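(* Suppose $\varphi\in\Phi_\alpha$ and $a\in A_\beta$ for some $\alpha\in(0,2)$ and $\beta\in\mathbb R$ with $\beta-\alpha>-1$, and that $a$ has linear growth. Let $X^{\varphi,a}$ be the Harris flow with infinitesimal covariance $\varphi$ and drift $a$. Then for all $C>0$, $t>0$, $$\mathbb E\,\#\{X^{\varphi,a}_{0,t}(u): u\in[-C,C]\}<\infty .$$
   Context: $D^\uparrow(\mathbb R)$ denotes the space of non-decreasing càdlàg functions $\mathbb R\to\mathbb R$ with the Skorokhod $J_1$ topology. A Harris flow $X^{\varphi,a}$ with infinitesimal covariance $\varphi$ (continuous) and drift $a$ (measurable) is a family $\{X^{\varphi,a}_{s,t}:0\le s\le t\}$ of $D^\uparrow(\mathbb R)$-valued random elements such that: (i) $X_{s,r}=X_{t,r}\circ X_{s,t}$ a.s. for $s\le t\le r$, $X_{s,s}=\mathrm{Id}$; (ii) increments over disjoint consecutive time intervals are independent; (iii) the law of $X_{s,t}$ is invariant under time shifts; (iv) $X_{0,h}\to\mathrm{Id}$ in probability as $h\to0+$; (v) for every $x,s$, $w_t(x,s)=X_{s,t}(x)-x-\int_s^ta(X_{s,r}(x))dr$ is a Wiener process from $0$ w.r.t. the filtration generated by the flow after time $s$; (vi) $\langle w(x,s),w(y,s)\rangle_t=\int_s^t\varphi(X_{s,r}(x)-X_{s,r}(y))dr$. Such a flow exists and is unique in law when $\varphi\in\Phi_*$ and $a$ is measurable of linear growth. $\Phi_*$: continuous symmetric strictly positive definite $\varphi$ with $\varphi(0)=1$, Lipschitz outside every neighborhood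 of $0$. For $\alpha\in(0,2]$, $\Phi_\alpha$ is the set of $\varphi\in\Phi_*$ for which there are $C_\varphi,\tilde C_\varphi>0$ with $1-\varphi(x)\ge C_\varphi|x|^\alpha$ for $|x|\le\tilde C_\varphi$. For $\beta\in\mathbb R$, $A_\beta$ is the set of measurable $a:\mathbb R\to\mathbb R$ for which there exist a non-negative continuous $\rho$ on $(0,\infty)$ and $C_\rho,\tilde C_\rho>0$ with $|a(x+y)-a(x)|\le\rho(y)$ for $x\in\mathbb R$, $y>0$; $\rho(x)\le C_\rho x^\beta$ for $x\in(0,\tilde C_\rho]$; and $\rho(x)\le C_\rho(1+|x|)$ for $x>0$. *)

(* Defs.v *)
From HB Require Import structures.
From mathcomp Require Import all_boot all_order all_algebra.
From mathcomp Require Import finmap all_classical all_reals all_analysis.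
Set Implicit Arguments. Unset Strict Implicit. Unset Printing Implicit Defensive.
Import Order.TTheory GRing.Theory Num.Theory.
Import numFieldNormedType.Exports.
Local Open Scope classical_set_scope.
Local Open Scope ring_scope.

Section deterministic.
Context {R : realType}.

(* element of D^uparrow(R): non-decreasing and cadlag (left limits exist
   automatically for monotone functions) *)
Definition nondecr_cadlag (f : R -> R) : Prop :=
  {homo f : x y / x <= y} /\ (forall x, f @ at_right x --> f x).

Definition Phi_star (phi : R -> R) : Prop :=
  continuous phi /\
  (forall x, phi (- x) = phi x) /\
  phi 0 = 1 /\
  (forall (n : nat) (xs : 'I_n -> R) (c : 'I_n -> R),
      injective xs -> (exists i, c i != 0) ->
      0 < \sum_(i < n) \sum_(j < n) c i * c j * phi (xs i - xs j)) /\
  (forall delta, 0 < delta -> exists L : R, forall x y,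
      delta <= `|x| -> delta <= `|y| -> `|phi x - phi y| <= L * `|x - y|).

Definition Phi_alpha (alpha : R) (phi : R -> R) : Prop :=
  Phi_star phi /\
  exists C Ct : R, 0 < C /\ 0 < Ct /\
    forall x, `|x| <= Ct -> C * (`|x| `^ alpha) <= 1 - phi x.

Definition A_beta (beta : R) (a : R -> R) : Prop :=
  measurable_fun setT a /\
  exists (rho : R -> R) (Cr Crt : R), 0 < Cr /\ 0 < Crt /\
    {within `]0, +oo[, continuous rho} /\
    (forall x, 0 < x -> 0 <= rho x) /\
    (forall x y, 0 < y -> `|a (x + y) - a x| <= rho y) /\
    (forall x, 0 < x -> x <= Crt -> rho x <= Cr * (x `^ beta)) /\
    (forall x, 0 < x -> rho x <= Cr * (1 + `|x|)).

Definition linear_growth (a : R -> R) : Prop :=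
  exists K : R, forall x, `|a x| <= K * (1 + `|x|).

Definition img_count (f : R -> R) (C : R) : \bar R :=
  let A := f @` `[- C, C] in
  if `[< finite_set A >] then ((#|` fset_set A|%fset)%:R)%:E else +oo%E.

End deterministic.

Section stochastic.
Context {R : realType} {d : measure_display} {T : measurableType d}.
Variable P : probability T R.

Definition sigma_gen (I : Type) (D : set I) (f : I -> T -> R) : set (set T) :=
  <<s \bigcup_(i in D) preimage_set_system setT (f i) measurable >>.

Definition indep_sigmas (n : nat) (G : 'I_n -> set (set T)) : Prop :=
  forall A : 'I_n -> set T, (forall i, G i (A i)) ->
    P (\bigcap_(i in [set: 'I_n]) A i) = (\prod_(i < n) P (A i))%E.

Definition flow_sigma (X : R -> R -> T -> R -> R) (s t : R) : set (set T) :=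
  sigma_gen [set p : R * R * R | s <= p.1.1 /\ p.1.1 <= p.1.2 /\ p.1.2 <= t]
            (fun p w => X p.1.1 p.1.2 w p.2).

Definition wiener_wrt (s : R) (F : R -> set (set T)) (W : R -> T -> R) : Prop :=
  {ae P, forall w, W s w = 0} /\
  {ae P, forall w, {within `[s, +oo[, continuous (fun t => W t w)}} /\
  (forall t, s <= t -> forall B : set R, measurable B -> F t (W t @^-1` B)) /\
  (forall u v, s <= u -> u < v -> forall A, F u A ->
     forall B : set R, measurable B ->
       P (A `&` [set w | B (W v w - W u w)]) =
       (P A * normal_prob 0 (Num.sqrt (v - u)) B)%E).

Definition martingale_wrt (s : R) (F : R -> set (set T)) (M : R -> T -> R) : Prop :=
  (forall t, s <= t -> forall B : set R, measurable B -> F t (M t @^-1` B)) /\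
  (forall t, s <= t -> P.-integrable setT (fun w => (M t w)%:E)) /\
  (forall u v, s <= u -> u <= v -> forall A, F u A ->
     (\int[P]_(w in A) (M v w - M u w)%:E = 0)%E).

Definition flow_w (a : R -> R) (X : R -> R -> T -> R -> R) (x s : R) : R -> T -> R :=
  fun t w => X s t w x - x -
    Rintegral lebesgue_measure `[s, t] (fun r => a (X s r w x)).

Definition HarrisFlow (phi a : R -> R) (X : R -> R -> T -> R -> R) : Prop :=
  (forall s t w, 0 <= s -> s <= t -> nondecr_cadlag (X s t w)) /\
  (forall s t x, 0 <= s -> s <= t -> measurable_fun setT (fun w => X s t w x)) /\
  (forall s, 0 <= s -> {ae P, forall w, X s s w = id}) /\
  (forall s t r, 0 <= s -> s <= t -> t <= r ->
     {ae P, forall w, X s r w = X t r w \o X s t w}) /\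
  (forall (n : nat) (ts : nat -> R), 0 <= ts 0%N -> (forall i, ts i <= ts i.+1) ->
     indep_sigmas (fun i : 'I_n =>
       sigma_gen setT (fun z w => X (ts i) (ts i.+1) w z))) /\
  (* (iii) time-shift invariance of the law of X_{s,t}
     (equality of all finite-dimensional distributions) *)
  (forall s t h, 0 <= s -> s <= t -> 0 <= h ->
     forall (n : nat) (xs : 'I_n -> R) (B : 'I_n -> set R),
       (forall i, measurable (B i)) ->
       P (\bigcap_(i in [set: 'I_n]) [set w | B i (X s t w (xs i))]) =
       P (\bigcap_(i in [set: 'I_n]) [set w | B i (X (s + h) (t + h) w (xs i))])) /\
  (* (iv) X_{0,h} -> Id in probability in J1 (i.e. locally uniformly,
     since Id is continuous) *)
  (forall N eps : R, 0 < eps ->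
     (fun h => P [set w | exists x, `|x| <= N /\ eps < `|X 0 h w x - x|])
       @ at_right 0 --> 0%E) /\
  (forall x s, 0 <= s -> {ae P, forall w, forall t, s <= t ->
     lebesgue_measure.-integrable `[s, t] (fun r => (a (X s r w x))%:E)}) /\
  (forall x y s, 0 <= s -> {ae P, forall w, forall t, s <= t ->
     lebesgue_measure.-integrable `[s, t]
       (fun r => (phi (X s r w x - X s r w y))%:E)}) /\
  (forall x s, 0 <= s -> wiener_wrt s (flow_sigma X s) (flow_w a X x s)) /\
  (* (vi) <w(x,s), w(y,s)>_t = int_s^t phi(X_{s,r}(x) - X_{s,r}(y)) dr *)
  (forall x y s, 0 <= s -> martingale_wrt s (flow_sigma X s)
     (fun t w => flow_w a X x s t w * flow_w a X y s t w -
        Rintegral lebesgue_measure `[s, t]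
          (fun r => phi (X s r w x - X s r w y)))).

End stochastic.

(* Main.v *)
Require Import Defs.
From HB Require Import structures.
From mathcomp Require Import all_boot all_order all_algebra.
From mathcomp Require Import finmap all_classical all_reals all_analysis.
From mathcomp Require Import measurable_realfun.
From mathcomp Require Import ring lra.
Set Implicit Arguments. Unset Strict Implicit. Unset Printing Implicit Defensive.
Import Order.TTheory GRing.Theory Num.Theory.
Import numFieldNormedType.Exports.
Local Open Scope classical_set_scope.
Local Open Scope ring_scope.

(** The number of values of the flow on [[-C, C]] is at most the lower limit of
    one plus the number of jumps along uniform grids, so by Fatou's lemma it is
    enough to bound P(X_t(x) < X_t(y)) by K (y - x).

    The gap Y = X(y) - X(x) is nonnegative, absorbed at 0, has a drift bounded by
    rho(Y) <= C1 Y^beta and a martingale part with bracket rate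
    2 (1 - phi(Y)) >= 2 C2 Y^alpha for small Y.  Ito's formula is replaced by an
    inequality: a second order Taylor bound and fourth moments show that for a
    suitable test function f the drift of f(Y) over a time step h is at most the
    integrated generator up to O(h^(3/2)), and this error disappears by
    subdivision.

    A concave perturbation of the identity, with derivative between 1 and 2, whose
    curvature compensates the drift since beta - alpha > -1, gives
    E Y_r <= 4 (y - x) for small r; when beta = 0 its generator is moreover at most
    a negative constant on Y > 0, and the bound follows.  Otherwise one may enlarge
    alpha so that 1 < alpha < 1 + beta; the generator of Y^g, g = 2 - alpha, is at
    most a negative constant on Y > 0, whence
    c (v - u) P(Y_v > 0) <= E Y_u^g + K (y - x).  Splitting
    Y^g <= kappa 1_(Y > 0) + kappa^(-k) Y and taking u = v / 2 closes the estimate on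
    sup_v v^(k+1) P(Y_v > 0). *)

(** * Real integrals and fourth moments *)

(** Orders of magnitude shape the Dynkin step. Over a step [h] the martingale part moves by
    [h^(1/2)] and the drift part by [h], so the cubic Taylor remainder, the mixed quadratic term and
    the cost of freezing the derivatives at the left end are all [O(h^(3/2))]; increments are only
    ever tested against functions of the process at the left end. The natural Lyapunov functions
    have derivatives that are singular at 0. Shifting the argument by [eps] spoils the generator
    only where [0 < Y < eps], and the time spent there vanishes with [eps] because a gap that has
    reached 0 is not counted. Short times stand in for Gronwall's lemma: a constant times [tau] is
    at most 1/2, so half of the unknown is absorbed on the left. Larger times follow because points
    that have met stay together. In the power case, the choice of [kappa] proportional to [v] gives
    [v P(Y_v > 0)] a bound by [v P(Y_u > 0)] and [v^(-k) (y - x)]; multiplying by [v^k] explains the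
    weight [v^(k+1)]. *)

Section real_integral.
Context {d : measure_display} {T : measurableType d} {R : realType}.
Variable mu : {measure set T -> \bar R}.
Variable D : set T.
Hypothesis mD : measurable D.
Implicit Types f g : T -> R.

Definition rint (f : T -> R) := mu.-integrable D (EFin \o f).

Lemma rint_measurable f : rint f -> measurable_fun D f.
Proof. by move=> /measurable_int /measurable_EFinP. Qed.

Lemma rintD f g : rint f -> rint g -> rint (fun x => f x + g x).
Proof.
move=> fi gi; have := integrableD mD fi gi.
by apply: eq_integrable.
Qed.

Lemma rintZ k f : rint f -> rint (fun x => k * f x).
Proof. by move=> fi; have := integrableZl mD k fi; apply: eq_integrable. Qed.

Lemma rintN f : rint f -> rint (fun x => - f x).
Proof. by move=> fi; have := integrableN fi; apply: eq_integrable. Qed.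

Lemma rintB f g : rint f -> rint g -> rint (fun x => f x - g x).
Proof. by move=> fi gi; apply: rintD => //; apply: rintN. Qed.

Lemma rint_le f g : measurable_fun D f ->
  (forall x, D x -> `|f x| <= g x) -> rint g -> rint f.
Proof.
move=> mf fg gi; apply: (le_integrable mD _ _ gi); first exact/measurable_EFinP.
move=> x Dx /=; rewrite lee_fin; apply: le_trans (fg _ Dx) _; exact: ler_norm.
Qed.

Lemma rint_abs f : rint f -> rint (fun x => `|f x|).
Proof.
move=> fi; apply: (@rint_le _ (fun x => `|f x|)).
- by apply: measurableT_comp => //; exact: rint_measurable.
- by move=> x _; rewrite normr_id.
- exact: integrable_norm.
Qed.

Lemma rint_ge0P f : measurable_fun D f -> (forall x, D x -> 0 <= f x) ->
  (\int[mu]_(x in D) (f x)%:E < +oo)%E -> rint f.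
Proof.
move=> mf f0 foo; apply/integrableP; split; first exact/measurable_EFinP.
rewrite (eq_integral (fun x => (f x)%:E))// => x /set_mem Dx /=.
by rewrite ger0_norm// f0.
Qed.

Lemma rint_fineK f : rint f ->
  (\int[mu]_(x in D) f x)%:E = (\int[mu]_(x in D) (f x)%:E)%E.
Proof. by move=> fi; rewrite /Rintegral fineK//; apply: integrable_fin_num. Qed.

Lemma rint_cst (k : R) : (mu D < +oo)%E -> rint (fun=> k).
Proof.
move=> Doo; apply: measurable_bounded_integrable => //.
exists `|k|; split; first exact: num_real.
by move=> M kM x _; exact: ltW.
Qed.

Lemma rint_sum (I : Type) (s : seq I) (h : I -> T -> R) :
  (forall i, rint (h i)) -> rint (fun x => \sum_(i <- s) h i x).
Proof.
move=> hi; elim: s => [|i s IH].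
  apply: eq_integrable (integrable0 mu D) => // x _ /=.
  by rewrite big_nil.
apply: (@eq_integrable _ _ _ _ _ mD (EFin \o (fun x => h i x + \sum_(j <- s) h j x))).
  by move=> x _ /=; rewrite big_cons.
exact: rintD.
Qed.

Lemma Rintegral_sum (I : Type) (s : seq I) (h : I -> T -> R) :
  (forall i, rint (h i)) ->
  \int[mu]_(x in D) (\sum_(i <- s) h i x) = \sum_(i <- s) \int[mu]_(x in D) h i x.
Proof.
move=> hi; elim: s => [|i s IH].
  rewrite big_nil; under eq_Rintegral do rewrite big_nil.
  by rewrite /Rintegral integral0.
rewrite big_cons -IH -(RintegralD mD (hi i) (rint_sum s hi)).
by apply: eq_Rintegral => x _; rewrite big_cons.
Qed.

End real_integral.

Lemma sqr_norm {R : realDomainType} (x : R) : `|x| ^+ 2 = x ^+ 2.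
Proof. by rewrite real_normK ?num_real. Qed.

(** * Fourth-moment bounds with an explicit scale *)

Section size4.
Context {d : measure_display} {T : measurableType d} {R : realType}.
Variable P : probability T R.
Implicit Types (f g F : T -> R) (k c C : R).

(** [k] carries the order of magnitude ([Num.sqrt (v - u)] for martingale increments, [v - u] for
    drift increments, 1 for values) and [C] a constant uniform in time, so that powers of the step
    length can be read off the scales. *)
Definition size4 k C g := measurable_fun setT g /\
  (\int[P]_w ((g w) ^+ 4)%:E <= (C * k ^+ 4)%:E)%E.

Lemma P_setT_lty : (P setT < +oo)%E.
Proof. by rewrite probability_setT ltry. Qed.

Lemma rintP_cst c : rint P setT (fun=> c).
Proof. by apply: rint_cst => //; exact: P_setT_lty. Qed.

Lemma Rintegral_Pcst c : \int[P]_w c = c.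
Proof. by rewrite Rintegral_cst//= probability_setT mulr1. Qed.

Lemma size4_rint k C g : size4 k C g -> rint P setT (fun w => g w ^+ 4).
Proof.
move=> [mg gC]; apply: rint_ge0P => //.
- exact: measurable_funX.
- by move=> x _; exact: exprn_even_ge0.
- exact: le_lt_trans gC (ltry _).
Qed.

Lemma size4_Rint k C g : size4 k C g -> \int[P]_w (g w ^+ 4) <= C * k ^+ 4.
Proof.
move=> sg; have [mg gC] := sg.
by rewrite -lee_fin rint_fineK//; exact: size4_rint sg.
Qed.

(** The bounds on products, first moments and third moments all come from this one domination by
    normalised fourth powers. It takes the place of Hölder's inequality and yields integrability at
    the same time. *)
Lemma size4_dom F f g k1 k2 C1 C2 c : measurable_fun setT F ->
  size4 k1 C1 f -> size4 k2 C2 g -> 0 < k1 -> 0 < k2 -> 0 <= c ->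
  (forall w, `|F w| <= c * (1 + (f w / k1) ^+ 4 + (g w / k2) ^+ 4)) ->
  rint P setT F /\ \int[P]_w `|F w| <= c * (1 + C1 + C2).
Proof.
move=> mF sf sg k10 k20 c0 Fd.
pose H w := c + (c / k1 ^+ 4 * f w ^+ 4 + c / k2 ^+ 4 * g w ^+ 4).
have if1 : rint P setT (fun w => c / k1 ^+ 4 * f w ^+ 4).
  by apply: rintZ => //; exact: size4_rint sf.
have ig1 : rint P setT (fun w => c / k2 ^+ 4 * g w ^+ 4).
  by apply: rintZ => //; exact: size4_rint sg.
have iH : rint P setT H.
  by apply: rintD => //; [exact: rintP_cst|exact: rintD].
have FH w : `|F w| <= H w.
  apply: le_trans (Fd w) _; rewrite /H !expr_div_n; lra.
have iF : rint P setT F by apply: rint_le iH.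
split => //; apply: (@le_trans _ _ (\int[P]_w H w)).
  by apply: le_Rintegral => //; exact: rint_abs.
rewrite /H RintegralD//; [|exact: rintP_cst|exact: rintD].
rewrite Rintegral_Pcst RintegralD// !RintegralZl//; last 2 first.
- exact: size4_rint sg.
- exact: size4_rint sf.
have h1 : c / k1 ^+ 4 * \int[P]_w (f w ^+ 4) <= c * C1.
  rewrite -mulrA ler_wpM2l// mulrC ler_pdivrMr ?exprn_gt0//.
  exact: size4_Rint sf.
have h2 : c / k2 ^+ 4 * \int[P]_w (g w ^+ 4) <= c * C2.
  rewrite -mulrA ler_wpM2l// mulrC ler_pdivrMr ?exprn_gt0//.
  exact: size4_Rint sg.
lra.
Qed.

Lemma size4_ge0 k C g : 0 < k -> size4 k C g -> 0 <= C.
Proof.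
move=> k0 [_ gC]; rewrite -(pmulr_lge0 _ (exprn_gt0 4 k0)) -lee_fin.
apply: le_trans gC; apply: integral_ge0 => x _.
by rewrite lee_fin exprn_even_ge0.
Qed.

Lemma size4_le k C f g : measurable_fun setT f ->
  (forall w, `|f w| <= `|g w|) -> size4 k C g -> size4 k C f.
Proof.
move=> mf fg [mg gC]; split => //; apply: le_trans gC.
apply: ge0_le_integral => //.
- by move=> x _; rewrite lee_fin exprn_even_ge0.
- by apply/measurable_EFinP; exact: measurable_funX.
- by apply/measurable_EFinP; exact: measurable_funX.
- move=> x _; rewrite lee_fin -[leLHS]ger0_norm ?exprn_even_ge0//.
  rewrite -[leRHS]ger0_norm ?exprn_even_ge0// !normrX.
  by rewrite lerXn2r ?nnegrE.
Qed.

Lemma size4_cst k c : 0 < k -> size4 k (c ^+ 4 / k ^+ 4) (fun=> c).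
Proof.
move=> k0; split => //.
by rewrite integral_cst//= probability_setT mule1 divfK// expf_neq0// gt_eqF.
Qed.

Lemma size4Z k C c g : size4 k C g -> size4 k (c ^+ 4 * C) (fun w => c * g w).
Proof.
move=> sg; have [mg gC] := sg; split; first exact: measurable_funM.
have i4 := size4_rint sg.
rewrite (eq_integral (fun w => (c ^+ 4 * g w ^+ 4)%:E)); last first.
  by move=> w _; rewrite exprMn.
rewrite -rint_fineK//; last exact: rintZ.
rewrite lee_fin RintegralZl// -mulrA ler_wpM2l ?exprn_even_ge0//.
exact: size4_Rint sg.
Qed.

Lemma size4N k C g : size4 k C g -> size4 k C (fun w => - g w).
Proof.
move=> sg; have [mg _] := sg; apply: size4_le sg; last by move=> w; rewrite normrN.
exact: measurableT_comp.
Qed.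

Lemma expr4D_le (a b : R) : (a + b) ^+ 4 <= 8 * (a ^+ 4 + b ^+ 4).
Proof.
have h x y : (x + y) ^+ 2 <= 2 * (x ^+ 2 + y ^+ 2) :> R.
  have := sqr_ge0 (x - y); nra.
rewrite (exprM (a + b) 2 2) (exprM a 2 2) (exprM b 2 2).
have := h (a ^+ 2) (b ^+ 2); have := h a b.
have := sqr_ge0 (a + b); have := sqr_ge0 a; have := sqr_ge0 b.
set X := (a + b) ^+ 2; set A := a ^+ 2; set B := b ^+ 2 => *; nra.
Qed.

Lemma size4D k C1 C2 f g : size4 k C1 f -> size4 k C2 g ->
  size4 k (8 * (C1 + C2)) (fun w => f w + g w).
Proof.
move=> sf sg; have [mf fC] := sf; have [mg gC] := sg.
split; first exact: measurable_funD.
have if4 := size4_rint sf; have ig4 := size4_rint sg.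
apply: (@le_trans _ _ (\int[P]_w (8 * (f w ^+ 4 + g w ^+ 4))%:E)%E).
  apply: ge0_le_integral => //.
  - by move=> x _; rewrite lee_fin exprn_even_ge0.
  - by apply/measurable_EFinP; apply: measurable_funX; exact: measurable_funD.
  - apply/measurable_EFinP; apply: measurable_funM => //.
    by apply: measurable_funD; exact: measurable_funX.
  - by move=> x _; rewrite lee_fin expr4D_le.
have iD : rint P setT (fun w => f w ^+ 4 + g w ^+ 4) by exact: rintD.
rewrite -rint_fineK ?lee_fin//; last exact: rintZ.
rewrite RintegralZl// RintegralD//.
have := size4_Rint sf; have := size4_Rint sg; lra.
Qed.

Lemma size4_subr k C k' g : 0 < k -> k <= k' -> size4 k C g -> size4 k' C g.
Proof.
move=> k0 kk sg; have C0 := size4_ge0 k0 sg; have [mg gC] := sg.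
split=> //; apply: le_trans gC _; rewrite lee_fin ler_wpM2l// lerXn2r ?nnegrE//.
  exact: ltW.
by rewrite ltW// (lt_le_trans k0).
Qed.

Lemma size4_leC k C C' g : 0 < k -> C <= C' -> size4 k C g -> size4 k C' g.
Proof.
move=> k0 kk sg; have C0 := size4_ge0 k0 sg; have [mg gC] := sg.
split=> //; apply: le_trans gC _; rewrite lee_fin ler_wpM2r//.
by rewrite exprn_ge0// ltW.
Qed.

Lemma mul_le_quartic (a b : R) : `|a * b| <= 1 + a ^+ 4 + b ^+ 4.
Proof.
rewrite normrM (exprM a 2 2) (exprM b 2 2) -(sqr_norm a) -(sqr_norm b).
move: (normr_ge0 a) (normr_ge0 b); set x := `|a|; set y := `|b| => x0 y0.
have := sqr_ge0 (x - y); have := sqr_ge0 (x ^+ 2 - 1).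
have := sqr_ge0 (y ^+ 2 - 1); have := sqr_ge0 x; have := sqr_ge0 y; nra.
Qed.

Lemma size4M f g k1 k2 C1 C2 : 0 < k1 -> 0 < k2 ->
  size4 k1 C1 f -> size4 k2 C2 g ->
  rint P setT (fun w => f w * g w) /\
  \int[P]_w `|f w * g w| <= k1 * k2 * (1 + C1 + C2).
Proof.
move=> k10 k20 sf sg; have [mf _] := sf; have [mg _] := sg.
apply: (size4_dom _ sf sg k10 k20).
- exact: measurable_funM.
- by rewrite mulr_ge0// ltW.
- move=> w; have := mul_le_quartic (f w / k1) (g w / k2) => h.
  rewrite (_ : f w * g w = (k1 * k2) * (f w / k1 * (g w / k2))); last first.
    by field; rewrite !gt_eqF.
  by rewrite normrM gtr0_norm ?mulr_gt0// ler_wpM2l// ltW// mulr_gt0.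
Qed.

Lemma size4_norm g k C : 0 < k -> size4 k C g ->
  rint P setT g /\ \int[P]_w `|g w| <= k * (1 + C).
Proof.
move=> k0 sg; have [mg _] := sg.
(* A single function is treated as a pair whose second member is 0. *)
have s0 : size4 1 0 (fun=> 0) by split => //; rewrite integral_cst//= expr0n/= mul0e mul0r.
have := @size4_dom g g (fun=> 0) k 1 C 0 k mg sg s0 k0 ltr01 (ltW k0).
rewrite !addr0; apply => w.
rewrite mul0r expr0n/= addr0.
have := mul_le_quartic (g w / k) 1.
rewrite expr1n mulr1 normrM normfV (gtr0_norm k0).
set q := g w / k => h.
have h4 : `|g w| / k <= 1 + q ^+ 4.
  have -> : `|g w| / k = `|q| by rewrite /q normrM normfV (gtr0_norm k0).
  rewrite (exprM q 2 2) -(sqr_norm q); have := normr_ge0 q.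
  set x := `|q| => x0; have := sqr_ge0 (x ^+ 2 - 1); have := sqr_ge0 (x - 1).
  nra.
by rewrite mulrC -ler_pdivrMr.
Qed.

Lemma size4_cube g k C : 0 < k -> size4 k C g ->
  rint P setT (fun w => `|g w| ^+ 3) /\ \int[P]_w (`|g w| ^+ 3) <= k ^+ 3 * (1 + C).
Proof.
move=> k0 sg; have [mg _] := sg.
have s0 : size4 1 0 (fun=> 0) by split => //; rewrite integral_cst//= expr0n/= mul0e mul0r.
have mF : measurable_fun setT (fun w => `|g w| ^+ 3).
  by apply: measurable_funX; exact: measurableT_comp.
have := @size4_dom _ g (fun=> 0) k 1 C 0 (k ^+ 3) mF sg s0 k0 ltr01 (exprn_ge0 _ (ltW k0)).
rewrite !addr0 => -[w|h1 h2].
  rewrite mul0r expr0n/= addr0 normrX normr_id.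
  set q := g w / k.
  have -> : `|g w| ^+ 3 = k ^+ 3 * `|q| ^+ 3.
    rewrite -exprMn /q normrM normfV (gtr0_norm k0); congr (_ ^+ 3).
    by field; rewrite gt_eqF.
  apply: ler_wpM2l; first exact/exprn_ge0/ltW.
  have -> : q ^+ 4 = `|q| ^+ 4 by rewrite (exprM q 2 2) -(sqr_norm q) -exprM.
  have := normr_ge0 q; set x := `|q| => x0.
  rewrite (exprS _ 3); have [x1|x1] := lerP x 1.
    by rewrite ler_wpDr ?mulr_ge0 ?exprn_ge0// exprn_ile1.
  by rewrite ler_wpDl// ler_peMl ?exprn_ge0// ltW.
split => //; apply: le_trans h2; apply: le_Rintegral => //.
- exact: rint_abs.
- by move=> w _; exact: ler_norm.
Qed.

End size4.

(** * Time integrals *)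

Section time_integral.
Context {R : realType}.
Notation leb := (@lebesgue_measure R).
Implicit Types (u v : R) (g : R -> R).

Lemma leb_itv u v : u <= v -> fine (leb `[u, v]) = v - u.
Proof.
rewrite le_eqVlt => /predU1P[->|uv]; first by rewrite set_itv1 lebesgue_measure_set1 subrr.
by rewrite lebesgue_measure_itv/= lte_fin uv -EFinB.
Qed.

Lemma leb_itv_lty u v : (leb `[u, v] < +oo)%E.
Proof. by rewrite lebesgue_measure_itv/=; case: ifP => // _; rewrite -EFinB ltry. Qed.

Lemma rint_itv_cst u v k : rint leb `[u, v] (fun=> k).
Proof. by apply: rint_cst => //; exact: leb_itv_lty. Qed.

Lemma Rintegral_itv_cst u v k : u <= v -> \int[leb]_(r in `[u, v]) k = k * (v - u).
Proof. by move=> uv; rewrite Rintegral_cst// leb_itv. Qed.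

Lemma rint_itv_bounded u v g b : measurable_fun `[u, v] g ->
  (forall r, u <= r <= v -> `|g r| <= b) -> rint leb `[u, v] g.
Proof.
move=> mg gb; apply: (@rint_le _ _ _ _ _ _ _ (fun=> b)) => //; last exact: rint_itv_cst.

Qed.

Lemma le_Rintegral_itv u v f g : rint leb `[u, v] f -> rint leb `[u, v] g ->
  (forall r, u <= r <= v -> f r <= g r) ->
  \int[leb]_(r in `[u, v]) f r <= \int[leb]_(r in `[u, v]) g r.
Proof.
move=> fi gi fg; apply: le_Rintegral => // x /=; rewrite in_itv/=; exact: fg.
Qed.

Lemma Rintegral_itv_le_cst u v g b : u <= v -> rint leb `[u, v] g ->
  (forall r, u <= r <= v -> g r <= b) ->
  \int[leb]_(r in `[u, v]) g r <= b * (v - u).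
Proof.
move=> uv gi gb; rewrite -Rintegral_itv_cst//.
by apply: le_Rintegral_itv => //; exact: rint_itv_cst.
Qed.

Lemma Rintegral_itv_cat u t v g : u <= t -> t <= v -> rint leb `[u, v] g ->
  \int[leb]_(r in `[u, v]) g r =
  \int[leb]_(r in `[u, t]) g r + \int[leb]_(r in `[t, v]) g r.
Proof.
move=> ut tv gi.
have -> : `[u, v]%classic = `[u, t]%classic `|` `]t, v]%classic.
  by rewrite -itv_bndbnd_setU// bnd_simp.
have e : `[u, t]%classic `|` `]t, v]%classic = `[u, v]%classic.
  by rewrite -itv_bndbnd_setU// bnd_simp.
rewrite Rintegral_setU ?e//; last first.
  apply/disj_setPRL => x /=; rewrite !in_itv/= => /andP[tx _] /andP[_ xt].
  by rewrite ltNge xt in tx.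
congr (_ + _).
rewrite Rintegral_itv_obnd_cbnd//.
by apply: integrableS gi => //; apply: subset_itvr; rewrite bnd_simp.
Qed.

(** Jensen's inequality for the fourth power, obtained by integrating the tangent line of [x^4] at
    the mean value [l] of [g]; the distance to the tangent is a square times a sum of squares. *)
Lemma jensen4 u v g : u < v -> rint leb `[u, v] g ->
  rint leb `[u, v] (fun r => g r ^+ 4) ->
  (\int[leb]_(r in `[u, v]) g r) ^+ 4 <=
  (v - u) ^+ 3 * \int[leb]_(r in `[u, v]) (g r ^+ 4).
Proof.
move=> uv gi g4i; set h := v - u; have h0 : 0 < h by rewrite subr_gt0.
set S := \int[leb]_(r in _) g r; pose l := S / h.
have Sl : S = l * h by rewrite /l divfK// gt_eqF.
have key : \int[leb]_(r in `[u, v]) (4 * l ^+ 3 * g r - 3 * l ^+ 4) <=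
           \int[leb]_(r in `[u, v]) (g r ^+ 4).
  apply: le_Rintegral_itv => //.
    exact: rintB (rintZ _ _ gi) (rint_itv_cst _ _ _).
  move=> r _; rewrite -subr_ge0.
  have -> : g r ^+ 4 - (4 * l ^+ 3 * g r - 3 * l ^+ 4) =
    (g r - l) ^+ 2 * ((g r + l) ^+ 2 + 2 * l ^+ 2) by ring.
  have := sqr_ge0 (g r - l); have := sqr_ge0 (g r + l); have := sqr_ge0 l; nra.
move: key; rewrite (RintegralB _ (rintZ _ _ gi) (rint_itv_cst _ _ _))//.
rewrite RintegralZl// (Rintegral_itv_cst _ (ltW uv)) -/S -/h Sl.
set J := Rintegral _ _ _ => key.
rewrite exprMn (_ : l ^+ 4 * h ^+ 4 = h ^+ 3 * (l ^+ 4 * h)); last by ring.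
apply: ler_wpM2l; first exact/exprn_ge0/ltW.
apply: le_trans key; rewrite le_eqVlt; apply/orP; left; apply/eqP; ring.
Qed.

Context {d : measure_display} {T : measurableType d}.
Variable P : probability T R.
Implicit Types (G : R * T -> R).

Lemma measurable_section1 G w : measurable_fun setT G ->
  measurable_fun setT (fun r => G (r, w)).
Proof. by move=> mG; exact: (measurableT_comp mG (pair2_measurable w)). Qed.

Lemma measurable_section2 G r : measurable_fun setT G ->
  measurable_fun setT (fun w => G (r, w)).
Proof. by move=> mG; exact: (measurableT_comp mG (pair1_measurable r)). Qed.

(** The pathwise hypothesis makes the inner time integrals genuine real integrals; the bound [c],
    uniform over the compact time interval, gives integrability for the product measure. *)
Lemma time_Fubini G u v c : measurable_fun setT G -> u <= v ->
  (forall w, rint leb `[u, v] (fun r => G (r, w))) ->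
  (forall r, u <= r <= v -> rint P setT (fun w => G (r, w)) /\
     \int[P]_w `|G (r, w)| <= c) ->
  [/\ rint P setT (fun w => \int[leb]_(r in `[u, v]) G (r, w)),
      rint leb `[u, v] (fun r => \int[P]_w G (r, w)) &
      \int[P]_w \int[leb]_(r in `[u, v]) G (r, w) =
      \int[leb]_(r in `[u, v]) \int[P]_w G (r, w)].
Proof.
move=> mG uv path bnd; pose I := `[u, v]%classic : set R.
have mI : measurable I by exact: measurable_itv.
(* Extension by 0 outside the time interval lets Fubini's theorem be applied on the whole product
   space. *)
pose f (z : R * T) : \bar R := (G z * \1_I z.1)%:E.
have mf : measurable_fun setT f.
  apply/measurable_EFinP; apply: measurable_funM => //.
  by apply: measurableT_comp => //; exact: measurable_indic.
have fI (r : R) w : I r -> f (r, w) = (G (r, w))%:E.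
  by move=> Ir; rewrite /f/= indicE mem_set// mulr1.
have fnI (r : R) w : ~ I r -> f (r, w) = 0%E.
  by move=> Ir; rewrite /f/= indicE memNset// mulr0.
have E1 w : (\int[leb]_r f (r, w) = (\int[leb]_(r in I) G (r, w))%:E)%E.
  rewrite rint_fineK; [|by []|exact: path].
  rewrite [RHS]integral_mkcond; apply: eq_integral => r _.
  rewrite patchE; case: ifPn => [/set_mem/fI//|/negP h].
  by rewrite fnI// => Ir; apply: h; rewrite mem_set.
have E2 : (fun r => \int[P]_w f (r, w))%E =
          (fun r => (\int[P]_w G (r, w))%:E)%E \_ I.
  apply/funext => r; rewrite patchE; case: ifPn => [/set_mem Ir|/negP h].
    rewrite rint_fineK//; last by apply bnd; move: Ir; rewrite /I/= in_itv.
    by apply: eq_integral => w _; rewrite fI.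
  rewrite (eq_integral (cst 0%E)) ?integral0// => w _.
  by rewrite fnI// => Ir; apply: h; rewrite mem_set.
have imf : (leb \x P)%E.-integrable setT f.
  apply/integrable12ltyP => //.
  apply: (@le_lt_trans _ _ (\int[leb]_(r in I) c%:E)%E); last first.
    by rewrite integral_cst//=; rewrite lte_mul_pinfty//; [|exact: leb_itv_lty];
      rewrite lee_fin; have [_] := bnd u ltac:(by rewrite lexx uv);
      apply: le_trans; apply: Rintegral_ge0.
  rewrite [leRHS]integral_mkcond; apply: ge0_le_integral => //.
  - by move=> r _; apply: integral_ge0 => w _; exact: abse_ge0.
  - by apply: (measurable_fun_fubini_tonelli_F (abse \o f)); [exact: measurableT_comp|move=> z; exact: abse_ge0].
  - by apply/measurable_restrict => //; rewrite setTI.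
  - move=> r _; rewrite patchE; case: ifPn => [/set_mem Ir|/negP h].
      have [bi bc] := bnd r ltac:(by move: Ir; rewrite /I/= in_itv).
      have -> : (\int[P]_w `|f (r, w)| = (\int[P]_w `|G (r, w)|)%:E)%E.
        rewrite rint_fineK//; last exact: rint_abs.
        by apply: eq_integral => w _; rewrite fI.
      by rewrite lee_fin.
    rewrite (eq_integral (cst 0%E)) ?integral0// => w _.
    by rewrite fnI ?abse0// => Ir; apply: h; rewrite mem_set.
have i1 := integrable_fubini_F imf.
have F12 := Fubini imf.
have m2 := measurable_fubini_G imf.
have i2 : P.-integrable setT (fubini_G leb f).
  apply/integrableP; split => //.
  have /integrable21ltyP := imf => /(_ mf); apply: le_lt_trans.
  apply: ge0_le_integral => //.
  - exact: measurableT_comp.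
  - by apply: (@measurable_fun_fubini_tonelli_G _ _ _ _ R leb (abse \o f)); [exact: measurableT_comp|move=> z; exact: abse_ge0].
  - move=> w _; apply: le_abse_integral => //.
    by apply: measurableT_comp => //; exact: pair2_measurable.
have e2 : fubini_G leb f = (fun w => (\int[leb]_(r in I) G (r, w))%:E).
  by apply/funext => w; rewrite /fubini_G E1.
split.
- by move: i2; rewrite e2.
- move: i1; rewrite /fubini_F E2 => i1.
  exact: (proj2 (integrable_mkcond (mu:=leb) (fun r => (\int[P]_w G (r, w))%:E) mI)) i1.
- rewrite /Rintegral; congr fine.
  transitivity (\int[P]_w \int[leb]_r f (r, w))%E.
    by apply: eq_integral => w _; rewrite E1.
  by rewrite -F12 E2 -integral_mkcond.
Qed.

(** By [jensen4] the fourth power of the integral costs [(v - u)^3] times the time integral of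
    [G^4], whose mean Fubini bounds by [C * (v - u)]. *)
Lemma size4_time G u v C : measurable_fun setT G -> u < v ->
  (forall w, exists b, forall r, u <= r <= v -> `|G (r, w)| <= b) ->
  (forall r, u <= r <= v -> size4 P 1 C (fun w => G (r, w))) ->
  size4 P (v - u) C (fun w => \int[leb]_(r in `[u, v]) G (r, w)).
Proof.
move=> mG uv bG sG; have h0 : 0 < v - u by rewrite subr_gt0.
have p1 w : rint leb `[u, v] (fun r => G (r, w)).
  have [b Gb] := bG w; apply: (rint_itv_bounded _ Gb).
  by apply: measurable_funTS; exact: measurable_section1.
have mG4 : measurable_fun setT (fun z => G z ^+ 4) by exact: measurable_funX.
have p4 w : rint leb `[u, v] (fun r => G (r, w) ^+ 4).
  have [b Gb] := bG w; apply: (@rint_itv_bounded _ _ _ (b ^+ 4)).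
    by apply: measurable_funTS; exact: (measurable_section1 w mG4).
  move=> r /Gb h; rewrite normrX lerXn2r// ?nnegrE//.
  exact: le_trans h.
have [i1 _ _] := @time_Fubini G u v (1 * (1 + C)) mG (ltW uv) p1
  (fun r hr => size4_norm ltr01 (sG r hr)).
have b4 r : u <= r <= v -> rint P setT (fun w => G (r, w) ^+ 4) /\
    \int[P]_w `|G (r, w) ^+ 4| <= C.
  move=> hr; split; first exact: size4_rint (sG r hr).
  under eq_Rintegral do rewrite ger0_norm ?exprn_even_ge0//.
  by have := size4_Rint (sG r hr); rewrite expr1n mulr1.
have [i4 j4 e4] := @time_Fubini (fun z => G z ^+ 4) u v C mG4 (ltW uv) p4 b4.
split; first exact: rint_measurable i1.
apply: (@le_trans _ _ (\int[P]_w ((v - u) ^+ 3 * \int[leb]_(r in `[u, v]) (G (r, w) ^+ 4))%:E)%E).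
  apply: ge0_le_integral => //.
  - by move=> w _; rewrite lee_fin exprn_even_ge0.
  - by apply/measurable_EFinP; apply: measurable_funX; exact: rint_measurable i1.
  - apply/measurable_EFinP; apply: measurable_funM => //; exact: rint_measurable i4.
  - by move=> w _; rewrite lee_fin; exact: jensen4.
rewrite -rint_fineK//; last exact: rintZ.
rewrite lee_fin RintegralZl// e4.
rewrite (_ : C * (v - u) ^+ 4 = (v - u) ^+ 3 * (C * (v - u))); last by ring.
apply: ler_wpM2l; first exact/exprn_ge0/ltW.
apply: Rintegral_itv_le_cst => //; first exact: ltW.
move=> r hr; have := size4_Rint (sG r hr); rewrite expr1n mulr1; exact.
Qed.

End time_integral.

Section time_integral_bounds.
Context {R : realType}.
Notation leb := (@lebesgue_measure R).

Lemma rint_itv_le (u v : R) (f g : R -> R) : measurable_fun `[u, v] f ->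
  (forall r, u <= r <= v -> `|f r| <= g r) -> rint leb `[u, v] g ->
  rint leb `[u, v] f.
Proof.
move=> mf fg gi.
have mf' : measurable_fun (`[u, v]%classic : set (measurableTypeR R)) f by exact: mf.
exact: (rint_le _ mf' _ gi).
Qed.

Lemma rint_itv_affine (u v a b : R) (g : R -> R) : rint leb `[u, v] g ->
  rint leb `[u, v] (fun r => a * (b + g r)).
Proof.
move=> gi; apply: rintZ => //; apply: rintD => //; exact: rint_itv_cst.
Qed.

End time_integral_bounds.

(** * The Dynkin inequality *)

Section subdivision.
Context {R : realType}.
Notation leb := (@lebesgue_measure R).

(* An error of order (v - u)^(3/2) on each increment is killed by subdividing. *)
Lemma subdivision (tau : R) (Phi Gam : R -> R) (c : R) :
  rint leb `[0, tau] Gam ->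
  (forall u v, 0 <= u -> u < v -> v <= tau ->
    Phi v - Phi u <= \int[leb]_(r in `[u, v]) Gam r + c * Num.sqrt (v - u) ^+ 3) ->
  forall u v, 0 <= u -> u <= v -> v <= tau ->
    Phi v - Phi u <= \int[leb]_(r in `[u, v]) Gam r.
Proof.
move=> iG step u v u0; rewrite le_eqVlt => /predU1P[->|uv] vt.
  by rewrite subrr set_itv1 Rintegral_set1.
have many h n : 0 < h -> u + n%:R * h <= tau ->
    Phi (u + n%:R * h) - Phi u <=
    \int[leb]_(r in `[u, u + n%:R * h]) Gam r + n%:R * (c * Num.sqrt h ^+ 3).
  move=> h0; elim: n => [|n IH] nt.
    by rewrite !mul0r !addr0 subrr set_itv1 Rintegral_set1.
  have e : u + n.+1%:R * h - (u + n%:R * h) = h by rewrite -natr1; ring.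
  have nn : u + n%:R * h < u + n.+1%:R * h by rewrite -subr_gt0 e.
  have un : u <= u + n%:R * h by rewrite lerDl mulr_ge0// ltW.
  have := step _ _ (le_trans u0 un) nn nt; rewrite e.
  have := IH (le_trans (ltW nn) nt).
  rewrite (@Rintegral_itv_cat _ u (u + n%:R * h) (u + n.+1%:R * h))//; last 2 first.
  - exact: ltW.
  - apply: integrableS iG => //; apply: subset_itv; by rewrite bnd_simp.
  rewrite -[n.+1%:R in X in _ -> _ -> _ <= _ + X]natr1 mulrDl mul1r; lra.
apply/ler_addgt0Pr => e e0.
set S := Num.sqrt (v - u).
have vu0 : 0 < v - u by rewrite subr_gt0.
have S2 : S ^+ 2 = v - u by rewrite sqr_sqrtr// ltW.
(* The number of pieces is a perfect square [k^2], so the square root of the step is [S / k] and the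
   total error is [c * S^3 / k]. *)
have [k k0 hke] : exists2 k : nat, 0 < k%:R :> R & `|c * S ^+ 3| / e <= k%:R.
  exists (Num.truncn (`|c * S ^+ 3| / e)).+1; first by rewrite ltr0n.
  by apply: ltW; exact: truncnS_gt.
have [N Nk] : exists N : nat, N%:R = k%:R ^+ 2 :> R by exists (k ^ 2)%N; rewrite natrX.
set h := (v - u) / k%:R ^+ 2.
have h0 : 0 < h by rewrite divr_gt0// exprn_gt0.
have hk : h = (S / k%:R) ^+ 2 by rewrite expr_div_n S2.
have ev : u + N%:R * h = v.
  rewrite Nk /h mulrC divfK; first by rewrite addrC subrK.
  by rewrite expf_neq0// gt_eqF.
have := many h N h0; rewrite ev => /(_ vt) hm; apply: le_trans hm _.
rewrite lerD2l hk sqrtr_sqr ger0_norm ?divr_ge0 ?sqrtr_ge0 ?(ltW k0)//.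
have -> : N%:R * (c * (S / k%:R) ^+ 3) = c * S ^+ 3 / k%:R.
  by rewrite Nk; field; rewrite gt_eqF.
rewrite ler_pdivrMr// [e * _]mulrC -ler_pdivrMr//.
apply: le_trans hke.
by rewrite ler_wpM2r ?invr_ge0 ?ler_norm// ltW.
Qed.

End subdivision.

Section arithmetic.
Context {R : realFieldType}.
Implicit Types (a b c : R).

(** [pB] and [pM] are [p] times the drift and martingale increments, [sMM], [sBM], [sBB] the
    quadratic terms, [KD] the cubic one, [pI] and [I2] the time integrals of [p * rho] and [s * m].
    [I2] is added and subtracted to pair [sMM] with its compensator. *)
Lemma taylor_arith (fu pB pM sMM sBM sBB KD pI I2 KsBM KsBB : R) :
  pB <= pI -> sBM <= KsBM -> sBB <= KsBB ->
  fu + (pB + pM) + (2^-1 * sMM + sBM + 2^-1 * sBB) + KD <=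
  fu + ((pI + I2 + (2^-1 * sMM - I2)) + (pM + (KsBM + (2^-1 * KsBB + KD)))).
Proof. lra. Qed.

Lemma error_arith (Fu Fv G1 G0 e1 e2 e3 a1 a2 a3 a4 k3 : R) :
  Fv <= Fu + (G1 + (e1 + (e2 + e3))) -> e1 <= a1 * k3 -> e2 <= a2 * k3 ->
  e3 <= a3 * k3 -> G1 <= G0 + a4 * k3 ->
  Fv - Fu <= G0 + (a1 + a2 + a3 + a4) * k3.
Proof. lra. Qed.

End arithmetic.

Section dynkin.
Context {R : realType} {d : measure_display} {T : measurableType d}.
Variable P : probability T R.
Notation leb := (@lebesgue_measure R).

(* What is used of a semimartingale [Y] with martingale part [M], drift at most
   [rho (Y r)] and bracket rate [2 * m (Y r)]. *)
Record diff_proc (tau delta : R) (rho m : R -> R) (Cb C4 : R)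
    (Y M : R -> T -> R) : Prop := {
  dp_mY : measurable_fun setT (fun z : R * T => Y z.1 z.2) ;
  dp_mM : measurable_fun setT (fun z : R * T => M z.1 z.2) ;
  dp_Y0 : forall r w, 0 <= Y r w ;
  dp_bdY : forall w, exists b, forall r, 0 <= r <= tau -> `|Y r w| <= b ;
  dp_bdM : forall w, exists b, forall r, 0 <= r <= tau -> `|M r w| <= b ;
  dp_drift : forall u v w, 0 <= u -> u <= v -> v <= tau ->
    `|Y v w - Y u w - (M v w - M u w)| <= \int[leb]_(r in `[u, v]) rho (Y r w) ;
  dp_init : forall w, Y 0 w <= delta ;
  dp_init0 : forall w, M 0 w = 0 ;
  dp_mart : forall u v (q : R -> R) b, 0 <= u -> u <= v -> v <= tau ->
    measurable_fun setT q -> (forall x, `|q x| <= b) ->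
    \int[P]_w (q (Y u w) * (M v w - M u w)) = 0 ;
  dp_quad : forall u v (q : R -> R) b, 0 <= u -> u <= v -> v <= tau ->
    measurable_fun setT q -> (forall x, `|q x| <= b) ->
    \int[P]_w (q (Y u w) * (M v w - M u w) ^+ 2) =
    2 * \int[P]_w (q (Y u w) * \int[leb]_(r in `[u, v]) m (Y r w)) ;
  dp_four : forall u v, 0 <= u -> u < v -> v <= tau ->
    size4 P (Num.sqrt (v - u)) C4 (fun w => M v w - M u w) ;
  dp_mrho : measurable_fun setT rho ;
  dp_mm : measurable_fun setT m ;
  dp_rho : forall x, 0 <= x -> 0 <= rho x <= Cb * (1 + x) ;
  dp_m : forall x, 0 <= m x <= 2 }.

Lemma size4_rescale k k' C C' (g : T -> R) : C * k ^+ 4 <= C' * k' ^+ 4 ->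
  size4 P k C g -> size4 P k' C' g.
Proof.
by move=> h [mg gC]; split => //; apply: le_trans gC _; rewrite lee_fin.
Qed.

Lemma sqrt_pow4 (x : R) : 0 <= x -> Num.sqrt x ^+ 4 = x ^+ 2.
Proof. by move=> x0; rewrite (exprM _ 2 2) sqr_sqrtr. Qed.

Variables (tau delta : R) (rho m : R -> R) (Cb C4 : R) (Y M : R -> T -> R).
Hypothesis tau0 : 0 < tau.
Hypothesis delta0 : 0 <= delta.
Hypothesis Cb0 : 0 <= Cb.
Hypothesis Cbtau : Cb * tau <= 2^-1.
Hypothesis DP : diff_proc tau delta rho m Cb C4 Y M.

Let mYr r : measurable_fun setT (Y r).
Proof. exact: (measurable_section2 r (dp_mY DP)). Qed.
Let mMr r : measurable_fun setT (M r).
Proof. exact: (measurable_section2 r (dp_mM DP)). Qed.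
Let mYw w : measurable_fun setT (fun r => Y r w).
Proof. exact: (measurable_section1 w (dp_mY DP)). Qed.
Let rY u v w : 0 <= u -> v <= tau -> rint leb `[u, v] (fun r => Y r w).
Proof.
move=> u0 vt; have [b Yb] := dp_bdY DP w.
apply: (@rint_itv_bounded _ _ _ _ b); first exact: measurable_funTS.
move=> r /andP[ur rv]; apply: Yb.
by rewrite (le_trans u0 ur) (le_trans rv vt).
Qed.

Let raM u v w : 0 <= u -> v <= tau -> rint leb `[u, v] (fun r => `|M r w|).
Proof.
move=> u0 vt; have [b Yb] := dp_bdM DP w.
apply: (@rint_itv_bounded _ _ _ _ b).
  by apply: measurable_funTS; apply: measurableT_comp => //; exact: (measurable_section1 w (dp_mM DP)).
move=> r /andP[ur rv]; rewrite normr_id; apply: Yb.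
by rewrite (le_trans u0 ur) (le_trans rv vt).
Qed.

Let rrho u v w : 0 <= u -> v <= tau -> rint leb `[u, v] (fun r => rho (Y r w)).
Proof.
move=> u0 vt; apply: (@rint_itv_le _ _ _ _ (fun r => Cb * (1 + Y r w))).
- by apply: measurable_funTS; exact: (measurableT_comp (dp_mrho DP) (mYw w)).
- move=> r _; have /andP[h1 h2] := dp_rho DP (dp_Y0 DP r w).
  by rewrite ger0_norm.
- by apply: rint_itv_affine; exact: rY.
Qed.

(** Integrating the drift bound over [[0, tau]] bounds the time integral [J] of [Y] by
    [Cb * tau * J] plus known terms, and [Cb * tau <= 2^-1] absorbs the first. The outcome is linear
    in the path of [M], so fourth moments pass from [M] to [Y]. *)
Lemma dp_gronwall r w : 0 <= r <= tau ->
  Y r w <= delta + Cb * tau + `|M r w| +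
    2 * Cb * (tau * (delta + Cb * tau) + \int[leb]_(q in `[0, tau]) `|M q w|).
Proof.
pose J := \int[leb]_(q in `[0, tau]) Y q w.
pose I := \int[leb]_(q in `[0, tau]) `|M q w|.
have J0 : 0 <= J by apply: Rintegral_ge0 => q _; exact: dp_Y0 DP _ _.
have step q : 0 <= q <= tau -> Y q w <= delta + Cb * tau + Cb * J + `|M q w|.
  move=> /andP[q0 qt].
  have := dp_drift DP w (lexx 0) q0 qt; rewrite (dp_init0 DP) subr0.
  move=> /(le_trans (ler_norm _)) h.
  have Yi := dp_init DP w; have Ml := ler_norm (M q w).
  have : \int[leb]_(r in `[0, q]) rho (Y r w) <= Cb * tau + Cb * J.
    apply: (@le_trans _ _ (\int[leb]_(r in `[0, q]) (Cb * (1 + Y r w)))).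
      apply: le_Rintegral_itv; first exact: rrho.
        by apply: rint_itv_affine; exact: rY.
      by move=> x _; have /andP[] := dp_rho DP (dp_Y0 DP x w).
    rewrite RintegralZl//; last first.
      by apply: rintD => //; [exact: rint_itv_cst|exact: rY].
    rewrite RintegralD//; [|exact: rint_itv_cst|exact: rY].
    rewrite Rintegral_itv_cst// mul1r subr0 -mulrDr.
    apply: ler_wpM2l => //; apply: lerD => //.
    rewrite /J (@Rintegral_itv_cat _ 0 q tau)//; last exact: rY.
    by rewrite lerDl; apply: Rintegral_ge0 => x _; exact: dp_Y0 DP _ _.
  move: h; lra.
have JI : J <= (delta + Cb * tau + Cb * J) * tau + I.
  rewrite [in X in X <= _]/J /I.
  set A := delta + Cb * tau + Cb * J.
  have -> : A * tau = \int[leb]_(q in `[0, tau]) A.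
    by rewrite Rintegral_itv_cst ?subr0// ltW.
  rewrite -RintegralD//; [|exact: rint_itv_cst|exact: raM].
  apply: le_Rintegral_itv => //; first exact: rY.
  by apply: rintD => //; [exact: rint_itv_cst|exact: raM].
move=> hr; apply: le_trans (step r hr) _; rewrite -/I.
have : Cb * J * tau <= 2^-1 * J by rewrite mulrAC ler_wpM2r.
move=> h; have h2 : J <= 2 * (tau * (delta + Cb * tau) + I) by move: JI h; lra.
have : Cb * J <= Cb * (2 * (tau * (delta + Cb * tau) + I)) by rewrite ler_wpM2l.
lra.
Qed.

Lemma dp_size4M r : 0 <= r <= tau -> size4 P 1 (C4 * tau ^+ 2) (M r).
Proof.
move=> /andP[]; rewrite le_eqVlt => /predU1P[<- _|r0 rt].
  have sM := dp_four DP (lexx 0) tau0 (lexx _).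
  rewrite subr0 in sM.
  have C40 : 0 <= C4 by apply: size4_ge0 sM; rewrite sqrtr_gt0.
  apply: (@size4_rescale 1 1 0); first by rewrite expr1n !mulr1 mulr_ge0 ?sqr_ge0.
  split; first exact: mMr.
  under eq_integral do rewrite (dp_init0 DP) expr0n/=.
  by rewrite integral0 mul0r.
have := dp_four DP (lexx 0) r0 rt; rewrite subr0 => sM.
have C40 : 0 <= C4 by apply: size4_ge0 sM; rewrite sqrtr_gt0.
apply: (@size4_rescale (Num.sqrt r) 1 C4).
  rewrite (sqrt_pow4 (ltW r0)) expr1n mulr1; apply: ler_wpM2l => //.
  by rewrite lerXn2r ?nnegrE// ltW.
apply: size4_le sM; first exact: mMr.
by move=> w; rewrite (dp_init0 DP) subr0.
Qed.

Lemma dp_size4Y : exists C, forall r, 0 <= r <= tau -> size4 P 1 C (Y r).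
Proof.
pose G (z : R * T) := `|M z.1 z.2|.
have mG : measurable_fun setT G by apply: measurableT_comp => //; exact: dp_mM DP.
have s1 : size4 P (tau - 0) (C4 * tau ^+ 2) (fun w => \int[leb]_(q in `[0, tau]) G (q, w)).
  apply: size4_time => //.
    by move=> w; have [b Mb] := dp_bdM DP w; exists b => r /Mb; rewrite /G/= normr_id.
  move=> r hr; apply: size4_le (dp_size4M hr); last by move=> w; rewrite normr_id.
  exact: (measurableT_comp _ (mMr r)).
pose c0 := delta + Cb * tau + 2 * Cb * (tau * (delta + Cb * tau)).
have s2 := size4Z (2 * Cb) s1; rewrite subr0 in s2.
set K2 := (X in size4 P _ X _) in s2.
have {}s2 : size4 P 1 (K2 * tau ^+ 4) (fun w => 2 * Cb * \int[leb]_(q in `[0, tau]) G (q, w)).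
  by apply: size4_rescale s2; rewrite expr1n mulr1.
have s3 := size4_cst P c0 ltr01.
eexists => r hr.
have sA : size4 P 1 (C4 * tau ^+ 2) (fun w => `|M r w|).
  apply: size4_le (dp_size4M hr); last by move=> w; rewrite normr_id.
  exact: (measurableT_comp _ (mMr r)).
apply: size4_le (size4D (size4D s3 sA) s2) => //.
move=> w; rewrite ger0_norm; last exact: dp_Y0 DP _ _.
apply: le_trans (ler_norm _); apply: le_trans (dp_gronwall w hr) _.
rewrite /G/= /c0; lra.
Qed.

(** The scale is [v - u], against [Num.sqrt (v - u)] for the martingale part: this is what makes the
    product of the two increments of order 3/2. *)
Lemma dp_size4_drift : exists C, forall u v, 0 <= u -> u < v -> v <= tau ->
  size4 P (v - u) C (fun w => Y v w - Y u w - (M v w - M u w)).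
Proof.
have [CY sY] := dp_size4Y.
pose G (z : R * T) := Cb * (1 + Y z.1 z.2).
have mG : measurable_fun setT G.
  by apply: measurable_funM => //; apply: measurable_funD => //; exact: dp_mY DP.
eexists => u v u0 uv vt.
have sG := size4_time (P := P) (C := Cb ^+ 4 * (8 * (1 ^+ 4 / 1 ^+ 4 + CY))) mG uv.
apply: size4_le (sG _ _).
- by apply: measurable_funB; apply: measurable_funB.
- move=> w; apply: le_trans (dp_drift DP w u0 (ltW uv) vt) _.
  apply: le_trans (ler_norm _); apply: le_Rintegral_itv; first exact: rrho.
    by apply: rint_itv_affine; exact: rY.
  by move=> x _; have /andP[] := dp_rho DP (dp_Y0 DP x w).
- move=> w; have [b Yb] := dp_bdY DP w; exists (Cb * (1 + b)) => r /andP[ur rv].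
  have hr : 0 <= r <= tau by rewrite (le_trans u0 ur) (le_trans rv vt).
  rewrite /G/= normrM (ger0_norm Cb0) ler_wpM2l//.
  by apply: le_trans (ler_normD _ _) _; rewrite normr1 lerD2l Yb.
- move=> r /andP[ur rv].
  have hr : 0 <= r <= tau by rewrite (le_trans u0 ur) (le_trans rv vt).
  apply: size4Z; apply: size4D; first exact: size4_cst.
  exact: sY.
Qed.

Lemma dp_size4_incr : exists C, forall u v, 0 <= u -> u < v -> v <= tau ->
  size4 P (Num.sqrt (v - u)) C (fun w => Y v w - Y u w).
Proof.
have [CB sB] := dp_size4_drift.
have CB0 : 0 <= CB.
  by apply: size4_ge0 (sB 0 tau _ _ _) => //; rewrite subr0.
exists (8 * (CB * tau ^+ 2 + C4)) => u v u0 uv vt.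
have h0 : 0 < v - u by rewrite subr_gt0.
have htau : v - u <= tau by lra.
have sM := dp_four DP u0 uv vt.
have {}sB : size4 P (Num.sqrt (v - u)) (CB * tau ^+ 2)
    (fun w => Y v w - Y u w - (M v w - M u w)).
  apply: size4_rescale (sB u v u0 uv vt).
  rewrite (sqrt_pow4 (ltW h0)); set h := v - u in h0 htau *.
  rewrite (_ : CB * h ^+ 4 = CB * (h ^+ 2 * h ^+ 2)); last by ring.
  rewrite -[leRHS]mulrA; apply: ler_wpM2l => //.
  by apply: ler_wpM2r; rewrite ?sqr_ge0// lerXn2r ?nnegrE// ltW.
apply: size4_le (size4D sB sM); first exact: measurable_funB.
by move=> w; rewrite subrK.
Qed.

Lemma path_lin u v a b (G : R * T -> R) w : 0 <= u -> v <= tau -> measurable_fun setT G ->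
  (forall r, `|G (r, w)| <= a + b * Y r w) -> rint leb `[u, v] (fun r => G (r, w)).
Proof.
move=> u0 vt mG Gle; apply: (@rint_itv_le _ _ _ _ (fun r => a + b * Y r w)).
- by apply: measurable_funTS; exact: measurable_section1.
- by [].
- by apply: rintD => //; [exact: rint_itv_cst|apply: rintZ => //; exact: rY].
Qed.

(** [C] is a bound on the first moment of [Y], uniform in time; a dominated [F] is allowed because
    [rho] and the test functions grow linearly. *)
Lemma prob_lin : exists C, forall r a b (F : T -> R), 0 <= r <= tau -> 0 <= b ->
  measurable_fun setT F ->
  (forall w, `|F w| <= a + b * Y r w) ->
  rint P setT F /\ \int[P]_w `|F w| <= a + b * C.
Proof.
have [CY sY] := dp_size4Y.
exists (1 * (1 + CY)) => r a b F hr b0 mF Fle.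
have [iY bY] := size4_norm ltr01 (sY r hr).
have i2 : rint P setT (fun w => a + b * Y r w).
  by apply: rintD => //; [exact: rintP_cst|exact: rintZ].
have iF : rint P setT F by apply: (rint_le _ mF _ i2).
split => //; apply: (@le_trans _ _ (\int[P]_w (a + b * Y r w))).
  by apply: le_Rintegral => //; exact: rint_abs.
rewrite RintegralD//; [|exact: rintP_cst|exact: rintZ].
rewrite Rintegral_Pcst RintegralZl// lerD2l ler_wpM2l//.
apply: le_trans bY; apply: le_Rintegral => //; first exact: rint_abs.
by move=> w _; exact: ler_norm.
Qed.

Lemma dp_Fubini u v a b (G : R * T -> R) : 0 <= u -> u <= v -> v <= tau -> 0 <= b ->
  measurable_fun setT G -> (forall r w, `|G (r, w)| <= a + b * Y r w) ->
  [/\ rint P setT (fun w => \int[leb]_(r in `[u, v]) G (r, w)),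
      rint leb `[u, v] (fun r => \int[P]_w G (r, w)) &
      \int[P]_w \int[leb]_(r in `[u, v]) G (r, w) =
      \int[leb]_(r in `[u, v]) \int[P]_w G (r, w)].
Proof.
move=> u0 uv vt b0 mG Gle; have [C lin] := prob_lin.
apply: (@time_Fubini R _ _ P G u v (a + b * C)) => //.
  by move=> w; exact: path_lin (Gle ^~ w).
move=> r /andP[ur rv]; apply: lin => //; last exact: measurable_section2.
by rewrite (le_trans u0 ur) (le_trans rv vt).
Qed.

(* [p] and [s] stand for the first two derivatives of [f]. *)
Record test_fun (f p s : R -> R) (Kf Kp Lp Ks Ls K : R) : Prop := {
  tf_mf : measurable_fun setT f ;
  tf_mp : measurable_fun setT p ;
  tf_ms : measurable_fun setT s ;
  tf_f : forall x, 0 <= x -> `|f x| <= Kf * (1 + x) ;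
  tf_p : forall x, 0 <= p x <= Kp ;
  tf_s : forall x, `|s x| <= Ks ;
  tf_Lp : forall x y, 0 <= x -> 0 <= y -> `|p x - p y| <= Lp * `|x - y| ;
  tf_Ls : forall x y, 0 <= x -> 0 <= y -> `|s x - s y| <= Ls * `|x - y| ;
  tf_taylor : forall x y, 0 <= x -> 0 <= y ->
    f y <= f x + p x * (y - x) + 2^-1 * s x * (y - x) ^+ 2 + K * `|y - x| ^+ 3 }.

Variables (f p s : R -> R) (Kf Kp Lp Ks Ls K : R).
Hypothesis TF : test_fun f p s Kf Kp Lp Ks Ls K.
Hypothesis Lp0 : 0 <= Lp.
Hypothesis Ls0 : 0 <= Ls.
Hypothesis K0 : 0 <= K.

Let Kp0 : 0 <= Kp.
Proof. by have /andP[h1 h2] := tf_p TF 0; exact: le_trans h2. Qed.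
Let Ks0 : 0 <= Ks.
Proof. exact: le_trans (tf_s TF 0). Qed.

Let G0 (z : R * T) := p (Y z.1 z.2) * rho (Y z.1 z.2) + s (Y z.1 z.2) * m (Y z.1 z.2).
(** [G0] is the generator along the path. [G1 u] keeps the derivatives frozen at time [u], the form
    produced by the Taylor expansion at [Y u] and by [dp_quad], whose weight is a function of
    [Y u]. *)
Let G1 u (z : R * T) := p (Y u z.2) * rho (Y z.1 z.2) + s (Y u z.2) * m (Y z.1 z.2).

Let mG0 : measurable_fun setT G0.
Proof.
have h (q : R -> R) : measurable_fun setT q -> measurable_fun setT (fun z : R * T => q (Y z.1 z.2)).
  by move=> mq; exact: (measurableT_comp mq (dp_mY DP)).
apply: measurable_funD; apply: measurable_funM; apply: h.
- exact: tf_mp TF.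
- exact: dp_mrho DP.
- exact: tf_ms TF.
- exact: dp_mm DP.
Qed.

Let mG1 u : measurable_fun setT (G1 u).
Proof.
have h (q : R -> R) : measurable_fun setT q -> measurable_fun setT (fun z : R * T => q (Y z.1 z.2)).
  by move=> mq; exact: (measurableT_comp mq (dp_mY DP)).
have h1 (q : R -> R) : measurable_fun setT q -> measurable_fun setT (fun z : R * T => q (Y u z.2)).
  by move=> mq; apply: (measurableT_comp mq (measurableT_comp (mYr u) measurable_snd)).
apply: measurable_funD; apply: measurable_funM.
- exact: (h1 _ (tf_mp TF)).
- exact: (h _ (dp_mrho DP)).
- exact: (h1 _ (tf_ms TF)).
- exact: (h _ (dp_mm DP)).
Qed.

Let G1_le u r w : `|G1 u (r, w)| <= (Kp * Cb + 2 * Ks) + Kp * Cb * Y r w.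
Proof.
have Yr := dp_Y0 DP r w.
rewrite /G1/=; apply: le_trans (ler_normD _ _) _; rewrite !normrM.
have /andP[p0 pK] := tf_p TF (Y u w); have sK := tf_s TF (Y u w).
have /andP[r0 rK] := dp_rho DP Yr; have /andP[m0 mK] := dp_m DP (Y r w).
rewrite (ger0_norm p0) (ger0_norm r0) (ger0_norm m0).
have h1 : p (Y u w) * rho (Y r w) <= Kp * (Cb * (1 + Y r w)) by apply: ler_pM.
have h2 : `|s (Y u w)| * m (Y r w) <= Ks * 2 by apply: ler_pM.
lra.
Qed.

Let G01_le u r w : `|G1 u (r, w) - G0 (r, w)| <=
  `|(Y r w - Y u w) * (Lp * Cb * (1 + Y r w) + 2 * Ls)|.
Proof.
have Yr := dp_Y0 DP r w; have Yu := dp_Y0 DP u w.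
rewrite /G1 /G0/=.
have -> : p (Y u w) * rho (Y r w) + s (Y u w) * m (Y r w) -
   (p (Y r w) * rho (Y r w) + s (Y r w) * m (Y r w)) =
   (p (Y u w) - p (Y r w)) * rho (Y r w) + (s (Y u w) - s (Y r w)) * m (Y r w).
  by ring.
apply: le_trans (ler_normD _ _) _; rewrite !normrM.
have hp := tf_Lp TF Yu Yr; have hs := tf_Ls TF Yu Yr.
have /andP[r0 rK] := dp_rho DP Yr; have /andP[m0 mK] := dp_m DP (Y r w).
rewrite (ger0_norm r0) (ger0_norm m0) (distrC (Y r w)).
have h1 : `|p (Y u w) - p (Y r w)| * rho (Y r w) <=
   Lp * `|Y u w - Y r w| * (Cb * (1 + Y r w)) by apply: ler_pM.
have h2 : `|s (Y u w) - s (Y r w)| * m (Y r w) <= Ls * `|Y u w - Y r w| * 2.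
  by apply: ler_pM.
rewrite [X in _ <= _ * X]ger0_norm; last first.
  by rewrite addr_ge0 ?mulr_ge0// addr_ge0.
lra.
Qed.

Lemma dp_int_f r : 0 <= r <= tau -> rint P setT (fun w => f (Y r w)).
Proof.
move=> hr; have [C hC] := prob_lin.
have Kf0 : 0 <= Kf.
  by have := tf_f TF (lexx 0); rewrite addr0 mulr1; apply: le_trans.
apply: (hC r Kf Kf _ hr Kf0 _ _).1; first exact: (measurableT_comp (tf_mf TF) (mYr r)).
by move=> w; have := tf_f TF (dp_Y0 DP r w); rewrite mulrDr mulr1.
Qed.

(** Split the increment of [Y] into its drift part [B] and martingale part [dM]. Since [p >= 0],
    [p * B] is at most the integral of [p * rho]; [p * dM] has mean 0; [s * dM^2 / 2] has the mean
    of the integral of [s * m]. The remaining terms, namely [B * dM], [B * B], the cubic remainder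
    and the replacement of [G1 u] by [G0], are of order at least 3/2 in [v - u]. *)
Lemma dynkin_step : exists c, forall u v, 0 <= u -> u < v -> v <= tau ->
  \int[P]_w f (Y v w) - \int[P]_w f (Y u w) <=
  \int[leb]_(r in `[u, v]) \int[P]_w G0 (r, w) + c * Num.sqrt (v - u) ^+ 3.
Proof.
have [CY sY] := dp_size4Y.
have [CB sB] := dp_size4_drift.
have [CI sI] := dp_size4_incr.
have [CL lin] := prob_lin.
pose A1 := Lp * Cb; pose A2 := Lp * Cb + 2 * Ls.
pose CG := 8 * (A2 ^+ 4 / 1 ^+ 4 + A1 ^+ 4 * CY).
(* The summands pay, in this order, for [B * dM], for [B * B], for the cubic remainder and for the
   freezing of the derivatives. *)
pose cE := Ks * (1 + CB + C4) + 2^-1 * Ks * ((1 + CB + CB) * Num.sqrt tau) +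
   K * (1 + CI) + (1 + CI + CG).
exists cE => u v u0 uv vt.
have h0 : 0 < v - u by rewrite subr_gt0.
set k := Num.sqrt (v - u).
have k0 : 0 < k by rewrite sqrtr_gt0.
have k2 : v - u = k ^+ 2 by rewrite sqr_sqrtr// ltW.
have hu : 0 <= u <= tau by rewrite u0 (le_trans (ltW uv)).
have hv : 0 <= v <= tau by rewrite vt (le_trans u0 (ltW uv)).
have hr r : u <= r <= v -> 0 <= r <= tau.
  by move=> /andP[ur rv]; rewrite (le_trans u0 ur) (le_trans rv vt).
pose B w := Y v w - Y u w - (M v w - M u w).
pose dM w := M v w - M u w.
pose D w := Y v w - Y u w.
have sBk := sB u v u0 uv vt; rewrite -/B in sBk.
have sMk := dp_four DP u0 uv vt; rewrite -/dM in sMk.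
have sDk := sI u v u0 uv vt; rewrite -/D in sDk.
have G1lin (r : R) w : `|G1 u (r, w)| <= (Kp * Cb + 2 * Ks) + Kp * Cb * Y r w by exact: G1_le.
have G0lin (r : R) w : `|G0 (r, w)| <= (Kp * Cb + 2 * Ks) + Kp * Cb * Y r w by exact: (G1_le r).
have KC0 : 0 <= Kp * Cb by rewrite mulr_ge0.
have [F1a F1b F1c] := dp_Fubini u0 (ltW uv) vt KC0 (mG1 u) G1lin.
have [F0a F0b F0c] := dp_Fubini u0 (ltW uv) vt KC0 mG0 G0lin.
pose G2 (z : R * T) := s (Y u z.2) * m (Y z.1 z.2).
have mG2 : measurable_fun setT G2.
  apply: measurable_funM.
    exact: (measurableT_comp (tf_ms TF) (measurableT_comp (mYr u) measurable_snd)).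
  exact: (measurableT_comp (dp_mm DP) (dp_mY DP)).
have G2lin (r : R) w : `|G2 (r, w)| <= (2 * Ks) + 0 * Y r w.
  rewrite /G2/= normrM mul0r addr0 mulrC.
  have /andP[m0 mK] := dp_m DP (Y r w).
  by rewrite (ger0_norm m0) ler_pM// (tf_s TF).
have [F2a F2b F2c] := dp_Fubini u0 (ltW uv) vt (lexx 0) mG2 G2lin.
have mB : measurable_fun setT B by have [] := sBk.
have mdM : measurable_fun setT dM by have [] := sMk.
have mD : measurable_fun setT D by have [] := sDk.
have msY : measurable_fun setT (fun w => s (Y u w)) by exact: (measurableT_comp (tf_ms TF) (mYr u)).
have mpY : measurable_fun setT (fun w => p (Y u w)) by exact: (measurableT_comp (tf_mp TF) (mYr u)).
have [idM _] := size4_norm k0 sMk.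
have [idM2 _] := size4M k0 k0 sMk sMk.
have [iBM bBM] := size4M h0 k0 sBk sMk.
have [iBB bBB] := size4M h0 h0 sBk sBk.
have [iD3 bD3] := size4_cube k0 sDk.
have ipM : rint P setT (fun w => p (Y u w) * dM w).
  apply: (@rint_le _ _ _ _ _ _ _ (fun w => Kp * `|dM w|)) => //.
  - exact: measurable_funM.
  - move=> w _; rewrite normrM; have /andP[p0 pK] := tf_p TF (Y u w).
    by rewrite (ger0_norm p0) ler_wpM2r.
  - by apply: rintZ => //; exact: rint_abs.
have isM : rint P setT (fun w => 2^-1 * (s (Y u w) * dM w ^+ 2)).
  apply: rintZ => //.
  apply: (@rint_le _ _ _ _ _ _ _ (fun w => Ks * `|dM w * dM w|)) => //.
  - by apply: measurable_funM => //; exact: measurable_funX.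
  - move=> w _; rewrite normrM expr2; apply: ler_wpM2r => //; exact: tf_s TF _.
  - by apply: rintZ => //; exact: rint_abs.
have iH1 : rint P setT (fun w => Ks * `|B w * dM w|) by apply: rintZ => //; exact: rint_abs.
have iH2 : rint P setT (fun w => 2^-1 * Ks * `|B w * B w|) by apply: rintZ => //; exact: rint_abs.
have iH3 : rint P setT (fun w => K * `|D w| ^+ 3) by apply: rintZ.
have path w : f (Y v w) <= f (Y u w) + ((\int[leb]_(r in `[u, v]) G1 u (r, w) +
   (2^-1 * (s (Y u w) * dM w ^+ 2) - \int[leb]_(r in `[u, v]) G2 (r, w))) +
   (p (Y u w) * dM w + (Ks * `|B w * dM w| + (2^-1 * Ks * `|B w * B w| + K * `|D w| ^+ 3)))).
  have := tf_taylor TF (dp_Y0 DP u w) (dp_Y0 DP v w); rewrite -/(D w) => /le_trans; apply.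
  have /andP[p0 pK] := tf_p TF (Y u w); have sK := tf_s TF (Y u w).
  have -> : \int[leb]_(r in `[u, v]) G1 u (r, w) =
     p (Y u w) * (\int[leb]_(r in `[u, v]) rho (Y r w)) + \int[leb]_(r in `[u, v]) G2 (r, w).
    have r1 := rrho w u0 vt.
    have r2 := path_lin u0 vt mG2 (G2lin ^~ w).
    by rewrite -(RintegralZl _ _ r1)// -(RintegralD _ (rintZ _ _ r1) r2).
  have hB : p (Y u w) * B w <= p (Y u w) * \int[leb]_(r in `[u, v]) rho (Y r w).
    apply: ler_wpM2l => //; have := dp_drift DP w u0 (ltW uv) vt.
    by apply: le_trans; exact: ler_norm.
  have DBM : D w = B w + dM w by rewrite /D /B /dM subrK.
  have h1 : s (Y u w) * (B w * dM w) <= Ks * `|B w * dM w|.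
    by apply: le_trans (ler_norm _) _; rewrite normrM ler_wpM2r.
  have h2 : s (Y u w) * (B w * B w) <= Ks * `|B w * B w|.
    by apply: le_trans (ler_norm _) _; rewrite normrM ler_wpM2r.
  have -> : 2^-1 * s (Y u w) * D w ^+ 2 = 2^-1 * (s (Y u w) * dM w ^+ 2) +
    s (Y u w) * (B w * dM w) + 2^-1 * (s (Y u w) * (B w * B w)).
    by rewrite DBM; field.
  have -> : p (Y u w) * D w = p (Y u w) * B w + p (Y u w) * dM w by rewrite DBM mulrDr.
  rewrite -(mulrA 2^-1 Ks); exact: taylor_arith.
have ifu := dp_int_f hu; have ifv := dp_int_f hv.
have iA := rintB measurableT isM F2a.
have iB := rintD measurableT F1a iA.
have iH := rintD measurableT iH1 (rintD measurableT iH2 iH3).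
have iC := rintD measurableT ipM iH.
have iBC := rintD measurableT iB iC.
have := le_Rintegral measurableT ifv (rintD measurableT ifu iBC) (fun w _ => path w).
rewrite (RintegralD measurableT ifu iBC) (RintegralD measurableT iB iC).
rewrite (RintegralD measurableT F1a iA) (RintegralB measurableT isM F2a).
rewrite (RintegralD measurableT ipM iH) (RintegralD measurableT iH1 (rintD measurableT iH2 iH3)).
rewrite (RintegralD measurableT iH2 iH3).
have -> : \int[P]_w (p (Y u w) * dM w) = 0.
  apply: (dp_mart DP (b := Kp) u0 (ltW uv) vt (tf_mp TF)) => x.
  by have /andP[p0 pK] := tf_p TF x; rewrite ger0_norm.
have -> : \int[P]_w (2^-1 * (s (Y u w) * dM w ^+ 2)) =
    \int[P]_w \int[leb]_(r in `[u, v]) G2 (r, w).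
  rewrite RintegralZl//; last first.
    have := rintZ measurableT 2 isM; apply: eq_integrable => // w _ /=.
    by rewrite mulrA divff ?mul1r// pnatr_eq0.
  rewrite (dp_quad DP u0 (ltW uv) vt (tf_ms TF) (tf_s TF)).
  rewrite mulrA mulVf ?mul1r ?pnatr_eq0//; apply: eq_Rintegral => w _.
  rewrite -RintegralZl//.
  have := @path_lin u v 2 0 (fun z => m (Y z.1 z.2)) w u0 vt; apply.
    exact: (measurableT_comp (dp_mm DP) (dp_mY DP)).
  move=> r /=; have /andP[m0 mK] := dp_m DP (Y r w).
  by rewrite mul0r addr0 ger0_norm.
rewrite F1c subrr; rewrite addr0 add0r.
rewrite (RintegralZl _ measurableT (rint_abs measurableT iBM)).
rewrite (RintegralZl _ measurableT (rint_abs measurableT iBB)).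
rewrite (RintegralZl _ measurableT iD3).
have e1 : Ks * \int[P]_w `|B w * dM w| <= Ks * (1 + CB + C4) * k ^+ 3.
  by rewrite -[leRHS]mulrA; apply: ler_wpM2l => //; apply: le_trans bBM _; rewrite k2 -exprSr mulrC.
have CB0 : 0 <= CB by apply: size4_ge0 sBk.
(* [B * B] is of order [(v - u)^2], better than required; the spare factor [k] is bounded by
   [Num.sqrt tau]. *)
have e2 : 2^-1 * Ks * \int[P]_w `|B w * B w| <=
    2^-1 * Ks * ((1 + CB + CB) * Num.sqrt tau) * k ^+ 3.
  rewrite -[leRHS]mulrA; apply: ler_wpM2l; first by rewrite mulr_ge0.
  apply: le_trans bBB _; rewrite k2.
  have -> : k ^+ 2 * k ^+ 2 * (1 + CB + CB) = (1 + CB + CB) * k * k ^+ 3 by ring.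
  apply: ler_wpM2r; first by rewrite exprn_ge0// ltW.
  apply: ler_wpM2l; first by rewrite !addr_ge0.
  by apply: ler_wsqrtr; rewrite (le_trans _ vt)// gerBl.
have e3 : K * \int[P]_w (`|D w| ^+ 3) <= K * (1 + CI) * k ^+ 3.
  by rewrite -[leRHS]mulrA; apply: ler_wpM2l => //; rewrite mulrC.
have sIr r : u <= r <= v -> size4 P k CI (fun w => Y r w - Y u w).
  move=> /andP[ur rv]; move: ur; rewrite le_eqVlt => /predU1P[<-|ur].
    have z : size4 P k 0 (fun=> 0).
      by split => //; rewrite integral_cst//= expr0n/= mul0e mul0r.
    apply: size4_le (size4_leC k0 (size4_ge0 k0 sDk) z); first exact: measurable_funB.
    by move=> w; rewrite subrr.
  have rt := le_trans rv vt.
  apply: size4_subr (sI u r u0 ur rt); first by rewrite sqrtr_gt0 subr_gt0.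
  by apply: ler_wsqrtr; exact: lerB.
have sG r : u <= r <= v -> size4 P 1 CG (fun w => A2 + A1 * Y r w).
  by move=> h; apply: size4D; [exact: size4_cst|apply: size4Z; exact: sY (hr r h)].
(* [G1 u - G0] is at most the increment of [Y] (scale [k]) times an affine function of [Y] (scale
   1); integration over [[u, v]] supplies the missing [k^2]. *)
have e4 : \int[leb]_(r in `[u, v]) \int[P]_w G1 u (r, w) <=
    \int[leb]_(r in `[u, v]) \int[P]_w G0 (r, w) + (1 + CI + CG) * k ^+ 3.
  rewrite -lerBlDl -(RintegralB _ F1b F0b)//.
  have -> : (1 + CI + CG) * k ^+ 3 = k * 1 * (1 + CI + CG) * (v - u) by rewrite k2; ring.
  apply: Rintegral_itv_le_cst; [exact: ltW|exact: rintB|].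
  move=> r h.
  have [j1 _] := lin r _ _ _ (hr r h) KC0 (measurable_section2 r (mG1 u)) (G1lin r).
  have [j0 _] := lin r _ _ _ (hr r h) KC0 (measurable_section2 r mG0) (G0lin r).
  rewrite -(RintegralB _ j1 j0)//.
  have [l1 l2] := size4M k0 ltr01 (sIr r h) (sG r h).
  apply: le_trans l2; apply: le_Rintegral => //; [exact: rintB|exact: rint_abs|].
  move=> w _; apply: le_trans (ler_norm _) _; apply: le_trans (G01_le _ _ _) _.
  by rewrite le_eqVlt; apply/orP; left; apply/eqP; congr (`|_ * _|); rewrite /A1 /A2; ring.
by move=> main; exact: error_arith main e1 e2 e3 e4.
Qed.

Lemma dynkin u v : 0 <= u -> u <= v -> v <= tau ->
  \int[P]_w f (Y v w) - \int[P]_w f (Y u w) <=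
  \int[leb]_(r in `[u, v]) \int[P]_w (p (Y r w) * rho (Y r w) + s (Y r w) * m (Y r w)).
Proof.
move=> u0 uv vt; have [c hc] := dynkin_step.
have KC0 : 0 <= Kp * Cb by rewrite mulr_ge0.
have [_ iG _] := dp_Fubini (lexx 0) (ltW tau0) (lexx tau) KC0 mG0 (fun r w => G1_le r r w).
exact: (subdivision (Phi := fun r => \int[P]_w f (Y r w)) iG hc).
Qed.

End dynkin.

(** * Lyapunov functions *)

Section test_functions.
Context {R : realType}.
Implicit Types (x y z eps : R).

(** Symmetric in [x] and [y], with [c] above [eps] and no farther from [x] than [y] is: applications
    can then be chained, the bounds on the derivatives being available on [[eps, +oo[] only. *)
Lemma mvt_pos (F dF : R -> R) eps x y : 0 < eps ->
  (forall z, 0 < z -> is_derive z 1 F (dF z)) -> eps <= x -> eps <= y ->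
  exists c, [/\ eps <= c, `|c - x| <= `|y - x| & F y - F x = dF c * (y - x)].
Proof.
move=> e0 dF_ ex ey.
have H a b : eps <= a -> a <= b ->
    exists2 c, c \in `[a, b] & F b - F a = dF c * (b - a).
  move=> ea ab; have a0 := lt_le_trans e0 ea.
  apply: MVT_segment => //.
    by move=> z; rewrite in_itv/= => /andP[az _]; apply: dF_; exact: lt_trans az.
  apply: derivable_within_continuous => z; rewrite in_itv/= => /andP[az _].
  by apply: ex_derive; apply: dF_; exact: lt_le_trans az.
have [xy|yx] := leP x y.
  have [c] := H x y ex xy; rewrite in_itv/= => /andP[xc cy] e.
  exists c; split => //; first exact: le_trans xc.
  by rewrite !ger0_norm ?subr_ge0// lerB.
have [c] := H y x ey (ltW yx); rewrite in_itv/= => /andP[yc cx] e.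
exists c; split; first exact: le_trans yc.
  by rewrite distrC (distrC y) !ger0_norm ?subr_ge0 ?(ltW yx)// lerB.
by rewrite -opprB e -mulrN opprB.
Qed.

Section from_derivatives.
Variables (F p0 s0 t0 : R -> R) (eps Kp Ks Ls : R).
Hypothesis eps0 : 0 < eps.
Hypotheses (mF : measurable_fun setT F) (mp : measurable_fun setT p0)
  (ms : measurable_fun setT s0).
Hypothesis dF : forall z, 0 < z -> is_derive z 1 F (p0 z).
Hypothesis dp : forall z, 0 < z -> is_derive z 1 p0 (s0 z).
Hypothesis ds : forall z, 0 < z -> is_derive z 1 s0 (t0 z).
Hypothesis bp : forall z, eps <= z -> 0 <= p0 z <= Kp.
Hypothesis bs : forall z, eps <= z -> `|s0 z| <= Ks.
Hypothesis bt : forall z, eps <= z -> `|t0 z| <= Ls.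

Let Ls0 : 0 <= Ls. Proof. exact: le_trans (bt (lexx eps)). Qed.
Let Ks0 : 0 <= Ks. Proof. exact: le_trans (bs (lexx eps)). Qed.
Let Kp0 : 0 <= Kp.
Proof. by have /andP[a b] := bp (lexx eps); exact: le_trans b. Qed.

(** Three nested mean value steps, for the remainder [G], for [p0] and for [s0], each contributing a
    factor of size at most [b - a]. The price is the constant [Ls] instead of [Ls / 6]. *)
Lemma taylor_pos a b : eps <= a -> eps <= b ->
  `|F b - F a - p0 a * (b - a) - 2^-1 * s0 a * (b - a) ^+ 2| <= Ls * `|b - a| ^+ 3.
Proof.
move=> ea eb.
pose G z := F z - p0 a * z - 2^-1 * s0 a * ((z - a) * (z - a)).
have dG z : 0 < z -> is_derive z 1 G (p0 z - p0 a - s0 a * (z - a)).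
  move=> z0; have dFz := dF z0.
  have H1 : is_derive z 1 (fun z => p0 a * z) (p0 a * 1) by exact: is_deriveZ.
  have H2 : is_derive z 1 (fun z : R => z - a) 1.
    by rewrite -[X in is_derive _ _ _ X]subr0; exact: is_deriveB.
  have H4 := is_deriveZ (2^-1 * s0 a) (is_deriveM H2 H2).
  have H5 := is_deriveB (is_deriveB dFz H1) H4.
  apply: is_derive_eq H5 _.
  by rewrite /GRing.scale/=; field.
have [c [ec cab Gc]] := mvt_pos eps0 dG ea eb.
have [e [ee eca pe]] := mvt_pos eps0 dp ea ec.
have [h [eh hea se]] := mvt_pos eps0 ds ea ee.
have -> : F b - F a - p0 a * (b - a) - 2^-1 * s0 a * (b - a) ^+ 2 =
   t0 h * (e - a) * (c - a) * (b - a).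
  have -> : F b - F a - p0 a * (b - a) - 2^-1 * s0 a * (b - a) ^+ 2 = G b - G a.
    by rewrite /G subrr; ring.
  by rewrite Gc pe -mulrBl -se.
rewrite !normrM (_ : Ls * _ = Ls * `|b - a| * `|b - a| * `|b - a|); last by ring.
apply: ler_wpM2r => //; apply: ler_pM => //.
apply: ler_pM => //; first exact: bt.
exact: le_trans eca _.
Qed.

(** The shift moves the singularity at 0 out of reach, the clamp by [Num.max] makes the bounds on
    [p] and [s] hold on the whole line as [test_fun] demands, and subtracting [F eps] gives the
    value 0 at 0, hence linear growth with constant [Kp]. *)
Lemma test_fun_shift :
  test_fun (fun x => F (Num.max x 0 + eps) - F eps) (fun x => p0 (Num.max x 0 + eps))
    (fun x => s0 (Num.max x 0 + eps)) Kp Kp Ks Ks Ls Ls.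
Proof.
have mm : measurable_fun setT (fun x : R => Num.max x 0 + eps).
  by apply: measurable_funD => //; exact: measurable_maxr.
have ge x : eps <= Num.max x 0 + eps by rewrite lerDr le_max lexx orbT.
have sh x y : x + eps - (y + eps) = x - y by ring.
have mx x : 0 <= x -> Num.max x 0 = x by move=> x0; apply/max_idPl.
split.
- by apply: measurable_funB => //; exact: (measurableT_comp mF mm).
- exact: (measurableT_comp mp mm).
- exact: (measurableT_comp ms mm).
- move=> x x0; rewrite mx//.
  have ex : eps <= x + eps by rewrite lerDr.
  have [c [ec _ ->]] := mvt_pos eps0 dF (lexx eps) ex.
  rewrite addrK normrM (ger0_norm x0).
  have /andP[h1 h2] := bp ec; rewrite ger0_norm//.
  by apply: ler_pM => //; rewrite lerDr.
- by move=> x; exact: bp.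
- by move=> x; exact: bs.
- move=> x y x0 y0; rewrite !mx//.
  have ex : eps <= x + eps by rewrite lerDr.
  have ey : eps <= y + eps by rewrite lerDr.
  have [c [ec _ ->]] := mvt_pos eps0 dp ey ex.
  by rewrite normrM sh; apply: ler_wpM2r => //; exact: bs.
- move=> x y x0 y0; rewrite !mx//.
  have ex : eps <= x + eps by rewrite lerDr.
  have ey : eps <= y + eps by rewrite lerDr.
  have [c [ec _ ->]] := mvt_pos eps0 ds ey ex.
  by rewrite normrM sh; apply: ler_wpM2r => //; exact: bt.
- move=> x y x0 y0; rewrite !mx//.
  have ex : eps <= x + eps by rewrite lerDr.
  have ey : eps <= y + eps by rewrite lerDr.
  have := taylor_pos ex ey; rewrite sh => /ler_normlP[_]; lra.
Qed.

End from_derivatives.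
End test_functions.

Section powR_extra.
Context {R : realType}.
Implicit Types (x y q b : R).

Lemma le0_ger_powR q x y : q <= 0 -> 0 < x -> x <= y -> y `^ q <= x `^ q.
Proof.
move=> q0 x0 xy; have y0 := lt_le_trans x0 xy.
have nq0 : 0 <= - q by rewrite oppr_ge0.
have eN z : z `^ q = (z `^ (- q))^-1 by rewrite powRN invrK.
rewrite !eN lef_pV2 ?posrE ?powR_gt0//.
by apply: (ge0_ler_powR nq0) => //; rewrite nnegrE ltW.
Qed.

(** With [t = x + y], any [z] in []0, t]] satisfies [z^q >= t^q * (z / t)] because [z / t <= 1] and
    [q <= 1]; add the inequalities for [x] and [y]. *)
Lemma powR_subadditive q x y : 0 < q <= 1 -> 0 <= x -> 0 <= y ->
  (x + y) `^ q <= x `^ q + y `^ q.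
Proof.
move=> /andP[q0 q1]; rewrite le_eqVlt => /predU1P[<- _|x0].
  by rewrite add0r lerDr powR_ge0.
rewrite le_eqVlt => /predU1P[<-|y0]; first by rewrite addr0 lerDl powR_ge0.
have t0 : 0 < x + y by rewrite addr_gt0.
have H z : 0 < z -> z <= x + y -> (x + y) `^ q * (z / (x + y)) <= z `^ q.
  move=> z0 zt; have e : z = (x + y) * (z / (x + y)).
    by rewrite mulrCA divff ?mulr1// gt_eqF.
  rewrite [leRHS](_ : _ = (x + y) `^ q * (z / (x + y)) `^ q); last first.
    by rewrite -powRM -?e// ?divr_ge0// ltW.
  apply: ler_wpM2l; first exact: powR_ge0.
  by apply: ger1_powR => //; rewrite divr_gt0//= ler_pdivrMr// mul1r.
have h1 := H x x0 ltac:(by rewrite lerDl ltW).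
have h2 := H y y0 ltac:(by rewrite lerDr ltW).
apply: le_trans (lerD h1 h2).
by rewrite -mulrDr -mulrDl divff ?mulr1// gt_eqF.
Qed.

(** The offset [b] serves both a regular power and, with [b = 0], the singular one; hence the terms
    [0 + y] in the functions built below. *)
Lemma is_derive_shift_powR b q (z : R) : 0 <= b -> 0 < z ->
  is_derive z 1 (fun y : R => (b + y) `^ q) (q * (b + z) `^ (q - 1)).
Proof.
move=> b0 z0.
have H1 : is_derive z 1 (fun y : R => b + y) 1.
  have Hc : is_derive z 1 (cst b) (0 : R) by exact: is_derive_cst.
  have Hi : is_derive z 1 (@id R) 1 by exact: is_derive_id.
  by apply: is_derive_eq (is_deriveD Hc Hi) _; rewrite add0r.
have bz : 0 < b + z by rewrite ltr_wpDl.
have H2 := is_derive1_powR q bz.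
by apply: is_derive_eq (is_derive1_comp H2 H1) _; rewrite /GRing.scale/= mulr1.
Qed.

Lemma measurable_shift_powR b q : measurable_fun setT (fun y : R => (b + y) `^ q).
Proof.
have mb : measurable_fun setT (fun y : R => b + y) by exact: measurable_funD.
exact: (measurableT_comp (measurable_powR q) mb).
Qed.

End powR_extra.

(** * Perturbed identity and power function *)

Section lyapunov.
Context {R : realType}.
Implicit Types (x y eps : R).

Definition pos01 x : R := ((0 < x)%R : bool)%:R.
Definition small01 eps x : R := ((0 < x < eps)%R : bool)%:R.

Variables (rho m : R -> R) (alpha beta C1 C2 Cb L0 : R).
Hypothesis alpha2 : alpha < 2.
Hypothesis C10 : 0 <= C1.
Hypothesis C20 : 0 < C2.
Hypothesis L00 : 0 < L0.
Hypothesis L01 : L0 <= 1.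
Hypothesis rho0 : rho 0 = 0.
Hypothesis rhoCb : forall x, 0 <= x -> 0 <= rho x <= Cb * (1 + x).
Hypothesis rhobeta : forall x, 0 < x <= L0 -> rho x <= C1 * x `^ beta.
Hypothesis mge0 : forall x, 0 <= m x.
Hypothesis malpha : forall x, 0 <= x <= L0 -> C2 * x `^ alpha <= m x.

Let Cb0 : 0 <= Cb.
Proof. by have /andP[h] := rhoCb (lexx 0); rewrite addr0 mulr1; exact: le_trans. Qed.

(* The last term is the price of a shift by [eps] that makes the derivatives
   Lipschitz at 0; it vanishes in the limit. *)
Definition lyapunov (kap K Ce eps : R) (U0 U1 : R -> R) :=
  exists f p s Kf Kp Lp Ks Ls Kt,
    [/\ @test_fun R f p s Kf Kp Lp Ks Ls Kt, [/\ 0 <= Lp, 0 <= Ls & 0 <= Kt],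
        (forall x, 0 <= x -> U0 x <= f x <= U1 x) &
        (forall x, 0 <= x -> p x * rho x + s x * m x <=
           - kap * pos01 x + K * x + Ce * small01 eps x)].

(** Four regions. At 0 [rho] vanishes and the curvature term has the right sign. On []0, eps[] the
    drift costs at most [Pm], charged to [small01]. On [[eps, L1]] the curvature beats the drift.
    Beyond [L1] the affine growth of [rho] and the constant [kap] are both paid by a multiple of
    [x], since [x / L1 >= 1]. *)
Lemma lyapunov_regions (p0 s0 : R -> R) kap L1 Pm PL eps x :
  0 <= kap -> 0 < eps <= 1 -> 0 < L1 -> 0 <= x -> 0 <= Pm -> 0 <= PL ->
  (forall y, 0 < y -> 0 <= p0 y) -> (forall y, 0 < y -> s0 y <= 0) ->
  (0 < x -> x < eps -> p0 (x + eps) * rho x <= Pm) ->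
  (eps <= x -> x <= L1 -> p0 (x + eps) * rho x + s0 (x + eps) * m x <= - kap) ->
  (L1 < x -> p0 (x + eps) <= PL) ->
  p0 (Num.max x 0 + eps) * rho x + s0 (Num.max x 0 + eps) * m x <=
  - kap * pos01 x + (PL * Cb * (1 + L1^-1) + kap / L1) * x +
  (Pm + kap) * small01 eps x.
Proof.
move=> kap0 /andP[eps0 eps1] L10 x0 Pm0 PL0 p00 s00 H1 H2 H3.
rewrite (max_idPl x0).
have y0 : 0 < x + eps by rewrite ltr_wpDl.
have sm : s0 (x + eps) * m x <= 0 by rewrite mulr_le0_ge0// s00.
have K0 : 0 <= PL * Cb * (1 + L1^-1) + kap / L1.
  by rewrite addr_ge0 ?mulr_ge0 ?addr_ge0 ?invr_ge0// ltW.
move: x0; rewrite le_eqVlt => /predU1P[<-|x0].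
  rewrite rho0 mulr0 add0r /pos01 /small01 ltxx/= !mulr0 !addr0.
  by rewrite mulr_le0_ge0// s00// add0r.
have Kx : 0 <= (PL * Cb * (1 + L1^-1) + kap / L1) * x by rewrite mulr_ge0// ltW.
rewrite /pos01 /small01 x0/= mulr1.
have [xe|ex] := ltP x eps.
  by rewrite mulr1; have := H1 x0 xe; lra.
rewrite mulr0 addr0.
have [xL|Lx] := leP x L1; first by have := H2 ex xL; lra.
have xL1 : 1 <= x / L1 by rewrite ler_pdivlMr// mul1r ltW.
have /andP[r0 rC] := rhoCb (ltW x0).
have h : p0 (x + eps) * rho x <= PL * (Cb * (1 + x)).
  by apply: ler_pM => //; [exact: p00|exact: H3].
have h2 : PL * (Cb * (1 + x)) <= PL * Cb * (1 + L1^-1) * x.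
  have h2a : 1 + x <= (1 + L1^-1) * x by rewrite mulrDl mul1r addrC lerD2l mulrC.
  by rewrite mulrA -[leRHS]mulrA; apply: ler_wpM2l => //; exact: mulr_ge0.
have h3 : kap <= kap / L1 * x by rewrite -mulrA (mulrC _ x) ler_peMr.
lra.
Qed.

(** Near 0 the second derivative behaves like [- A * dl * y^(dl - 1)]; against [m >= C2 * y^alpha]
    this has order [y^beta], because [dl - 1 + alpha = beta], which is the order of the drift. The
    offset [b] keeps the first derivative bounded, by [(b + y)^dl - y^dl <= b^dl]. *)
Lemma lyapunov_scale kap : 0 <= kap -> 0 < 1 + beta - alpha < 1 ->
  (forall x, 0 < x <= L0 -> kap <= x `^ beta) ->
  exists K Ce, [/\ 0 <= K, 0 <= Ce & forall eps, 0 < eps <= 1 ->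
    lyapunov kap K Ce eps id (fun x => 2 * x)].
Proof.
set dl := 1 + beta - alpha => kap0 /andP[dl0 dl1] kapb.
(* The shift by [eps] and the offset term each lose a factor 2 of curvature, hence the 4. What is
   left is [(2 * C1 + 1) * x^beta]: the part [2 * C1] beats the drift, as [p0 <= 2], and the
   remaining [x^beta] is at least [kap]. *)
pose A := 4 * (2 * C1 + 1) / (dl * C2).
have A0 : 0 < A by rewrite divr_gt0 ?mulr_gt0// ltr_wpDl// mulr_ge0.
(* Chosen so that [A * b^dl = 1], which caps the first derivative at 2. *)
pose b := (A^-1) `^ (dl^-1).
have b0 : 0 < b by rewrite powR_gt0// invr_gt0.
have bA : A * b `^ dl = 1.
  by rewrite -powRrM mulVf ?gt_eqF// powRr1 ?divff ?invr_ge0 ?gt_eqF ?ltW.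
(* For [eps <= x <= L1] the shifted point is at most [2 * x <= b * 2^(1 / (dl - 1))]; below that
   level [b^(dl - 1)] is at most half of the singular term. *)
pose L1 := Num.min L0 (2^-1 * (b * 2 `^ ((dl - 1)^-1))).
have L10 : 0 < L1.
  by rewrite lt_min L00/= mulr_gt0// mulr_gt0// powR_gt0.
have d1 : dl - 1 < 0 by rewrite subr_lt0.
pose F y := y + A / (1 + dl) * ((b + y) `^ (1 + dl) - (0 + y) `^ (1 + dl)).
pose p0 y := 1 + A * ((b + y) `^ dl - (0 + y) `^ dl).
pose s0 y := 0 + A * dl * ((b + y) `^ (dl - 1) - (0 + y) `^ (dl - 1)).
pose t0 y := A * dl * (dl - 1) * ((b + y) `^ (dl - 2) - (0 + y) `^ (dl - 2)).
have dpw q (z : R) : 0 < z -> is_derive z 1 (fun y : R => (b + y) `^ q - (0 + y) `^ q)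
    (q * (b + z) `^ (q - 1) - q * (0 + z) `^ (q - 1)).
  by move=> z0; apply: is_deriveB; apply: is_derive_shift_powR => //; exact: ltW.
have mpw q : measurable_fun setT (fun y : R => (b + y) `^ q - (0 + y) `^ q).
  by apply: measurable_funB; exact: measurable_shift_powR.
have dF (z : R) : 0 < z -> is_derive z 1 F (p0 z).
  move=> z0; have Hi : is_derive z 1 (@id R) 1 by exact: is_derive_id.
  apply: is_derive_eq (is_deriveD Hi (is_deriveZ (A / (1 + dl)) (dpw (1 + dl) z z0))) _.
  rewrite /p0 /GRing.scale/= (_ : 1 + dl - 1 = dl); last by ring.
  by field; rewrite gt_eqF// addr_gt0.
have dp (z : R) : 0 < z -> is_derive z 1 p0 (s0 z).
  move=> z0; have Hc : is_derive z 1 (cst (1 : R)) (0 : R) by exact: is_derive_cst.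
  apply: is_derive_eq (is_deriveD Hc (is_deriveZ A (dpw dl z z0))) _.
  by rewrite /s0 /GRing.scale/=; ring.
have ds (z : R) : 0 < z -> is_derive z 1 s0 (t0 z).
  move=> z0; have Hc : is_derive z 1 (cst (0 : R)) (0 : R) by exact: is_derive_cst.
  apply: is_derive_eq (is_deriveD Hc (is_deriveZ (A * dl) (dpw (dl - 1) z z0))) _.
  by rewrite /t0 /GRing.scale/= (_ : dl - 1 - 1 = dl - 2); ring.
have p12 (y : R) : 0 < y -> 1 <= p0 y <= 2.
  move=> y0; rewrite /p0 add0r; apply/andP; split.
    rewrite lerDl; apply: mulr_ge0; first exact: ltW.
    rewrite subr_ge0; apply: (ge0_ler_powR (ltW dl0)); rewrite ?nnegrE ?(ltW y0)//.
      by rewrite addr_ge0 ?ltW.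
    by rewrite lerDr ltW.
  have : (b + y) `^ dl <= b `^ dl + y `^ dl.
    by apply: powR_subadditive; rewrite ?dl0 ?ltW.
  rewrite -lerBlDr -(ler_pM2l A0) bA; lra.
have anti q y z : q <= 0 -> 0 < y -> y <= z ->
    0 <= y `^ q - (b + z) `^ q <= y `^ q.
  move=> q0 y0 yz; rewrite gerBl powR_ge0 andbT subr_ge0.
  by apply: le0_ger_powR => //; rewrite (le_trans yz)// lerDr ltW.
have s0le (y : R) : 0 < y -> s0 y <= 0.
  move=> y0; rewrite /s0 !add0r; apply: mulr_ge0_le0; first by rewrite mulr_ge0// ltW.
  rewrite -oppr_ge0 opprB.
  by have /andP[] := anti (dl - 1) y y (ltW d1) y0 (lexx y).
(* Both constants are free of [eps], as the limit requires. [4 * Cb] comes from [p0 <= 2] and from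
   [rho <= 2 * Cb] on []0, eps[], where [eps <= 1]. *)
exists (2 * Cb * (1 + L1^-1) + kap / L1), (4 * Cb + kap); split.
- by rewrite addr_ge0 ?mulr_ge0 ?addr_ge0 ?invr_ge0// ltW.
- by rewrite addr_ge0 ?mulr_ge0.
move=> eps heps; have /andP[eps0 eps1] := heps.
have TF := @test_fun_shift R F p0 s0 t0 eps 2 (A * dl * eps `^ (dl - 1))
  (A * dl * (1 - dl) * eps `^ (dl - 2)) eps0.
do 3 eexists; exists 2, 2, (A * dl * eps `^ (dl - 1)), (A * dl * eps `^ (dl - 1)),
  (A * dl * (1 - dl) * eps `^ (dl - 2)), (A * dl * (1 - dl) * eps `^ (dl - 2)).
have Ad : 0 <= A * dl by rewrite mulr_ge0// ltW.
have Add : 0 <= A * dl * (1 - dl) by rewrite mulr_ge0// subr_ge0 ltW.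
split; first apply: TF => //.
- by apply: measurable_funD => //; exact: measurable_funM.
- by apply: measurable_funD => //; exact: measurable_funM.
- by apply: measurable_funD => //; exact: measurable_funM.
- by move=> z ez; have /andP[h1 ->] := p12 z (lt_le_trans eps0 ez); rewrite andbT (le_trans _ h1).
- move=> z ez; have z0 := lt_le_trans eps0 ez.
  rewrite /s0 !add0r normrM (ger0_norm Ad); apply: ler_wpM2l => //.
  have /andP[h1 h2] := anti (dl - 1) z z (ltW d1) z0 (lexx z).
  rewrite distrC ger0_norm//; apply: le_trans h2 _.
  by apply: le0_ger_powR => //; exact: ltW.
- move=> z ez; have z0 := lt_le_trans eps0 ez.
  have d2 : dl - 2 <= 0 by lra.
  rewrite /t0 !add0r normrM normrM (ger0_norm Ad) (ler0_norm (ltW d1)) opprB.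
  apply: ler_wpM2l => //.
  have /andP[h1 h2] := anti (dl - 2) z z d2 z0 (lexx z).
  rewrite distrC ger0_norm//; apply: le_trans h2 _.
  exact: le0_ger_powR.
- by split; apply: mulr_ge0 => //; exact: powR_ge0.
- move=> x x0 /=; rewrite (max_idPl x0).
  have ex : eps <= x + eps by rewrite lerDr.
  have [c [ec _ ->]] := mvt_pos eps0 dF (lexx eps) ex.
  have /andP[h1 h2] := p12 c (lt_le_trans eps0 ec).
  by rewrite addrK; apply/andP; split; [rewrite ler_peMl|rewrite ler_wpM2r].
- move=> x x0 /=; apply: lyapunov_regions => //.
  + by rewrite mulr_ge0.
  + by move=> y y0; have /andP[h1 _] := p12 y y0; rewrite (le_trans _ h1).
  + move=> x1 xe; have /andP[r0 rC] := rhoCb x0.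
    have /andP[h1 h2] := p12 (x + eps) ltac:(by rewrite ltr_wpDl).
    have h : p0 (x + eps) * rho x <= 2 * (Cb * (1 + x)).
      by apply: ler_pM => //; exact: le_trans h1.
    apply: le_trans h _; rewrite (_ : 4 * Cb = 2 * (Cb * 2)); last by ring.
    apply: ler_wpM2l => //; apply: ler_wpM2l => //; lra.
  + move=> ex xL; have x1 := lt_le_trans eps0 ex.
    have y0 : 0 < x + eps by rewrite addr_gt0.
    have xL0 : 0 < x <= L0 by rewrite x1 (le_trans xL)// ge_min lexx.
    have /andP[h1 h2] := p12 (x + eps) y0.
    have hr : p0 (x + eps) * rho x <= 2 * (C1 * x `^ beta).
      apply: ler_pM => //; [exact: le_trans h1|by have /andP[] := rhoCb x0|].
      exact: rhobeta.
    have y2 : x + eps <= 2 * x by lra.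
    have hy : (b + (x + eps)) `^ (dl - 1) <= 2^-1 * (x + eps) `^ (dl - 1).
      have h3 : x + eps <= b * 2 `^ ((dl - 1)^-1).
        apply: le_trans y2 _; rewrite mulrC -ler_pdivlMr// mulrC.
        by apply: le_trans xL _; rewrite ge_min lexx orbT.
      have h4 : (b * 2 `^ ((dl - 1)^-1)) `^ (dl - 1) = b `^ (dl - 1) * 2.
        rewrite powRM ?(ltW b0) ?powR_ge0// -powRrM mulVf ?lt_eqF// powRr1//.
      have := le0_ger_powR (ltW d1) y0 h3; rewrite h4 => h5.
      have : (b + (x + eps)) `^ (dl - 1) <= b `^ (dl - 1).
        by apply: le0_ger_powR => //; [exact: ltW|rewrite lerDl ltW].
      lra.
    have hx : 2^-1 * x `^ (dl - 1) <= (x + eps) `^ (dl - 1).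
      apply: le_trans (le0_ger_powR (ltW d1) y0 y2).
      rewrite powRM//; apply: ler_wpM2r; first exact: powR_ge0.
      by rewrite -(powR_inv1 (ler0n _ 2)); apply: ler_powR; lra.
    have hs : s0 (x + eps) <= - (A * dl / 4 * x `^ (dl - 1)).
      have hq : (b + (x + eps)) `^ (dl - 1) - (x + eps) `^ (dl - 1) <= - (4^-1 * x `^ (dl - 1)).
        lra.
      by rewrite /s0 !add0r; apply: le_trans (ler_wpM2l Ad hq) _; rewrite mulrN mulrA.
    have hm := malpha (x := x) ltac:(by rewrite x0; have /andP[] := xL0).
    have hsm : s0 (x + eps) * m x <= - ((2 * C1 + 1) * x `^ beta).
      apply: (@le_trans _ _ (- (A * dl / 4 * x `^ (dl - 1)) * m x)).
        by apply: ler_wpM2r.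
      rewrite mulNr lerN2.
      have -> : (2 * C1 + 1) * x `^ beta =
          A * dl / 4 * x `^ (dl - 1) * (C2 * x `^ alpha).
        have -> : beta = (dl - 1) + alpha by rewrite /dl; ring.
        rewrite powRD; last by apply/implyP => _; rewrite gt_eqF.
        by rewrite /A; field; rewrite !gt_eqF.
      apply: ler_wpM2l => //; apply: mulr_ge0; last exact: powR_ge0.
      by rewrite divr_ge0.
    have := kapb x xL0; lra.
  + by move=> xL; have /andP[] := p12 (x + eps) ltac:(by rewrite ltr_wpDl).
Qed.

(** The second derivative of [y^g] is [- g * (1 - g) * y^(- alpha)], so its product with
    [m >= C2 * y^alpha] stays below a negative constant near 0, while the drift term is of order
    [y^(g - 1 + beta) = y^dl] and tends to 0. The condition [1 < alpha] makes the power concave. *)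
Lemma lyapunov_power : 1 < alpha -> 0 < 1 + beta - alpha ->
  exists kap K Ce, [/\ 0 < kap, 0 <= K, 0 <= Ce & forall eps, 0 < eps <= L0 ->
    lyapunov kap K Ce eps (fun=> 0) (fun x => x `^ (2 - alpha))].
Proof.
move=> al1 dl0; set dl := 1 + beta - alpha in dl0 *.
set g := 2 - alpha.
have g0 : 0 < g by rewrite subr_gt0.
have g1 : g < 1 by rewrite /g; lra.
have g1n : g - 1 <= 0 by lra.
pose cc := g * (1 - g).
have cc0 : 0 < cc by rewrite mulr_gt0// subr_gt0.
(* When [x^dl <= q] the drift term is at most [kap]; the [+ 1] keeps the denominator positive if
   [C1 = 0]. *)
pose q := cc * C2 / 8 / (C1 * g + 1).
have den0 : 0 < C1 * g + 1 by rewrite ltr_wpDl// mulr_ge0// ltW.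
have q0 : 0 < q by rewrite divr_gt0// divr_gt0// mulr_gt0.
pose L1 := Num.min L0 (q `^ (dl^-1)).
have L10 : 0 < L1 by rewrite lt_min L00/= powR_gt0.
(* Half of what the curvature provides: it gives [2 * kap] after the shift has cost a factor
   [2^(- alpha) >= 4^-1], and the drift takes back at most [kap]. *)
pose kap := cc * C2 / 8.
have kap0 : 0 < kap by rewrite divr_gt0// mulr_gt0.
have [g0' cc0' L10' kap0'] : [/\ 0 <= g, 0 <= cc, 0 <= L1 & 0 <= kap] by rewrite !ltW.
pose F y := (0 + y) `^ g.
pose p0 y := g * (0 + y) `^ (g - 1).
pose s0 y := g * (g - 1) * (0 + y) `^ (g - 2).
pose t0 y := g * (g - 1) * (g - 2) * (0 + y) `^ (g - 3).
have dF (z : R) : 0 < z -> is_derive z 1 F (p0 z).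
  by move=> z0; exact: is_derive_shift_powR.
have dp (z : R) : 0 < z -> is_derive z 1 p0 (s0 z).
  move=> z0.
  apply: is_derive_eq (is_deriveZ g (is_derive_shift_powR (g - 1) (lexx 0) z0)) _.
  by rewrite /s0 /GRing.scale/= (_ : g - 1 - 1 = g - 2); ring.
have ds (z : R) : 0 < z -> is_derive z 1 s0 (t0 z).
  move=> z0.
  apply: is_derive_eq (is_deriveZ (g * (g - 1)) (is_derive_shift_powR (g - 2) (lexx 0) z0)) _.
  by rewrite /t0 /GRing.scale/= (_ : g - 2 - 1 = g - 3); ring.
have pge (y : R) : 0 <= p0 y by rewrite mulr_ge0 ?powR_ge0// ltW.
have drift' x y : 0 < x -> x <= L0 -> x <= y -> p0 y * rho x <= C1 * g * x `^ dl.
  move=> x0 xL xy.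
  have e : x `^ dl = x `^ (g - 1) * x `^ beta.
    rewrite -powRD; last by apply/implyP => _; rewrite gt_eqF.
    by congr (_ `^ _); rewrite /g /dl; ring.
  rewrite e (_ : C1 * g * _ = g * x `^ (g - 1) * (C1 * x `^ beta)); last by ring.
  apply: ler_pM => //; first by have /andP[] := rhoCb (ltW x0).
    by rewrite /p0 add0r; apply: ler_wpM2l => //; exact: le0_ger_powR.
  by apply: rhobeta; rewrite x0.
have drift x y : 0 < x -> x <= L0 -> x <= y -> p0 y * rho x <= C1 * g.
  move=> x0 xL xy; apply: le_trans (drift' x y x0 xL xy) _.
  rewrite -[leRHS]mulr1; apply: ler_wpM2l; first exact: mulr_ge0.
  have := ge0_ler_powR (ltW dl0) (x := x) (y := 1); rewrite powR1; apply.
  - by rewrite nnegrE ltW.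
  - by rewrite nnegrE.
  - exact: le_trans L01.
have ggn : g * (g - 1) <= 0 by rewrite mulr_ge0_le0// ltW.
exists kap, ((g * L1 `^ (g - 1)) * Cb * (1 + L1^-1) + kap / L1), (C1 * g + kap); split.
- by [].
- apply: addr_ge0; last exact: divr_ge0.
  apply: mulr_ge0; last by rewrite addr_ge0// invr_ge0.
  by apply: mulr_ge0 => //; apply: mulr_ge0 => //; exact: powR_ge0.
- by apply: addr_ge0 => //; exact: mulr_ge0.
move=> eps /andP[eps0 epsL].
have heps : 0 < eps <= 1 by rewrite eps0 (le_trans epsL).
have TF := @test_fun_shift R F p0 s0 t0 eps (g * eps `^ (g - 1)) (cc * eps `^ (g - 2))
  (cc * (2 - g) * eps `^ (g - 3)) eps0.
do 3 eexists; exists (g * eps `^ (g - 1)), (g * eps `^ (g - 1)), (cc * eps `^ (g - 2)),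
  (cc * eps `^ (g - 2)), (cc * (2 - g) * eps `^ (g - 3)), (cc * (2 - g) * eps `^ (g - 3)).
have cge : 0 <= cc * (2 - g) by rewrite mulr_ge0 ?(ltW cc0)// subr_ge0; lra.
split; first apply: TF => //.
- exact: measurable_shift_powR.
- by apply: measurable_funM => //; exact: measurable_shift_powR.
- by apply: measurable_funM => //; exact: measurable_shift_powR.
- move=> z ez; rewrite pge/= /p0 add0r; apply: ler_wpM2l; first exact: ltW.
  exact: le0_ger_powR.
- move=> z ez; rewrite /s0 add0r normrM (ler0_norm ggn) (ger0_norm (powR_ge0 _ _)).
  rewrite (_ : - (g * (g - 1)) = cc); last by rewrite /cc; ring.
  apply: ler_wpM2l; first exact: ltW.
  by apply: le0_ger_powR => //; lra.
- move=> z ez; rewrite /t0 add0r normrM (ger0_norm (powR_ge0 _ _)).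
  rewrite (_ : g * (g - 1) * (g - 2) = cc * (2 - g)); last by rewrite /cc; ring.
  rewrite (ger0_norm cge); apply: ler_wpM2l => //.
  by apply: le0_ger_powR => //; lra.
- by split; apply: mulr_ge0 => //; exact: powR_ge0.
- move=> x x0 /=; rewrite (max_idPl x0) /F !add0r subr_ge0 lerBlDr.
  apply/andP; split.
    by apply: (ge0_ler_powR (ltW g0)); rewrite ?nnegrE ?addr_ge0 ?(ltW eps0)// lerDr.
  by apply: powR_subadditive => //; [rewrite g0 ltW|exact: ltW].
- move=> x x0 /=; apply: lyapunov_regions => //.
  + by rewrite mulr_ge0.
  + by rewrite mulr_ge0 ?powR_ge0.
  + by move=> y y0; rewrite /s0 mulr_le0_ge0// powR_ge0.
  + move=> x1 xe; apply: drift => //; first exact: le_trans (ltW xe) _.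
    by rewrite lerDl ltW.
  + move=> ex xL; have x1 := lt_le_trans eps0 ex.
    have xL0 : x <= L0 by rewrite (le_trans xL)// ge_min lexx.
    have y0 : 0 < x + eps by rewrite addr_gt0.
    have hq : x `^ dl <= q.
      have : x `^ dl <= (q `^ (dl^-1)) `^ dl.
        apply: (ge0_ler_powR (ltW dl0)); rewrite ?nnegrE ?powR_ge0//.
        by rewrite (le_trans xL)// ge_min lexx orbT.
      by rewrite -powRrM mulVf ?gt_eqF// powRr1// ltW.
    have hr : p0 (x + eps) * rho x <= kap.
      apply: le_trans (drift' x (x + eps) x1 xL0 _) _; first by rewrite lerDl ltW.
      apply: (@le_trans _ _ ((C1 * g + 1) * q)).
        have : C1 * g * x `^ dl <= C1 * g * q by apply: ler_wpM2l => //; exact: mulr_ge0.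
        by move: q0; lra.
      rewrite /q mulrC divfK// gt_eqF//.
    have hx : 4^-1 * x `^ (g - 2) <= (x + eps) `^ (g - 2).
      have y2 : x + eps <= 2 * x by lra.
      have g2 : g - 2 <= 0 by lra.
      apply: le_trans (le0_ger_powR g2 y0 y2).
      rewrite powRM//; apply: ler_wpM2r; first exact: powR_ge0.
      have -> : 4^-1 = 2 `^ (- 2%:R) :> R by rewrite powR_invn// -natrX.
      by apply: ler_powR; lra.
    have hs : s0 (x + eps) <= - (cc / 4 * x `^ (g - 2)).
      have := ler_wpM2l cc0' hx.
      have -> : s0 (x + eps) = - (cc * (x + eps) `^ (g - 2)) by rewrite /s0 /cc add0r; ring.
      lra.
    have hm := malpha (x := x) ltac:(by rewrite x0).
    have hsm : s0 (x + eps) * m x <= - (2 * kap).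
      apply: (@le_trans _ _ (- (cc / 4 * x `^ (g - 2)) * m x)).
        by apply: ler_wpM2r.
      rewrite mulNr lerN2.
      have -> : 2 * kap = cc / 4 * x `^ (g - 2) * (C2 * x `^ alpha).
        rewrite mulrACA (_ : g - 2 = - alpha); last by rewrite /g; ring.
        rewrite powRN mulVf ?mulr1; last by rewrite gt_eqF// powR_gt0.
        by rewrite /kap; field.
      apply: ler_wpM2l => //; apply: mulr_ge0; last exact: powR_ge0.
      exact: divr_ge0.
    lra.
  + move=> xL; rewrite /p0 add0r; apply: ler_wpM2l => //.
    by apply: le0_ger_powR => //; rewrite (le_trans (ltW xL))// lerDl ltW.
Qed.

End lyapunov.

(** * The coalescence estimate *)

Section bounded_convergence.
Context {d : measure_display} {T : measurableType d} {R : realType}.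
Variables (mu : {measure set T -> \bar R}) (D : set T).
Hypotheses (mD : measurable D) (fD : (mu D < +oo)%E).

Lemma Rintegral_bounded_cvg0 (f : nat -> T -> R) :
  (forall n, measurable_fun D (f n)) ->
  (forall n x, D x -> `|f n x| <= 1) ->
  (forall x, D x -> f ^~ x @ \oo --> (0 : R)) ->
  (fun n => \int[mu]_(x in D) f n x) @ \oo --> (0 : R).
Proof.
move=> mf f1 fc.
have f_f : {ae mu, forall x, D x -> (fun n => (f n x)%:E) @ \oo --> (cst 0%E : T -> \bar R) x}.
  apply: aeW => x Dx; apply/fine_cvgP; split; first exact: nearW.
  exact: fc.
have f_g : {ae mu, forall x n, D x -> (`|(f n x)%:E| <= (cst 1%E : T -> \bar R) x)%E}.
  by apply: aeW => x n Dx; rewrite /= lee_fin; exact: f1.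
have mf' n : measurable_fun D (fun x => (f n x)%:E) by exact/measurable_EFinP.
have [_ _] := dominated_convergence mD mf' (measurable_cst _) f_f
  (rint_cst mD 1 fD) f_g.
by rewrite integral0 => /fine_cvg.
Qed.

End bounded_convergence.

Lemma lyapunov_arith {R : realFieldType} (a b c d e f g h k K Ce : R) :
  a <= b -> c <= d -> b - c <= e -> e <= - k * f + K * g + Ce * h ->
  a + k * f <= d + K * g + Ce * h.
Proof. lra. Qed.

Lemma sup_arith1 {R : realFieldType} (U A I J S d : R) :
  U + A <= 2 * d + I -> 0 <= A -> I <= J -> J <= 2^-1 * S -> U <= 2 * d + 2^-1 * S.
Proof. lra. Qed.

Lemma sup_arith2 {R : realFieldType} (r S d : R) :
  S <= 2 * d + 2^-1 * S -> r <= S -> r <= 4 * d.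
Proof. lra. Qed.

Lemma direct_arith {R : realFieldType} (U A B I J d : R) :
  U + B <= 2 * d + I -> 0 <= U -> A <= B -> I <= J -> J <= 2^-1 * (4 * d) -> A <= 4 * d.
Proof. lra. Qed.

Lemma power_arith {R : realFieldType} (k G S a b c e X : R) :
  a <= k / 4 * S -> b <= c -> 2^-1 * (k * G) <= a + X + b ->
  k * G <= 2^-1 * (k * S) + 2 * (X + c).
Proof. lra. Qed.

Lemma power_arith2 {R : realFieldType} (x e : R) :
  x <= 2^-1 * x + 2 * e -> x <= 2 * (2 * e).
Proof. lra. Qed.

(** With a threshold [a * t] proportional to time, multiplication by [t^k] frees the middle term of
    [t] and turns the first one into the same weighted quantity at time [t / 2]. *)
Lemma rescale_arith {R : realFieldType} (t a A X Z : R) (k : nat) : t != 0 -> a != 0 ->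
  t ^+ k * (a * t * A + (a * t)^-1 ^+ k * X + Z) =
  a * 2 ^+ k.+1 * ((t / 2) ^+ k.+1 * A) + a^-1 ^+ k * X + t ^+ k * Z.
Proof.
move=> t0 a0.
have e1 : 2 ^+ k.+1 * (t / 2) ^+ k.+1 = t ^+ k.+1 by rewrite -exprMn mulrC divfK.
have e2 : t ^+ k * (a * t)^-1 ^+ k = a^-1 ^+ k.
  by rewrite -exprMn invfM mulrCA divff// mulr1.
rewrite !mulrDr; congr (_ + _); congr (_ + _); last by rewrite mulrA e2.
have -> : a * 2 ^+ k.+1 * ((t / 2) ^+ k.+1 * A) = a * (2 ^+ k.+1 * (t / 2) ^+ k.+1) * A.
  by rewrite !mulrA.
by rewrite e1 exprS !mulrA [t ^+ k * a]mulrC -!mulrA [t ^+ k * _]mulrCA.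
Qed.

(** Put [z = x^g]. If [z <= c] the first term suffices. Otherwise [c^k * z] is at most
    [z^(k+1) <= z^(1/g) = x] when [z <= 1], and at most [z <= z^(1/g)] when [z > 1]. An integer
    [k >= 1/g - 1] keeps the later rescaling within integer powers. *)
Lemma powR_split_le {R : realType} (g c x : R) (k : nat) : 0 < g -> g < 1 ->
  g^-1 <= k.+1%:R -> 0 < c <= 1 -> 0 <= x ->
  x `^ g <= c * pos01 x + c^-1 ^+ k * x.
Proof.
move=> g0 g1 gk /andP[c0 c1]; rewrite le_eqVlt => /predU1P[<-|x0].
  by rewrite powR0 ?gt_eqF// /pos01 ltxx/= !mulr0 addr0.
rewrite /pos01 x0 mulr1.
set z := x `^ g; have z0 : 0 < z by rewrite powR_gt0.
have [zc|cz] := leP z c.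
  by rewrite ler_wpDr// mulr_ge0 ?ltW// exprn_gt0// invr_gt0.
apply: ler_wpDl; first exact: ltW.
have xz : x = z `^ (g^-1) by rewrite -powRrM divff ?gt_eqF// powRr1// ltW.
rewrite exprVn mulrC ler_pdivlMr ?exprn_gt0// [leRHS]xz.
have [z1|z1] := leP z 1.
  apply: (@le_trans _ _ (z ^+ k.+1)).
    rewrite exprS; apply: ler_wpM2l; first exact: ltW.
    by rewrite lerXn2r ?nnegrE// ltW.
  rewrite -(powR_mulrn k.+1 (ltW z0)); apply: ger_powR => //.
  by rewrite z0.
apply: (@le_trans _ _ z).
  by rewrite ler_piMr ?(ltW z0)// exprn_ile1// ltW.
by apply: le1r_powR; [exact: ltW|rewrite invf_ge1// ltW].
Qed.

Section coalescence.
Context {R : realType} {d : measure_display} {T : measurableType d}.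
Variable P : probability T R.
Notation leb := (@lebesgue_measure R).

Lemma measurable_pos01 : measurable_fun setT (@pos01 R).
Proof.
have -> : @pos01 R = \1_(`]0, +oo[).
  by apply/funext => x; rewrite /pos01 indicE mem_setE in_itv/= andbT.
exact: measurable_indic.
Qed.

Lemma measurable_small01 eps : measurable_fun setT (@small01 R eps).
Proof.
have -> : @small01 R eps = \1_(`]0, eps[).
  by apply/funext => x; rewrite /small01 indicE mem_setE in_itv/=.
exact: measurable_indic.
Qed.

Lemma pos01_bound (x : R) : 0 <= pos01 x <= 1.
Proof. by rewrite /pos01; case: (0 < x)%R; rewrite /= ?lexx ?ler01. Qed.

Lemma small01_bound eps (x : R) : 0 <= small01 eps x <= 1.
Proof. by rewrite /small01; case: (0 < x < eps)%R; rewrite /= ?lexx ?ler01. Qed.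

Variables (tau delta : R) (rho m : R -> R) (Cb C4 : R) (Y M : R -> T -> R).
Hypothesis tau0 : 0 < tau.
Hypothesis delta0 : 0 <= delta.
Hypothesis Cb0 : 0 <= Cb.
Hypothesis Cbtau : Cb * tau <= 2^-1.
Hypothesis DP : diff_proc P tau delta rho m Cb C4 Y M.

(** The probability that the two points have not met by time [r], as a real integral so that it can
    be integrated over time. *)
Definition alive r := \int[P]_w pos01 (Y r w).
Definition meanY r := \int[P]_w Y r w.
Definition near0 eps r := \int[P]_w small01 eps (Y r w).

Hypothesis absorb : forall u v, 0 <= u -> u <= v -> v <= tau -> alive v <= alive u.

Let mYr r : measurable_fun setT (Y r).
Proof. exact: (measurable_section2 r (dp_mY DP)). Qed.

Lemma rint_fY (q : R -> R) a b r : 0 <= r <= tau -> 0 <= b -> measurable_fun setT q ->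
  (forall x, 0 <= x -> `|q x| <= a + b * x) -> rint P setT (fun w => q (Y r w)).
Proof.
move=> hr b0 mq qab; have [C lin] := prob_lin tau0 Cb0 Cbtau DP.
apply: (lin r a b _ hr b0 _ _).1; first exact: (measurableT_comp mq (mYr r)).
by move=> w; apply: qab; exact: dp_Y0 DP _ _.
Qed.

Lemma rint_itv_fY (q : R -> R) a b u v : 0 <= u -> u <= v -> v <= tau -> 0 <= b ->
  measurable_fun setT q ->
  (forall x, 0 <= x -> `|q x| <= a + b * x) ->
  rint leb `[u, v] (fun r => \int[P]_w q (Y r w)).
Proof.
move=> u0 uv vt b0 mq qab.
have mG : measurable_fun setT (fun z : R * T => q (Y z.1 z.2)).
  exact: (measurableT_comp mq (dp_mY DP)).
have Gl r w : `|q (Y r w)| <= a + b * Y r w by apply: qab; exact: dp_Y0 DP _ _.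
by have [] := dp_Fubini tau0 Cb0 Cbtau DP u0 uv vt b0 mG Gl.
Qed.

Let pos_lin x : 0 <= x -> `|pos01 x| <= 1 + 0 * x :> R.
Proof. by move=> _; have /andP[h1 h2] := pos01_bound x; rewrite mul0r addr0 ger0_norm. Qed.
Let small_lin eps x : 0 <= x -> `|small01 eps x| <= 1 + 0 * x :> R.
Proof. by move=> _; have /andP[h1 h2] := small01_bound eps x; rewrite mul0r addr0 ger0_norm. Qed.
Let id_lin (x : R) : 0 <= x -> `|id x| <= 0 + 1 * x :> R.
Proof. by move=> x0; rewrite add0r mul1r ger0_norm. Qed.

Let i_pos r : 0 <= r <= tau -> rint P setT (fun w => pos01 (Y r w)).
Proof. by move=> hr; apply: (rint_fY hr (lexx 0) measurable_pos01 pos_lin). Qed.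
Let i_small eps r : 0 <= r <= tau -> rint P setT (fun w => small01 eps (Y r w)).
Proof. by move=> hr; apply: (rint_fY hr (lexx 0) (measurable_small01 eps) (@small_lin eps)). Qed.
Let i_Y r : 0 <= r <= tau -> rint P setT (Y r).
Proof. by move=> hr; apply: (@rint_fY id 0 1 r hr ler01 _ id_lin). Qed.

Lemma i_alive u v : 0 <= u -> u <= v -> v <= tau -> rint leb `[u, v] alive.
Proof. by move=> u0 uv vt; exact: (rint_itv_fY u0 uv vt (lexx 0) measurable_pos01 pos_lin). Qed.
Lemma i_near0 eps u v : 0 <= u -> u <= v -> v <= tau -> rint leb `[u, v] (near0 eps).
Proof.
by move=> u0 uv vt; exact: (rint_itv_fY u0 uv vt (lexx 0) (measurable_small01 eps) (@small_lin eps)).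
Qed.
Lemma i_mean u v : 0 <= u -> u <= v -> v <= tau -> rint leb `[u, v] meanY.
Proof. by move=> u0 uv vt; exact: (@rint_itv_fY id 0 1 u v u0 uv vt ler01 _ id_lin). Qed.

Let itv_sub u v r : 0 <= u -> v <= tau -> u <= r <= v -> 0 <= r <= tau.
Proof. by move=> u0 vt /andP[ur rv]; rewrite (le_trans u0 ur) (le_trans rv vt). Qed.

(** Trading [f] for [U0] at the final time and for [U1] at the initial time removes [eps] from both
    ends; it survives in the last term only. *)
Lemma lyapunov_ineq kap K Ce eps (U0 U1 : R -> R) c u v :
  lyapunov rho m kap K Ce eps U0 U1 ->
  measurable_fun setT U0 -> measurable_fun setT U1 -> 0 <= c ->
  (forall x, 0 <= x -> `|U0 x| <= c + c * x) -> (forall x, 0 <= x -> `|U1 x| <= c + c * x) ->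
  0 <= u -> u <= v -> v <= tau ->
  \int[P]_w U0 (Y v w) + kap * \int[leb]_(r in `[u, v]) alive r <=
  \int[P]_w U1 (Y u w) + K * \int[leb]_(r in `[u, v]) meanY r +
  Ce * \int[leb]_(r in `[u, v]) near0 eps r.
Proof.
move=> [f [p [s [Kf [Kp [Lp [Ks [Ls [Kt [TF [Lp0 Ls0 Kt0] fU gen]]]]]]]]]].
move=> mU0 mU1 c0 U0c U1c u0 uv vt.
have D := dynkin tau0 Cb0 Cbtau DP TF Lp0 Ls0 Kt0 u0 uv vt.
have hu : 0 <= u <= tau by rewrite u0 (le_trans uv).
have hv : 0 <= v <= tau by rewrite (le_trans u0 uv).
have iu := dp_int_f tau0 Cb0 Cbtau DP TF hu.
have iv := dp_int_f tau0 Cb0 Cbtau DP TF hv.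
have h1 : \int[P]_w U0 (Y v w) <= \int[P]_w f (Y v w).
  apply: le_Rintegral => //; first exact: (rint_fY hv c0 mU0 U0c).
  by move=> w _; have /andP[] := fU _ (dp_Y0 DP v w).
have h2 : \int[P]_w f (Y u w) <= \int[P]_w U1 (Y u w).
  apply: le_Rintegral => //; first exact: (rint_fY hu c0 mU1 U1c).
  by move=> w _; have /andP[] := fU _ (dp_Y0 DP u w).
have ja := i_alive u0 uv vt; have jn := i_near0 eps u0 uv vt; have jm := i_mean u0 uv vt.
have gbound x : 0 <= x -> `|p x * rho x + s x * m x| <= (Kp * Cb + 2 * Ks) + Kp * Cb * x.
  move=> x0; apply: le_trans (ler_normD _ _) _; rewrite !normrM.
  have /andP[p0 pK] := tf_p TF x; have sK := tf_s TF x.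
  have /andP[r0 rK] := dp_rho DP x0; have /andP[m0 mK] := dp_m DP x.
  rewrite (ger0_norm p0) (ger0_norm r0) (ger0_norm m0).
  have e1 : p x * rho x <= Kp * (Cb * (1 + x)) by apply: ler_pM.
  have e2 : `|s x| * m x <= Ks * 2 by apply: ler_pM.
  lra.
have Kp0 : 0 <= Kp by have /andP[] := tf_p TF 0; exact: le_trans.
have mg : measurable_fun setT (fun x => p x * rho x + s x * m x).
  apply: measurable_funD; apply: measurable_funM.
  - exact: tf_mp TF.
  - exact: dp_mrho DP.
  - exact: tf_ms TF.
  - exact: dp_mm DP.
have h3 : \int[leb]_(r in `[u, v]) \int[P]_w (p (Y r w) * rho (Y r w) + s (Y r w) * m (Y r w))
    <= \int[leb]_(r in `[u, v]) ((- kap * alive r + K * meanY r) + Ce * near0 eps r).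
  apply: le_Rintegral_itv.
  - apply: (@rint_itv_fY (fun x => p x * rho x + s x * m x) (Kp * Cb + 2 * Ks) (Kp * Cb)) => //.
    by rewrite mulr_ge0.
  - apply: rintD => //; last exact: rintZ.
    by apply: rintD => //; exact: rintZ.
  - move=> r hr; have hr' := itv_sub u0 vt hr.
    have ip := i_pos hr'; have is_ := i_small eps hr'; have iy := i_Y hr'.
    have jp := rintZ measurableT (- kap) ip; have jy := rintZ measurableT K iy.
    have js := rintZ measurableT Ce is_; have jpy := rintD measurableT jp jy.
    have -> : - kap * alive r + K * meanY r + Ce * near0 eps r =
      \int[P]_w ((- kap * pos01 (Y r w) + K * Y r w) + Ce * small01 eps (Y r w)).
      rewrite (RintegralD measurableT jpy js) (RintegralD measurableT jp jy).
      by rewrite (RintegralZl _ measurableT ip) (RintegralZl _ measurableT iy) (RintegralZl _ measurableT is_).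
    apply: le_Rintegral => //.
    + apply: (@rint_fY (fun x => p x * rho x + s x * m x) (Kp * Cb + 2 * Ks) (Kp * Cb)) => //.
      by rewrite mulr_ge0.
    + exact: rintD.
    + by move=> w _; exact: gen _ (dp_Y0 DP r w).
have mI : measurable (`[u, v]%classic : set (measurableTypeR R)) by exact: measurable_itv.
have za := rintZ mI (- kap) ja; have zm := rintZ mI K jm; have zn := rintZ mI Ce jn.
move: h3; rewrite (RintegralD mI (rintD mI za zm) zn) (RintegralD mI za zm).
rewrite (RintegralZl _ mI ja) (RintegralZl _ mI jm) (RintegralZl _ mI jn).
exact: lyapunov_arith h1 h2 D.
Qed.

(** For a fixed outcome and time [small01 eps] is eventually 0: either [Y] is 0, where the indicator
    vanishes, or [Y] is positive and exceeds small [eps]. Bounded convergence is applied in the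
    outcome, then in time. *)
Lemma near0_small u v eps0 eta : 0 <= u -> u <= v -> v <= tau -> 0 < eps0 -> 0 < eta ->
  exists2 eps, 0 < eps <= eps0 & \int[leb]_(r in `[u, v]) near0 eps r <= eta.
Proof.
move=> u0 uv vt e0 eta0.
pose en n : R := eps0 / n.+1%:R.
have en0 n : 0 < en n by rewrite divr_gt0.
have ene n : en n <= eps0 by rewrite ler_pdivrMr// ler_peMr ?ler1n// ltW.
have c1 r : 0 <= r <= tau -> (fun n => near0 (en n) r) @ \oo --> (0 : R).
  move=> hr; apply: Rintegral_bounded_cvg0 => //.
  - exact: P_setT_lty.
  - move=> n; exact: (measurableT_comp (measurable_small01 (en n)) (mYr r)).
  - by move=> n w _; have /andP[h1 h2] := small01_bound (en n) (Y r w); rewrite ger0_norm.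
  - move=> w _; have [Y0|Ypos] := leP (Y r w) 0.
      rewrite (_ : (fun n => _) = cst 0); first exact: cvg_cst.
      by apply/funext => n; rewrite /small01 ltNge Y0.
    apply: cvg_near_cst; near=> n.
    rewrite /small01 Ypos/= ltNge.
    suff -> : en n <= Y r w by [].
    rewrite /en ler_pdivrMr// mulrC -ler_pdivrMr//.
    near: n.
    exists (Num.truncn (eps0 / Y r w)) => // n /= hn.
    apply: ltW; apply: lt_le_trans (truncnS_gt _) _.
    by rewrite ler_nat ltnS.
have c2 : (fun n => \int[leb]_(r in `[u, v]) near0 (en n) r) @ \oo --> (0 : R).
  apply: Rintegral_bounded_cvg0 => //.
  - exact: leb_itv_lty.
  - by move=> n; apply: rint_measurable; exact: i_near0.
  - move=> n r; rewrite /= in_itv/= => hr; have hr' := itv_sub u0 vt hr.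
    have is_ := i_small (en n) hr'.
    rewrite ger0_norm; last first.
      by apply: Rintegral_ge0 => w _; have /andP[] := small01_bound (en n) (Y r w).
    rewrite -[leRHS](Rintegral_Pcst P); apply: le_Rintegral => //; first exact: rintP_cst.
    by move=> w _; have /andP[] := small01_bound (en n) (Y r w).
  - by move=> r; rewrite /= in_itv/= => hr; apply: c1; exact: itv_sub hr.
have /cvgrPdist_le/(_ _ eta0)[N _ HN] := c2.
exists (en N); first by rewrite en0 ene.
have := HN N (leqnn N); rewrite /= sub0r normrN => h.
exact: le_trans (ler_norm _) h.
Unshelve. all: by end_near. Qed.

Lemma lyapunov_limit kap K Ce eps0 (U0 U1 : R -> R) c u v :
  0 < eps0 -> 0 <= Ce ->
  (forall eps, 0 < eps <= eps0 -> lyapunov rho m kap K Ce eps U0 U1) ->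
  measurable_fun setT U0 -> measurable_fun setT U1 -> 0 <= c ->
  (forall x, 0 <= x -> `|U0 x| <= c + c * x) -> (forall x, 0 <= x -> `|U1 x| <= c + c * x) ->
  0 <= u -> u <= v -> v <= tau ->
  \int[P]_w U0 (Y v w) + kap * \int[leb]_(r in `[u, v]) alive r <=
  \int[P]_w U1 (Y u w) + K * \int[leb]_(r in `[u, v]) meanY r.
Proof.
move=> e0 Ce0 lyap mU0 mU1 c0 U0c U1c u0 uv vt.
apply/ler_addgt0Pr => e e1.
(* The [+ 1] covers the case [Ce = 0]. *)
have ee : 0 < e / (Ce + 1) by rewrite divr_gt0// ltr_wpDl.
have [eps heps hn] := near0_small u0 uv vt e0 ee.
apply: le_trans (lyapunov_ineq (lyap eps heps) mU0 mU1 c0 U0c U1c u0 uv vt) _.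
rewrite lerD2l; apply: (@le_trans _ _ (Ce * (e / (Ce + 1)))); first exact: ler_wpM2l.
rewrite mulrCA ler_piMr ?(ltW e1)// ler_pdivrMr ?mul1r ?lerDl// ltr_wpDl//.
Qed.

Lemma alive_bound r : 0 <= r <= tau -> 0 <= alive r <= 1.
Proof.
move=> hr; apply/andP; split.
  by apply: Rintegral_ge0 => w _; have /andP[] := pos01_bound (Y r w).
rewrite -[leRHS](Rintegral_Pcst P); apply: le_Rintegral => //; [exact: i_pos|exact: rintP_cst|].
by move=> w _; have /andP[] := pos01_bound (Y r w).
Qed.

Lemma meanY_ge0 r : 0 <= meanY r.
Proof. by apply: Rintegral_ge0 => w _; exact: dp_Y0 DP _ _. Qed.

Lemma alive_integral u v : 0 <= u -> u <= v -> v <= tau ->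
  alive v * (v - u) <= \int[leb]_(r in `[u, v]) alive r.
Proof.
move=> u0 uv vt; rewrite -Rintegral_itv_cst//; apply: le_Rintegral_itv.
- exact: rint_itv_cst.
- exact: i_alive.
- by move=> r /andP[ur rv]; apply: absorb => //; exact: le_trans ur.
Qed.

(** * The mean gap at short times *)

Section scale.
Variables (kap K Ce eps0 : R).
Hypotheses (kap0 : 0 <= kap) (K0 : 0 <= K) (Ce0 : 0 <= Ce) (e0 : 0 < eps0).
Hypothesis Ktau : K * tau <= 2^-1.
Hypothesis lyap : forall eps, 0 < eps <= eps0 -> lyapunov rho m kap K Ce eps id (fun x => 2 * x).

Lemma scale_ineq v : 0 <= v <= tau ->
  meanY v + kap * \int[leb]_(r in `[0, v]) alive r <=
  2 * delta + K * \int[leb]_(r in `[0, v]) meanY r.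
Proof.
move=> /andP[v0 vt].
have h2 x : 0 <= x -> `|2 * x| <= 2 + 2 * x :> R.
  by move=> x0; rewrite ger0_norm ?mulr_ge0// lerDr.
have h1 x : 0 <= x -> `|id x| <= 2 + 2 * x :> R.
  by move=> x0 /=; rewrite ger0_norm//; lra.
have m2 : measurable_fun setT (fun x : R => 2 * x) by exact: measurable_funM.
have := lyapunov_limit e0 Ce0 lyap (@measurable_id _ _ _) m2 (ler0n _ 2) h1 h2 (lexx 0) v0 vt.
move=> /le_trans; apply; rewrite lerD2r.
have h0 : 0 <= (0 : R) <= tau by rewrite lexx ltW.
rewrite RintegralZl//; last exact: i_Y.
apply: ler_wpM2l => //; rewrite -[leRHS](Rintegral_Pcst P).
apply: le_Rintegral => //; [exact: i_Y|exact: rintP_cst|].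
by move=> w _; exact: dp_init DP _.
Qed.

(** The supremum [S] over [[0, tau]] is finite by [prob_lin], so that [S <= 2 * delta + S / 2] can
    be solved for it. *)
Lemma meanY_le r : 0 <= r <= tau -> meanY r <= 4 * delta.
Proof.
have [C lin] := prob_lin tau0 Cb0 Cbtau DP.
pose A := [set meanY r | r in `[0, tau]%classic].
have Aub : has_ubound A.
  exists (0 + 1 * C) => _ [q + <-]; rewrite /= in_itv/= => hq.
  have [_ h] := lin q 0 1 (Y q) hq ler01 (mYr q)
    (fun w => ltac:(by rewrite add0r mul1r ger0_norm// (dp_Y0 DP))).
  apply: le_trans h; apply: le_Rintegral => //; first exact: i_Y.
    by apply: rint_abs => //; exact: i_Y.
  by move=> w _; exact: ler_norm.
have A0 : A !=set0 by exists (meanY 0), 0 => //=; rewrite in_itv/= lexx ltW.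
have leS q : 0 <= q <= tau -> meanY q <= sup A.
  by move=> hq; apply: ub_le_sup => //; exists q => //=; rewrite in_itv.
have S0 : 0 <= sup A.
  by apply: le_trans (leS 0 _); [exact: meanY_ge0|rewrite lexx ltW].
have key q : 0 <= q <= tau -> meanY q <= 2 * delta + 2^-1 * sup A.
  move=> hq; have /andP[q0 qt] := hq.
  have ha : 0 <= \int[leb]_(r in `[0, q]) alive r.
    apply: Rintegral_ge0 => z; rewrite /= in_itv/= => hz.
    by have /andP[] := alive_bound (itv_sub (lexx 0) qt hz).
  have hm : \int[leb]_(r in `[0, q]) meanY r <= sup A * (q - 0).
    apply: Rintegral_itv_le_cst => //; first exact: i_mean.
    by move=> z hz; apply: leS; exact: itv_sub hz.
  have h4 := ler_wpM2l K0 hm; rewrite subr0 in h4.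
  have h3 : K * (sup A * q) <= 2^-1 * sup A.
    rewrite mulrCA mulrC; apply: ler_wpM2r => //.
    by apply: le_trans Ktau; apply: ler_wpM2l.
  exact: sup_arith1 (scale_ineq hq) (mulr_ge0 kap0 ha) h4 h3.
have : sup A <= 2 * delta + 2^-1 * sup A.
  by apply: ge_sup => // _ [q + <-]; rewrite /= in_itv/= => hq; exact: key.
by move=> hS hr; exact: sup_arith2 hS (leS r hr).
Qed.

Lemma meanY_integral u v : 0 <= u -> u <= v -> v <= tau ->
  \int[leb]_(r in `[u, v]) meanY r <= 4 * delta * (v - u).
Proof.
move=> u0 uv vt; apply: Rintegral_itv_le_cst => //; first exact: i_mean.
by move=> z hz; apply: meanY_le; exact: itv_sub hz.
Qed.

(** Once the mean gap is controlled, the right side of [scale_ineq] is at most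
    [2 * delta + 2 * delta], and its dissipation term is at least [kap * tau] times the survival
    probability at [tau]. This is informative when [kap > 0], as in the case [beta = 0]. *)
Lemma alive_direct : kap * (alive tau * tau) <= 4 * delta.
Proof.
have ht : 0 <= tau <= tau by rewrite ltW//=.
have h1 := alive_integral (lexx 0) (ltW tau0) (lexx tau).
have h2 := meanY_integral (lexx 0) (ltW tau0) (lexx tau).
have h3 := scale_ineq ht; have h4 := meanY_ge0 tau.
move: (ler_wpM2l kap0 h1) (ler_wpM2l K0 h2); rewrite !subr0 => h5 h6.
have h7 : K * (4 * delta * tau) <= 2^-1 * (4 * delta).
  by rewrite mulrCA mulrC; apply: ler_wpM2r => //; exact: mulr_ge0.
exact: direct_arith h3 h4 h5 h6 h7.
Qed.

End scale.

(** * Survival bound through the power function *)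

Section power.
Variables (kap K Ce eps0 g : R) (k : nat).
Hypotheses (kap0 : 0 < kap) (K0 : 0 <= K) (Ce0 : 0 <= Ce) (e0 : 0 < eps0).
Hypotheses (g0 : 0 < g) (g1 : g < 1) (gk : g^-1 <= k.+1%:R) (tau1 : tau <= 1).
Hypothesis lyap : forall eps, 0 < eps <= eps0 ->
  lyapunov rho m kap K Ce eps (fun=> 0) (fun x => x `^ g).
Hypothesis mean4 : forall r, 0 <= r <= tau -> meanY r <= 4 * delta.

(** The inequality for [Y^g] with its final value dropped; [powR_split_le] then trades the mean of
    [Y^g] at time [u] for a small multiple of the survival probability and a large multiple of the
    mean gap. *)
Lemma power_ineq c u v : 0 < c <= 1 -> 0 <= u -> u <= v -> v <= tau ->
  kap * (alive v * (v - u)) <=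
  c * alive u + c^-1 ^+ k * (4 * delta) + K * (4 * delta).
Proof.
move=> hc u0 uv vt; have /andP[c0 c1] := hc.
have hu : 0 <= u <= tau by rewrite u0 (le_trans uv).
have h1 x : 0 <= x -> `|0 : R| <= 1 + 1 * x.
  by move=> x0; rewrite normr0 mul1r addr_ge0.
have h2 x : 0 <= x -> `|x `^ g| <= 1 + 1 * x :> R.
  move=> x0; rewrite ger0_norm ?powR_ge0// mul1r.
  have := powR_split_le (c := 1) (k := k) g0 g1 gk ltac:(by rewrite ltr01 lexx) x0.
  move=> /le_trans; apply; rewrite mul1r invr1 expr1n mul1r lerD2r.
  by have /andP[] := pos01_bound x.
have L := lyapunov_limit e0 Ce0 lyap (measurable_cst _) (measurable_powR g) ler01 h1 h2 u0 uv vt.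
rewrite Rintegral_Pcst add0r in L.
have ia := ler_wpM2l (ltW kap0) (alive_integral u0 uv vt).
apply: le_trans ia _; apply: le_trans L _.
have iu := i_Y hu; have ip := i_pos hu.
have jc := rintZ measurableT c ip; have jk := rintZ measurableT (c^-1 ^+ k) iu.
apply: lerD.
  apply: (@le_trans _ _ (\int[P]_w (c * pos01 (Y u w) + c^-1 ^+ k * Y u w))).
    apply: le_Rintegral => //.
    - exact: (rint_fY hu ler01 (measurable_powR g) h2).
    - exact: rintD.
    - by move=> w _; apply: powR_split_le => //; exact: dp_Y0 DP _ _.
  rewrite (RintegralD measurableT jc jk) (RintegralZl _ measurableT ip) (RintegralZl _ measurableT iu).
  rewrite lerD2l; apply: ler_wpM2l; last exact: mean4.
  by rewrite exprn_ge0// invr_ge0 ltW.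
apply: ler_wpM2l => //.
apply: (@le_trans _ _ (4 * delta * (v - u))).
  apply: Rintegral_itv_le_cst => //; first exact: i_mean.
  by move=> z hz; apply: mean4; exact: itv_sub hz.
rewrite ler_piMr ?mulr_ge0//; apply: le_trans tau1; apply: le_trans vt.
by rewrite gerBl.
Qed.

(** The threshold used at time [t] is [power_rate * t]. Its size ensures
    [power_rate * 2^(k+1) <= kap / 4], half of the coefficient [kap / 2] that the step from [t / 2]
    to [t] leaves on the left, so the term at [t / 2] is absorbed. [power_const] is what solving for
    the supremum then gives. *)
Definition power_rate := Num.min 1 (kap / 2 ^+ k.+3).
Definition power_const :=
  2 * (2 / kap * (power_rate^-1 ^+ k * 4 + K * 4)) / tau ^+ k.+1.

(** The weight [t^(k+1)] makes the supremum finite beforehand (at most 1, since [tau <= 1]), so the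
    half of it that returns from time [t / 2] can be subtracted. *)
Lemma alive_power : alive tau <= power_const * delta.
Proof.
set a := power_rate.
have a0 : 0 < a by rewrite lt_min ltr01 divr_gt0// exprn_gt0.
have a1 : a <= 1 by rewrite ge_min lexx.
have ak : a * 2 ^+ k.+1 <= kap / 4.
  apply: (@le_trans _ _ (kap / 2 ^+ k.+3 * 2 ^+ k.+1)).
    by apply: ler_wpM2r; rewrite ?exprn_ge0// ge_min lexx orbT.
  rewrite le_eqVlt; apply/orP; left; apply/eqP.
  have -> : 2 ^+ k.+3 = 4 * 2 ^+ k.+1 :> R by rewrite !exprS; ring.
  by field; rewrite expf_neq0.
pose G t := t ^+ k.+1 * alive t.
pose A := [set G t | t in `[0, tau]%classic].
have Gub t : 0 <= t <= tau -> G t <= 1.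
  move=> ht; have /andP[t0 tt] := ht; have /andP[h1 h2] := alive_bound ht.
  rewrite -[leRHS]mulr1; apply: ler_pM => //; first exact: exprn_ge0.
  by rewrite exprn_ile1// (le_trans tt).
have Aub : has_ubound A.
  by exists 1 => _ [t + <-]; rewrite /= in_itv/=; exact: Gub.
have A0 : A !=set0 by exists (G 0), 0 => //=; rewrite in_itv/= lexx ltW.
have leS q : 0 <= q <= tau -> G q <= sup A.
  by move=> hq; apply: ub_le_sup => //; exists q => //=; rewrite in_itv.
set S := sup A in leS.
have S0 : 0 <= S.
  by apply: le_trans (leS 0 _); [rewrite /G expr0n/= mul0r|rewrite lexx ltW].
set X := 4 * delta; have X0 : 0 <= X by rewrite mulr_ge0.
set E0 := a^-1 ^+ k * X + K * X.
have E00 : 0 <= E0 by rewrite addr_ge0// mulr_ge0// exprn_ge0// invr_ge0 ltW.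
have key t : 0 <= t <= tau -> kap * G t <= 2^-1 * (kap * S) + 2 * E0.
  move=> ht; have /andP[t0 tt] := ht.
  have rhs0 : 0 <= 2^-1 * (kap * S) + 2 * E0.
    by rewrite addr_ge0 ?mulr_ge0// ltW.
  move: t0; rewrite le_eqVlt => /predU1P[<-|t0].
    by rewrite /G expr0n/= mul0r mulr0.
  have t1 : t <= 1 by exact: le_trans tt tau1.
  have th : 0 <= t / 2 <= tau.
    by rewrite divr_ge0 ?(ltW t0)//= (le_trans _ tt)// ler_piMr ?(ltW t0)// invf_le1 ?ler1n.
  have ht2 : t / 2 <= t by rewrite ler_piMr ?(ltW t0)// invf_le1 ?ler1n.
  have at0 : 0 < a * t <= 1 by rewrite mulr_gt0//= mulr_ile1// ltW.
  have /andP[th0 _] := th.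
  have I := power_ineq at0 th0 ht2 tt; rewrite -/X in I.
  have tk0 : 0 <= t ^+ k by rewrite exprn_ge0// ltW.
  have {I} := ler_wpM2l tk0 I.
  have -> : t ^+ k * (kap * (alive t * (t - t / 2))) = 2^-1 * (kap * G t).
    by rewrite /G exprS; field.
  have -> : t ^+ k * (a * t * alive (t / 2) + (a * t)^-1 ^+ k * X + K * X) =
     a * 2 ^+ k.+1 * G (t / 2) + a^-1 ^+ k * X + t ^+ k * (K * X).
    by apply: rescale_arith; rewrite gt_eqF.
  have h1 : a * 2 ^+ k.+1 * G (t / 2) <= kap / 4 * S.
    apply: ler_pM => //; last exact: leS.
    - by rewrite mulr_ge0 ?exprn_ge0// ltW.
    - by rewrite /G mulr_ge0 ?exprn_ge0//; have /andP[] := alive_bound th.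
  have h2 : t ^+ k * (K * X) <= K * X.
    by rewrite ler_piMl ?mulr_ge0// exprn_ile1// ltW.
  exact: power_arith h1 h2.
have hS : kap * S <= 2^-1 * (kap * S) + 2 * E0.
  rewrite -ler_pdivlMl//; apply: ge_sup => // _ [q + <-]; rewrite /= in_itv/= => hq.
  by rewrite ler_pdivlMl//; exact: key.
have hS2 : S <= 2 * (2 / kap * E0).
  have -> : 2 * (2 / kap * E0) = kap^-1 * (2 * (2 * E0)) by field; rewrite gt_eqF.
  by rewrite ler_pdivlMl//; exact: power_arith2.
have ht : 0 <= tau <= tau by rewrite ltW//=.
have := le_trans (leS tau ht) hS2.
rewrite /G -ler_pdivlMl ?exprn_gt0// => /le_trans; apply.
rewrite le_eqVlt; apply/orP; left; apply/eqP.
by rewrite /E0 /power_const -/a /X; field; rewrite ?expf_neq0 ?gt_eqF.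
Qed.

End power.

End coalescence.

Section coalescence_bound.
Context {R : realType} {d : measure_display} {T : measurableType d}.
Variable P : probability T R.

(** The order of quantifiers matters: the constant may depend on the coefficients and on [tau], but
    it is fixed before [delta], [Y] and [M], so that one constant serves every pair of points. [C4]
    also comes after it: fourth moments enter only through finiteness and through errors that
    subdivision removes. *)
Lemma coalescence_bound (rho m : R -> R) (alpha beta C1 C2 Cb L0 : R) :
  alpha < 2 -> 0 <= C1 -> 0 < C2 -> 0 < L0 -> L0 <= 1 -> rho 0 = 0 ->
  (forall x, 0 <= x -> 0 <= rho x <= Cb * (1 + x)) ->
  (forall x, 0 < x <= L0 -> rho x <= C1 * x `^ beta) ->
  (forall x, 0 <= m x) ->
  (forall x, 0 <= x <= L0 -> C2 * x `^ alpha <= m x) ->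
  0 < 1 + beta - alpha < 1 ->
  beta = 0 \/ 1 < alpha ->
  exists2 tau0, 0 < tau0 & forall tau, 0 < tau <= tau0 -> exists Kf,
    forall delta C4 Y M, 0 <= delta ->
    diff_proc P tau delta rho m Cb C4 Y M ->
    (forall u v, 0 <= u -> u <= v -> v <= tau -> alive P Y v <= alive P Y u) ->
    alive P Y tau <= Kf * delta.
Proof.
move=> al2 C10 C20 L00 L01 rho0 rhoCb rhobeta mge0 malpha hdl.
have Cb0 : 0 <= Cb.
  by have /andP[h] := rhoCb 0 (lexx 0); rewrite addr0 mulr1; exact: le_trans.
have small X : 0 <= X -> exists2 tau : R, 0 < tau <= 1 & X * tau <= 2^-1.
  move=> X0; exists (2 * (1 + X))^-1.
    rewrite invr_gt0 mulr_gt0 ?ltr_wpDr//= invf_le1 ?mulr_gt0 ?ltr_wpDr//.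
    by lra.
  by rewrite ler_pdivrMr ?mulr_gt0 ?ltr_wpDr// mulKf ?pnatr_eq0// lerDr.
have small2 X X' : 0 <= X -> 0 <= X' -> exists tau : R,
    [/\ 0 < tau, tau <= 1, X * tau <= 2^-1 & X' * tau <= 2^-1].
  move=> X0 X'0; have [tau /andP[t0 t1] h] := small (X + X') (addr_ge0 X0 X'0).
  exists tau; split => //; apply: le_trans h; apply: ler_wpM2r; rewrite ?(ltW t0)//.
    by rewrite lerDl.
  by rewrite lerDr.
have scale := lyapunov_scale C10 C20 L00 rho0 rhoCb rhobeta mge0 malpha.
(* For [beta = 0] one has [x^beta = 1], so the perturbed identity dissipates at rate [kap = 1] by
   itself; in the other case it is used with [kap = 0], for the mean gap only. *)
case=> [b0|al1].
  have [K [Ce [K0 Ce0 L]]] := scale 1 ler01 hdl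
    (fun x _ => ltac:(by rewrite b0 powRr0)).
  have [tau0 [t00 _ h10 h20]] := small2 Cb K Cb0 K0.
  exists tau0 => // tau /andP[t0 tt0]; exists (4 / tau) => delta C4 Y M d0 DP ab.
  have h1 := le_trans (ler_wpM2l Cb0 tt0) h10; have h2 := le_trans (ler_wpM2l K0 tt0) h20.
  have := alive_direct t0 d0 Cb0 h1 DP ab ler01 K0 Ce0 ltr01 h2 L.
  by rewrite mul1r -ler_pdivlMr// mulrAC.
have [K [Ce [K0 Ce0 L]]] := scale 0 (lexx 0) hdl (fun x _ => powR_ge0 x beta).
have /andP[dl0 _] := hdl.
have [kap [K1 [Ce1 [kap0 K10 Ce10 L1]]]] :=
  lyapunov_power al2 C10 C20 L00 L01 rho0 rhoCb rhobeta mge0 malpha al1 dl0.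
have [tau0 [t00 t10 h10 h20]] := small2 Cb K Cb0 K0.
have g0 : 0 < 2 - alpha by rewrite subr_gt0.
have g1 : 2 - alpha < 1 by lra.
pose k := Num.truncn (2 - alpha)^-1.
have gk : (2 - alpha)^-1 <= k.+1%:R by apply: ltW; exact: truncnS_gt.
exists tau0 => // tau /andP[t0 tt0]; exists (power_const tau kap K1 k) => delta C4 Y M d0 DP ab.
have h1 := le_trans (ler_wpM2l Cb0 tt0) h10; have h2 := le_trans (ler_wpM2l K0 tt0) h20.
have t1 := le_trans tt0 t10.
have m4 r := meanY_le t0 Cb0 h1 DP (lexx 0) K0 Ce0 ltr01 h2 L (r := r).
exact: (alive_power t0 d0 Cb0 h1 DP ab kap0 K10 Ce10 L00 g0 g1 gk t1 L1 m4).
Qed.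

End coalescence_bound.

(** * Gaussian increments and conditioning *)

Section density.
Context {d : measure_display} {T : measurableType d} {R : realType}.
Variables (mu nu : {measure set T -> \bar R}) (g : T -> R).
Hypothesis mg : measurable_fun setT g.
Hypothesis g0 : forall x, 0 <= g x.
Hypothesis nuE : forall A, measurable A -> (nu A = \int[mu]_(x in A) (g x)%:E)%E.

Import HBNNSimple.

Let density_nnsfun (h : {nnsfun T >-> R}) :
  (\int[nu]_x (h x)%:E = \int[mu]_x (h x * g x)%:E)%E.
Proof.
have mh r : measurable (h @^-1` [set r]) by exact: measurable_sfunP.
transitivity (\sum_(k \in range h) \int[nu]_x (k * \1_(h @^-1` [set k]) x)%:E)%E.
  under eq_integral do rewrite fimfunE -fsumEFin//.
  rewrite ge0_integral_fsum//.
  - by move=> y; exact/measurable_EFinP/measurable_funM.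
  - by move=> y x _; rewrite nnfun_muleindic_ge0.
transitivity (\sum_(k \in range h) \int[mu]_x (k * \1_(h @^-1` [set k]) x * g x)%:E)%E; last first.
  rewrite -ge0_integral_fsum//.
  - apply: eq_integral => x _.
    by rewrite fsumEFin//; congr EFin; rewrite fimfunE mulr_fsuml.
  - move=> y; apply/measurable_EFinP/measurable_funM => //.
    exact: measurable_funM.
  - move=> y x _; have := nnfun_muleindic_ge0 h y x.
    by rewrite -EFinM !lee_fin => h0; rewrite mulr_ge0.
apply: eq_fsbigr => r /set_mem [x _ <-].
rewrite integralZl_indic_nnsfun// integral_indic// setIT nuE//.
rewrite -ge0_integralZl_EFin//; last 2 first.
- by move=> y _; rewrite lee_fin.
- exact/measurable_EFinP/measurable_funTS.
rewrite integral_mkcond; apply: eq_integral => y _.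
rewrite patchE indicE; case: ifPn => _ /=; first by rewrite mulr1 EFinM.
by rewrite mulr0 mul0r.
Qed.

(** Simple functions, then monotone convergence. It serves to compute moments of a variable whose
    Gaussian law is given by its values on sets. *)
Lemma ge0_integral_density (f : T -> R) : measurable_fun setT f ->
  (forall x, 0 <= f x) ->
  (\int[nu]_x (f x)%:E = \int[mu]_x (f x * g x)%:E)%E.
Proof.
move=> mf f0.
have mF : measurable_fun setT (EFin \o f) by exact/measurable_EFinP.
pose h := nnsfun_approx measurableT mF.
have cvgh x : (fun n => (h n x)%:E) @ \oo --> (f x)%:E.
  by apply: (cvg_nnsfun_approx measurableT mF) => // y _; rewrite lee_fin.
transitivity (limn (fun n => \int[nu]_x (h n x)%:E))%E.
  rewrite -monotone_convergence//.
  - by apply: eq_integral => x _; apply/esym/cvg_lim => //; exact: cvgh.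
  - by move=> n; exact/measurable_EFinP.
  - by move=> n x _; rewrite lee_fin.
  - by move=> x _ a b ab; rewrite lee_fin; exact/lefP/nd_nnsfun_approx.
rewrite (_ : (fun n => _) = (fun n => \int[mu]_x (h n x * g x)%:E)%E); last first.
  by apply/funext => n; exact: density_nnsfun.
rewrite -monotone_convergence//.
- apply: eq_integral => x _; apply/cvg_lim => //.
  under eq_fun do rewrite EFinM.
  by rewrite EFinM; apply: cvgeZr => //; exact: cvgh.
- by move=> n; apply/measurable_EFinP; apply: measurable_funM.
- by move=> n x _; rewrite lee_fin mulr_ge0.
- by move=> x _ a b ab; rewrite lee_fin ler_wpM2r//; exact/lefP/nd_nnsfun_approx.
Qed.

End density.

Section gaussian.
Context {R : realType}.
Notation leb := (@lebesgue_measure R).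

Lemma normal_pdf_even (s x : R) : s != 0 -> normal_pdf 0 s (- x) = normal_pdf 0 s x.
Proof. by move=> s0; rewrite !normal_pdfE// /normal_fun !subr0 sqrrN. Qed.

Lemma normal_prob_sym (s : R) (B : set R) : s != 0 -> measurable B ->
  normal_prob 0 s (-%R @^-1` B) = normal_prob 0 s B.
Proof.
move=> s0 mB; rewrite /normal_prob.
have mf : measurable_fun setT (fun x : R => (normal_pdf 0 s x)%:E).
  by apply/measurable_EFinP; exact: measurable_normal_pdf.
transitivity (\int[leb]_(x in (-%R : R -> measurableTypeR R) @^-1` B) (normal_pdf 0 s (- x))%:E)%E.
  by apply: eq_integral => x _; rewrite normal_pdf_even.
rewrite -(@ge0_integral_pushforward _ _ _ _ _ (-%R : measurableTypeR R -> measurableTypeR R) _ leb B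
  (fun x => (normal_pdf 0 s x)%:E))//.
- by apply: eq_measure_integral => A mA _; exact: lebesgue_measureN.
- exact: measurable_funTS.
- by move=> x _; rewrite lee_fin normal_pdf_ge0.
Qed.

Lemma sqr_le_expR (t : R) : 0 <= t -> t ^+ 2 <= 4 * expR t.
Proof.
move=> t0; have e : expR t = expR (t / 2) ^+ 2.
  by rewrite -expRM_natl; congr expR; rewrite -mulr_natl; field.
have h := expR_ge1Dx (t / 2).
rewrite e (_ : t ^+ 2 = 4 * (t / 2) ^+ 2); last by field.
apply: ler_wpM2l => //; rewrite lerXn2r// ?nnegrE ?expR_ge0 ?divr_ge0//.
by apply: le_trans h; rewrite lerDr.
Qed.

(** Doubling the standard deviation absorbs the fourth power, so the fourth moment reduces to the
    total mass of another Gaussian density. With [t = x^2 / (4 * s^2)] one has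
    [x^4 = 16 * s^4 * t^2] and [t^2 exp(- 2 t) <= 4 exp(- t)]; the peak, halved by the doubling,
    accounts for the last factor 2 of 128. *)
Lemma normal_pdf_quartic (s x : R) : 0 < s ->
  x ^+ 4 * normal_pdf 0 s x <= 128 * s ^+ 4 * normal_pdf 0 (2 * s) x.
Proof.
move=> s0; have s2 : 0 < 2 * s by rewrite mulr_gt0.
rewrite !normal_pdfE ?gt_eqF//.
have -> : normal_peak (2 * s) = 2^-1 * normal_peak s.
  rewrite /normal_peak exprMn -mulrA -mulrnAr sqrtrM ?exprn_ge0//.
  by rewrite sqrtr_sqr ger0_norm// invfM.
set pk := normal_peak s; have pk0 : 0 <= pk by exact: normal_peak_ge0.
pose t := x ^+ 2 / (4 * s ^+ 2).
have sn : s != 0 by rewrite gt_eqF.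
have t0 : 0 <= t by rewrite divr_ge0 ?sqr_ge0// mulr_ge0// sqr_ge0.
have e1 : normal_fun 0 s x = expR (- t) ^+ 2.
  rewrite /normal_fun subr0 -expRM_natl; congr expR.
  by rewrite -mulr_natl /t; field.
have e2 : expR (- t) <= normal_fun 0 (2 * s) x.
  rewrite /normal_fun subr0 ler_expR.
  have -> : - x ^+ 2 / ((2 * s) ^+ 2 *+ 2) = - (t / 2).
    by rewrite -mulr_natl /t; field.
  by rewrite lerN2 ler_piMr// invf_le1// ler1n.
have h := sqr_le_expR t0.
have e3 : x ^+ 4 = 16 * s ^+ 4 * t ^+ 2 by rewrite /t; field.
have e4 : t ^+ 2 * expR (- t) ^+ 2 <= 4 * expR (- t).
  have : t ^+ 2 * expR (- t) ^+ 2 <= 4 * expR t * expR (- t) ^+ 2.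
    by apply: ler_wpM2r => //; exact: sqr_ge0.
  move=> /le_trans; apply; rewrite expr2 mulrA -(mulrA 4) -expRD subrr expR0 mulr1//.
have e5 : x ^+ 4 * (pk * normal_fun 0 s x) <= 16 * s ^+ 4 * pk * (4 * expR (- t)).
  rewrite e3 e1 (_ : _ * (pk * _) = 16 * s ^+ 4 * pk * (t ^+ 2 * expR (- t) ^+ 2)); last by ring.
  by apply: ler_wpM2l => //; rewrite mulr_ge0// mulr_ge0// exprn_ge0// ltW.
apply: le_trans e5 _.
rewrite (_ : 128 * s ^+ 4 * _ = 16 * s ^+ 4 * pk * (4 * normal_fun 0 (2 * s) x)); last by field.
apply: ler_wpM2l; first by rewrite mulr_ge0// mulr_ge0// exprn_ge0// ltW.
exact: ler_wpM2l.
Qed.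

Context {d : measure_display} {T : measurableType d}.
Variable P : probability T R.

Lemma gaussian_size4 (Z : T -> R) (s : R) : 0 < s -> measurable_fun setT Z ->
  (forall B : set R, measurable B -> P (Z @^-1` B) = normal_prob 0 s B) ->
  size4 P s 128 Z.
Proof.
move=> s0 mZ law; split => //.
have mx4 : measurable_fun setT (fun x : R => x ^+ 4) by exact: measurable_funX.
pose Z' : T -> measurableTypeR R := Z.
have mZ' : measurable_fun setT Z' by exact: mZ.
have mE : measurable_fun setT (fun x : measurableTypeR R => (x ^+ 4)%:E).
  by apply/measurable_EFinP; exact: mx4.
have e1 : (\int[P]_w (Z w ^+ 4)%:E = \int[pushforward P Z']_x (x ^+ 4)%:E)%E.
  rewrite (ge0_integral_pushforward mZ' P measurableT mE)//.
  by move=> x _; rewrite lee_fin exprn_even_ge0.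
have e2 := @ge0_integral_density _ (measurableTypeR R) R leb (pushforward P Z')
   (normal_pdf 0 s) (measurable_normal_pdf 0 s) (normal_pdf_ge0 0 s) law
   (fun x => x ^+ 4) mx4 (fun x => @exprn_even_ge0 R 4 x isT).
rewrite e1 (e2 mZ').
apply: (@le_trans _ _ (\int[leb]_x (128 * s ^+ 4 * normal_pdf 0 (2 * s) x)%:E)%E).
  apply: ge0_le_integral => //.
  - by move=> x _; rewrite lee_fin mulr_ge0 ?exprn_even_ge0 ?normal_pdf_ge0.
  - by apply/measurable_EFinP; apply: measurable_funM => //; exact: measurable_normal_pdf.
  - by apply/measurable_EFinP; apply: measurable_funM => //; exact: measurable_normal_pdf.
  - by move=> x _; rewrite lee_fin normal_pdf_quartic.
under eq_integral do rewrite EFinM.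
rewrite ge0_integralZl_EFin//.
- by rewrite integral_normal_pdf mule1.
- by move=> x _; rewrite lee_fin normal_pdf_ge0.
- by apply/measurable_EFinP; exact: measurable_normal_pdf.
- by rewrite mulr_ge0// exprn_ge0// ltW.
Qed.

Lemma sym_law_integral0 (V : T -> R) : rint P setT V ->
  (forall B : set R, measurable B -> P (V @^-1` B) = P (V @^-1` (-%R @^-1` B))) ->
  \int[P]_w V w = 0.
Proof.
move=> iV sV; have mV := rint_measurable iV.
have iN : rint P setT (fun w => - V w) by exact: rintN.
have mN := rint_measurable iN.
have e : (\int[P]_w (V w)%:E = \int[P]_w (- V w)%:E)%E.
  rewrite -(@integral_pushforward _ _ _ _ _ V mV P setT EFin)//.
  rewrite -(@integral_pushforward _ _ _ _ _ (fun w => - V w) mN P setT EFin)//.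
  by apply: eq_measure_integral => A mA _; exact: sV.
have e2 : \int[P]_w V w = \int[P]_w (- V w) by rewrite /Rintegral e.
move: e2; under [in X in _ = X -> _]eq_Rintegral do rewrite -mulN1r.
rewrite RintegralZl// mulN1r => e2.
lra.
Qed.

End gaussian.

(** * Orthogonality to a sub-sigma-algebra *)

Section sub_sigma_algebra.
Context {R : realType} {d : measure_display} {T : measurableType d}.
Variable P : probability T R.
Variable G : set (set T).
Notation TG := (g_sigma_algebraType G).
Hypothesis Gm : forall A, <<s G>> A -> measurable A.

Lemma sub_measurable_fun (Y : T -> R) :
  measurable_fun setT (Y : TG -> R) -> measurable_fun setT Y.
Proof.
move=> mY _ B mB; rewrite setTI; apply: Gm.
by have := mY measurableT B mB; rewrite setTI.
Qed.

Lemma sub_preimage (Y : T -> R) (B : set R) : measurable_fun setT (Y : TG -> R) ->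
  measurable B -> <<s G>> (Y @^-1` B).
Proof. by move=> mY mB; have := mY measurableT B mB; rewrite setTI. Qed.

Variable Z : T -> R.
Hypothesis iZ : rint P setT Z.
Hypothesis Z0 : forall A, <<s G>> A -> \int[P]_w (\1_A w * Z w) = 0.

Let mZ : measurable_fun setT Z := rint_measurable iZ.

(** [Y] is within [1 / n], uniformly, of a finite combination of indicators of its own level sets,
    each orthogonal to [Z]; the integral is therefore at most the mean of the absolute value of [Z]
    divided by [n]. *)
Lemma cond0_bounded (Y : T -> R) (b : R) : measurable_fun setT (Y : TG -> R) ->
  (forall w, `|Y w| <= b) -> \int[P]_w (Y w * Z w) = 0.
Proof.
move=> mYG Yb; have mY := sub_measurable_fun mYG.
have b0 (w : T) : 0 <= b by exact: le_trans (normr_ge0 _) (Yb w).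
have iYZ : rint P setT (fun w => Y w * Z w).
  apply: (@rint_le _ _ _ _ _ _ _ (fun w => b * `|Z w|)) => //.
  - exact: measurable_funM.
  - by move=> w _; rewrite normrM ler_wpM2r.
  - by apply: rintZ => //; exact: rint_abs.
have aZ0 : 0 <= \int[P]_w `|Z w| by apply: Rintegral_ge0.
apply/eqP; rewrite -normr_le0; apply/ler_addgt0Pr => e e0; rewrite add0r.
pose I := \int[P]_w `|Z w|.
have [n n0 hn] : exists2 n : nat, 0 < n%:R :> R & I / n%:R <= e.
  exists (Num.truncn (I / e)).+1; first by rewrite ltr0n.
  rewrite ler_pdivrMr ?ltr0n// mulrC -ler_pdivrMr//.
  by apply: ltW; exact: truncnS_gt.
have [K hK] : exists K : nat, forall w, n%:R * (Y w + b) < K%:R.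
  exists (Num.truncn (n%:R * (b + b))).+1 => w.
  apply: le_lt_trans (truncnS_gt _); rewrite ler_pM2l// lerD2r.
  exact: le_trans (ler_norm _) (Yb w).
(* The values of [Y], shifted by [b] to be nonnegative, are cut into half-open cells of length
   [1 / n], so that the index of a cell is a truncation. *)
pose A (k : 'I_K) := Y @^-1` [set x | k%:R <= n%:R * (x + b) < k.+1%:R].
have AG k : <<s G>> (A k).
  apply: sub_preimage => //.
  rewrite (_ : [set x | _] = (fun x : R => n%:R * (x + b)) @^-1` `[k%:R, k.+1%:R[); last first.
    by apply/seteqP; split => x /=; rewrite in_itv.
  have mq : measurable_fun setT (fun x : R => n%:R * (x + b)).
    by apply: measurable_funM => //; exact: measurable_funD.
  by rewrite -[X in measurable X]setTI; exact: mq.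
have mA k : measurable (A k) by apply: Gm.
pose c (k : 'I_K) : R := k%:R / n%:R - b.
pose Yn w := \sum_(k < K) c k * \1_(A k) w.
have hYn w : `|Y w - Yn w| <= n%:R^-1.
  have y0 : 0 <= n%:R * (Y w + b).
    by rewrite mulr_ge0 ?ler0n// -lerBlDr sub0r lerNl (le_trans (ler_norm _))// normrN.
  have /andP[t1 t2] := truncn_itv y0.
  have kK : (Num.truncn (n%:R * (Y w + b)) < K)%N.
    by rewrite -(ltr_nat R); exact: le_lt_trans (hK w).
  pose k0 := Ordinal kK.
  have -> : Yn w = c k0.
    rewrite /Yn (bigD1 k0)//= indicE mem_set ?mulr1; last by rewrite /A/= t1 t2.
    rewrite big1 ?addr0// => k kk0; rewrite indicE memNset ?mulr0// /A/= => /truncn_def h.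
    by move/eqP: kk0; apply; apply/val_inj.
  have -> : Y w - c k0 = (n%:R * (Y w + b) - (Num.truncn (n%:R * (Y w + b)))%:R) / n%:R.
    by rewrite /c/=; field; rewrite gt_eqF.
  rewrite normrM ger0_norm ?subr_ge0// ger0_norm ?invr_ge0 ?ler0n//.
  by rewrite -[leRHS]mul1r ler_wpM2r ?invr_ge0 ?ler0n// lerBlDl natr1 (ltW t2).
have iAZ k : rint P setT (fun w => \1_(A k) w * Z w).
  apply: (@rint_le _ _ _ _ _ _ _ (fun w => `|Z w|)) => //.
  - by apply: measurable_funM => //; exact: measurable_indic.
  - move=> w _; rewrite normrM ler_piMl// indicE; case: (_ \in _) => /=.
      by rewrite normr1.
    by rewrite normr0.
  - exact: rint_abs.
have icAZ k : rint P setT (fun w => c k * (\1_(A k) w * Z w)) by apply: rintZ.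
have eYn : (fun w => Yn w * Z w) = (fun w => \sum_(k < K) c k * (\1_(A k) w * Z w)).
  by apply/funext => w; rewrite /Yn mulr_suml; apply: eq_bigr => k _; rewrite mulrA.
have iYn : rint P setT (fun w => Yn w * Z w) by rewrite eYn; exact: rint_sum.
have YnZ : \int[P]_w (Yn w * Z w) = 0.
  rewrite -[X in Rintegral _ _ X]/(fun w => Yn w * Z w) eYn Rintegral_sum//.
  by apply: big1 => k _; rewrite (RintegralZl _ measurableT (iAZ k)) (Z0 (AG k)) mulr0.
have -> : \int[P]_w (Y w * Z w) = \int[P]_w (Y w * Z w - Yn w * Z w).
  by rewrite RintegralB// YnZ subr0.
have iD := rintB measurableT iYZ iYn.
apply: le_trans (le_normr_Rintegral measurableT iD) _.
apply: le_trans hn; rewrite mulrC -RintegralZl//; last exact: rint_abs.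
apply: le_Rintegral => //; [exact: rint_abs|by apply: rintZ => //; exact: rint_abs|].
by move=> w _; rewrite -mulrBl normrM ler_wpM2r.
Qed.

(** [Y] is set to 0 where it exceeds [n] in absolute value, and dominated convergence concludes.
    Unbounded weights occur as [Y * W1 u] in [covariation]. *)
Lemma cond0 (Y : T -> R) : measurable_fun setT (Y : TG -> R) ->
  rint P setT (fun w => Y w * Z w) -> \int[P]_w (Y w * Z w) = 0.
Proof.
move=> mYG iYZ; have mY := sub_measurable_fun mYG.
pose phi (n : nat) (x : R) : R := x * \1_(`[- n%:R, n%:R]) x.
have mphi n : measurable_fun setT (phi n) by apply: measurable_funM => //; exact: measurable_indic.
have phiE n x : phi n x = if `|x| <= n%:R then x else 0.
  rewrite /phi indicE; case: ifPn => h.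
    by rewrite mem_set ?mulr1//= in_itv/= -ler_norml.
  by rewrite memNset ?mulr0//= in_itv/= -ler_norml; exact/negP.
have phib n x : `|phi n x| <= n%:R by rewrite phiE; case: ifPn => // _; rewrite normr0.
have phile n x : `|phi n x| <= `|x| by rewrite phiE; case: ifPn => // _; rewrite normr0.
have z n : \int[P]_w (phi n (Y w) * Z w) = 0.
  apply: (@cond0_bounded (fun w => phi n (Y w)) n%:R) => //.
  exact: (measurableT_comp (mphi n) mYG).
have phi_ev (x : R) : \forall n \near \oo, phi n x = x.
  by near=> n; rewrite phiE ifT//; near: n; exact: nbhs_infty_ger.
have f_f : {ae P, forall w, setT w ->
    (fun n => (phi n (Y w) * Z w)%:E) @ \oo --> (Y w * Z w)%:E}.
  apply: aeW => w _; apply: cvg_near_cst.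
  by apply: filterS (phi_ev (Y w)) => n ->.
have f_g : {ae P, forall w n, setT w -> (`|(phi n (Y w) * Z w)%:E| <= (`|Y w * Z w|)%:E)%E}.
  by apply: aeW => w n _; rewrite /= lee_fin normrM [leRHS]normrM ler_wpM2r.
have mf n : measurable_fun setT (fun w => (phi n (Y w) * Z w)%:E).
  by apply/measurable_EFinP; apply: measurable_funM => //; exact: measurableT_comp.
have [_ _] := dominated_convergence measurableT mf (proj2 (measurable_EFinP _ _)
  (measurable_funM mY mZ)) f_f (rint_abs measurableT iYZ) f_g.
rewrite /Rintegral.
have -> : (fun n => (\int[P]_x (phi n (Y x) * Z x)%:E)%E) = (fun=> 0%E).
  apply/funext => n; rewrite -[RHS]/((0 : R)%:E) -(z n) rint_fineK//.
  apply: (rint_le _ _ _ (rint_abs measurableT iYZ)) => //; last by move=> w _; rewrite normrM [leRHS]normrM ler_wpM2r.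
  by apply: measurable_funM => //; exact: measurableT_comp.
by move=> h; rewrite -(cvg_lim _ h)// lim_cst.
Unshelve. all: end_near. Qed.

End sub_sigma_algebra.

(** * Wiener processes relative to a filtration *)

Section wiener.
Context {R : realType} {d : measure_display} {T : measurableType d}.
Variable P : probability T R.
Variable G : R -> set (set T).
Notation F := (fun t => <<s G t >>).
Notation TG t := (g_sigma_algebraType (G t)).
Hypothesis FM : forall t A, 0 <= t -> <<s G t >> A -> measurable A.

Lemma adapted_measurable t (Y : T -> R) :
  (forall B, measurable B -> <<s G t >> (Y @^-1` B)) ->
  measurable_fun setT (Y : TG t -> R).
Proof. by move=> h _ B mB; rewrite setTI; exact: h. Qed.

Section one.
Variable W : R -> T -> R.
Hypothesis WW : wiener_wrt P 0 F W.

Lemma wiener_adapted t : 0 <= t -> measurable_fun setT (W t : TG t -> R).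
Proof. by move=> t0; apply: adapted_measurable => B mB; have [_ [_ [h _]]] := WW; exact: h. Qed.

Lemma wiener_measurable t : 0 <= t -> measurable_fun setT (W t).
Proof.
by move=> t0; apply: sub_measurable_fun (wiener_adapted t0) => A; exact: FM.
Qed.

Let mdW u v : 0 <= u -> u <= v -> measurable_fun setT (fun w => W v w - W u w).
Proof.
move=> u0 uv; apply: measurable_funB; apply: wiener_measurable => //.
exact: le_trans uv.
Qed.

Lemma wiener_size4 u v : 0 <= u -> u < v ->
  size4 P (Num.sqrt (v - u)) 128 (fun w => W v w - W u w).
Proof.
move=> u0 uv; apply: gaussian_size4.
- by rewrite sqrtr_gt0 subr_gt0.
- exact: mdW (ltW uv).
- move=> B mB; have [_ [_ [_ h]]] := WW.
  have := h u v u0 uv setT _ B mB; rewrite setTI probability_setT mul1e; apply.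
  exact: (@measurableT _ (TG u)).
Qed.

Lemma wiener_incr_indic u v A : 0 <= u -> u <= v -> <<s G u >> A ->
  \int[P]_w (\1_A w * (W v w - W u w)) = 0.
Proof.
move=> u0; rewrite le_eqVlt => /predU1P[<-|uv] FA.
  by under eq_Rintegral do rewrite subrr mulr0; rewrite Rintegral_cst//= mul0r.
have mA : measurable A by exact: FM FA.
have mV := mdW u0 (ltW uv).
have k0 : 0 < Num.sqrt (v - u) by rewrite sqrtr_gt0 subr_gt0.
have [iV _] := size4_norm k0 (wiener_size4 u0 uv).
have m1 : measurable_fun setT (fun w => \1_A w * (W v w - W u w)).
  by apply: measurable_funM => //; exact: measurable_indic.
apply: sym_law_integral0.
  apply: (rint_le _ _ _ (rint_abs measurableT iV)) => // w _.
  rewrite normrM ler_piMl// indicE; case: (_ \in _) => /=.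
    by rewrite normr1.
  by rewrite normr0.
have [_ [_ [_ h]]] := WW.
have E (B : set R) : measurable B -> P ((fun w => \1_A w * (W v w - W u w)) @^-1` B) =
    (P A * normal_prob 0 (Num.sqrt (v - u)) B + P (~` A `&` [set _ | B 0%R]))%E.
  move=> mB; rewrite -h//.
  have mN : measurable (~` A `&` [set _ : T | B 0]).
    apply: measurableI; first exact: measurableC.
    have [b|b] := pselect (B 0).
      by rewrite (_ : [set _ | _] = setT)//; apply/seteqP; split.
    by rewrite (_ : [set _ | _] = set0)//; apply/seteqP; split.
  rewrite -measureU//.
  - congr (P _); apply/seteqP; split => w /=.
      rewrite indicE; case: (pselect (A w)) => Aw.
        by rewrite mem_set//= mul1r => ?; left.
      by rewrite memNset//= mul0r; right.
    rewrite indicE => -[[Aw]|[Aw]].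
      by rewrite mem_set//= mul1r.
    by rewrite memNset//= mul0r.
  - apply: measurableI => //.
    by have := mV measurableT B mB; rewrite setTI.
  - by apply/seteqP; split => w //= -[[] + _ []].
have mNB (B : set R) : measurable B -> measurable (-%R @^-1` B).
  by move=> mB; have := @oppr_measurable R setT measurableT B mB; rewrite setTI.
move=> B mB; rewrite !E//; last exact: mNB.
rewrite normal_prob_sym ?gt_eqF//; congr (_ + P (_ `&` _))%E.
by apply/funext => w /=; rewrite oppr0.
Qed.

Lemma wiener_incr0 u v (Y : T -> R) : 0 <= u -> u <= v ->
  measurable_fun setT (Y : TG u -> R) ->
  rint P setT (fun w => Y w * (W v w - W u w)) ->
  \int[P]_w (Y w * (W v w - W u w)) = 0.
Proof.
move=> u0; rewrite le_eqVlt => /predU1P[<- _ _|uv mY iY].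
  by under eq_Rintegral do rewrite subrr mulr0; rewrite Rintegral_cst//= mul0r.
have k0 : 0 < Num.sqrt (v - u) by rewrite sqrtr_gt0 subr_gt0.
have [iV _] := size4_norm k0 (wiener_size4 u0 uv).
apply: (@cond0 _ _ _ P (G u)) => //; first by move=> A; exact: FM.
by move=> A FA; apply: wiener_incr_indic => //; exact: ltW.
Qed.

Lemma size4_ae k C (f g : T -> R) : measurable_fun setT f -> {ae P, forall w, f w = g w} ->
  size4 P k C g -> size4 P k C f.
Proof.
move=> mf fg [mg gC]; split => //; apply: le_trans gC.
rewrite le_eqVlt; apply/orP; left; apply/eqP; apply: ae_eq_integral => //.
- by apply/measurable_EFinP; exact: measurable_funX.
- by apply/measurable_EFinP; exact: measurable_funX.
- by apply: filterS fg => w /= ->.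
Qed.

Lemma wiener_size4_pos t : 0 <= t -> exists C, size4 P 1 C (W t).
Proof.
have [W0 _] := WW.
have z : size4 P 1 0 (fun=> 0 : R).
  by split => //; rewrite integral_cst//= expr0n/= mul0e mul0r.
rewrite le_eqVlt => /predU1P[<-|t0].
  exists 0; apply: size4_ae z; first exact: wiener_measurable.
  by [].
exists (128 * Num.sqrt t ^+ 4); apply: (@size4_rescale _ _ _ _ (Num.sqrt t) 1 128).
  by rewrite expr1n mulr1.
have := wiener_size4 (lexx 0) t0; rewrite subr0; apply: size4_ae.
  exact/wiener_measurable/ltW.
by apply: filterS W0 => w ->; rewrite subr0.
Qed.

Lemma wiener_size4_incr u v : 0 <= u -> u <= v ->
  exists C, size4 P 1 C (fun w => W v w - W u w).
Proof.
move=> u0 uv.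
have [C1 s1] := wiener_size4_pos u0.
have [C2 s2] := wiener_size4_pos (le_trans u0 uv).
by eexists; exact: size4D s2 (size4N s1).
Qed.

End one.

Section two.
Variables (W1 W2 Q : R -> T -> R).
Hypothesis WW1 : wiener_wrt P 0 F W1.
Hypothesis WW2 : wiener_wrt P 0 F W2.
Hypothesis MQ : martingale_wrt P 0 F (fun t w => W1 t w * W2 t w - Q t w).

Lemma rint_mul_bounded (b : R) (Y Z : T -> R) : measurable_fun setT Y ->
  (forall w, `|Y w| <= b) -> rint P setT Z -> rint P setT (fun w => Y w * Z w).
Proof.
move=> mY Yb iZ; have mZ := rint_measurable iZ.
apply: (@rint_le _ _ _ _ _ _ _ (fun w => b * `|Z w|)) => //.
- exact: measurable_funM.
- by move=> w _; rewrite normrM ler_wpM2r.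
- by apply: rintZ => //; exact: rint_abs.
Qed.

Lemma rint_bracket t : 0 <= t -> rint P setT (Q t).
Proof.
move=> t0; have [_ [iM _]] := MQ.
have [C1 s1] := wiener_size4_pos WW1 t0.
have [C2 s2] := wiener_size4_pos WW2 t0.
have [i12 _] := size4M ltr01 ltr01 s1 s2.
have := rintB measurableT i12 (iM t t0); congr (rint _ _ _).
by apply/funext => w; rewrite subKr.
Qed.

(** The product of the increments is the increment of [W1 * W2], minus [W1 u] times the increment of
    [W2], minus [W2 u] times the increment of [W1]. The last two are orthogonal to the past, and the
    martingale property turns the first into the increment of [Q]. *)
Lemma covariation u v (Y : T -> R) (b : R) : 0 <= u -> u <= v ->
  measurable_fun setT (Y : TG u -> R) -> (forall w, `|Y w| <= b) ->
  rint P setT (fun w => Y w * (Q v w - Q u w)) /\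
  \int[P]_w (Y w * ((W1 v w - W1 u w) * (W2 v w - W2 u w))) =
  \int[P]_w (Y w * (Q v w - Q u w)).
Proof.
move=> u0 uv mYG Yb.
have v0 := le_trans u0 uv.
have mY : measurable_fun setT Y by apply: sub_measurable_fun mYG => A; exact: FM.
have [C1 s1] := wiener_size4_pos WW1 u0.
have [C2 s2] := wiener_size4_pos WW2 u0.
have [C3 s3] := wiener_size4_incr WW1 u0 uv.
have [C4 s4] := wiener_size4_incr WW2 u0 uv.
have [i14 _] := size4M ltr01 ltr01 s1 s4.
have [i23 _] := size4M ltr01 ltr01 s2 s3.
have [_ [iM hM]] := MQ.
have iMM := rintB measurableT (iM v v0) (iM u u0).
have iQQ := rintB measurableT (rint_bracket v0) (rint_bracket u0).
have jM := rint_mul_bounded mY Yb iMM.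
have jQ := rint_mul_bounded mY Yb iQQ.
have j14 := rint_mul_bounded mY Yb i14.
have j23 := rint_mul_bounded mY Yb i23.
split => //.
have z14 : \int[P]_w (Y w * (W1 u w * (W2 v w - W2 u w))) = 0.
  have := wiener_incr0 WW2 u0 uv (Y := fun w => Y w * W1 u w).
  under eq_Rintegral do rewrite -mulrA.
  apply; first by apply: measurable_funM => //; exact: wiener_adapted.
  by move: j14; congr (rint _ _ _); apply/funext => w; rewrite mulrA.
have z23 : \int[P]_w (Y w * (W2 u w * (W1 v w - W1 u w))) = 0.
  have := wiener_incr0 WW1 u0 uv (Y := fun w => Y w * W2 u w).
  under eq_Rintegral do rewrite -mulrA.
  apply; first by apply: measurable_funM => //; exact: wiener_adapted.
  by move: j23; congr (rint _ _ _); apply/funext => w; rewrite mulrA.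
have zM : \int[P]_w (Y w * (W1 v w * W2 v w - Q v w - (W1 u w * W2 u w - Q u w))) = 0.
  apply: (@cond0 _ _ _ P (G u)) => //; first by move=> A; exact: FM.
  move=> A FA; have mA : measurable A by exact: FM FA.
  have := hM u v u0 uv A FA => h.
  rewrite /Rintegral -[RHS]/(fine (0 : \bar R)) -h; congr fine.
  rewrite [RHS]integral_mkcond; apply: eq_integral => w _.
  rewrite patchE indicE; case: ifPn => _ /=; by rewrite ?mul1r ?mul0r.
have jA := rintB measurableT jQ j14.
have jB := rintB measurableT jA j23.
rewrite -[RHS]subr0 -z14 -(RintegralB measurableT jQ j14) -[RHS]subr0 -z23.
rewrite -(RintegralB measurableT jA j23) -[RHS]add0r -zM -(RintegralD measurableT jM jB).
by apply: eq_Rintegral => w _; ring.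
Qed.

End two.

End wiener.

(** * Harris flows *)

Section joint.
Context {R : realType} {d : measure_display} {T : measurableType d}.
Notation leb := (@lebesgue_measure R).

Lemma measurable_fun_glue (h : R -> nat) (g : nat -> T -> R) :
  (forall k, measurable (h @^-1` [set k])) -> (forall k, measurable_fun setT (g k)) ->
  measurable_fun setT (fun z : R * T => g (h z.1) z.2).
Proof.
move=> mh mg _ B mB; rewrite setTI.
rewrite (_ : _ @^-1` _ =
    \bigcup_k ((fst @^-1` (h @^-1` [set k])) `&` (snd @^-1` (g k @^-1` B)))); last first.
  apply/seteqP; split => z /=; first by move=> Bz; exists (h z.1).
  by move=> [k _ [/= -> ]].
apply: bigcupT_measurable => k; apply: measurableI.
  by rewrite -[X in measurable X]setTI; apply: measurable_fst.
rewrite -[X in measurable X]setTI; apply: measurable_snd => //.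
by have := mg k measurableT B mB; rewrite setTI.
Qed.

Lemma truncn_preimage_measurable (n : nat) (k : nat) :
  measurable ((fun r : R => Num.truncn (n.+1%:R * Num.max r 0)) @^-1` [set k]).
Proof.
rewrite (_ : _ @^-1` _ = (fun r : R => n.+1%:R * Num.max r 0) @^-1` `[k%:R, k.+1%:R[); last first.
  apply/seteqP; split => r /=; rewrite in_itv/=.
    by move=> <-; apply: truncn_itv; rewrite mulr_ge0// le_max lexx orbT.
  by move=> /truncn_def.
have m : measurable_fun setT (fun r : R => n.+1%:R * Num.max r 0).
  apply: measurable_funM => //; exact: measurable_maxr.
by rewrite -[X in measurable X]setTI; exact: m.
Qed.

(** Each path is approximated by its value at the last point [k / (n + 1)] not after the current
    time. The approximants are countable gluings of measurable functions and converge by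
    continuity. *)
Lemma continuous_joint_measurable (Y : R -> T -> R) :
  (forall r, 0 <= r -> measurable_fun setT (Y r)) ->
  (forall w, continuous (fun r : R => Y (Num.max r 0) w)) ->
  measurable_fun setT (fun z : R * T => Y (Num.max z.1 0) z.2).
Proof.
move=> mY cY.
apply: (@measurable_fun_cvg _ _ _ _ (fun n (z : R * T) =>
  (fun k w => Y (k%:R / n.+1%:R) w) (Num.truncn (n.+1%:R * Num.max z.1 0)) z.2)).
  move=> n; apply: (measurable_fun_glue (h := fun r => Num.truncn (n.+1%:R * Num.max r 0))
    (g := fun k w => Y (k%:R / n.+1%:R) w)).
    exact: truncn_preimage_measurable.
  by move=> k; apply: mY; rewrite divr_ge0.
move=> [r w] _ /=; set m := Num.max r 0.
have m0 : 0 <= m by rewrite /m le_max lexx orbT.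
pose a n : R := (Num.truncn (n.+1%:R * m))%:R / n.+1%:R.
have a0 n : 0 <= a n by rewrite divr_ge0.
have -> : (fun n => Y (a n) w) = (fun n => Y (Num.max (a n) 0) w).
  by apply/funext => n; rewrite max_l.
have -> : Y m w = Y (Num.max m 0) w by rewrite (max_l m0).
apply: (continuous_cvg _ (cY w m)).
apply/cvgrPdist_le => e e0; near=> n.
have nm0 : 0 <= n.+1%:R * m by rewrite mulr_ge0.
have /andP[t1 t2] := truncn_itv nm0.
have -> : m - a n = (n.+1%:R * m - (Num.truncn (n.+1%:R * m))%:R) / n.+1%:R.
  by rewrite /a mulrBl mulrAC divff ?mul1r// pnatr_eq0.
rewrite ger0_norm ?divr_ge0 ?subr_ge0//.
apply: (@le_trans _ _ (1 / n.+1%:R)).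
  by rewrite ler_wpM2r ?invr_ge0// lerBlDl natr1 (ltW t2).
rewrite div1r ltW//; near: n; exact: (near_infty_natSinv_lt (PosNum e0)).
Unshelve. all: end_near. Qed.

Lemma cvg_clamp (f : R -> R) (A : set R) (r : R) :
  f @ within A (nbhs (Num.max r 0)) --> f (Num.max r 0) ->
  (\forall s \near r, A (Num.max (s : R) 0)) ->
  (fun s : R => f (Num.max s 0)) @ r --> f (Num.max r 0).
Proof.
move=> fc nA U /fc hU.
have mc : (fun s : R => Num.max s 0) @ r --> Num.max r 0.
  exact: (@continuous_max R R id (cst 0) r (@cvg_id _ _) (@cvg_cst _ _ _ _ _)).
have h : \forall s \near r, A (Num.max (s : R) 0) -> U (f (Num.max (s : R) 0)) := mc _ hU.
suff : \forall s \near r, U (f (Num.max (s : R) 0)) by [].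
by near=> s; apply: (near h s) => //; near: s.
Unshelve. all: end_near. Qed.

Lemma clamp_continuous (f : R -> R) : {within `[0, +oo[, continuous f} ->
  continuous (fun s : R => f (Num.max s 0)).
Proof.
move=> /subspace_continuousP fc r; apply: (cvg_clamp (A := `[0, +oo[)).
  by apply: fc; rewrite /= in_itv/= le_max lexx orbT.
by near=> s; rewrite /= in_itv/= le_max lexx orbT.
Unshelve. all: end_near. Qed.

Lemma clamp_integral_continuous (g : R -> R) :
  (forall t, 0 <= t -> rint leb `[0, t] g) ->
  continuous (fun s : R => \int[leb]_(r in `[0, Num.max s 0]) g r).
Proof.
(* The margin 1 makes [b] an upper limit for all times near [r], so continuity on [[0, b]] is
   enough. *)
move=> ig r; pose b := Num.max r 0 + 1.
have b0 : 0 <= b by rewrite addr_ge0// le_max lexx orbT.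
have /subspace_continuousP h := parameterized_integral_continuous b0 (ig b b0).
apply: (@cvg_clamp (fun x => \int[leb]_(r in `[0, x]) g r) `[0, b]).
  by apply: h; rewrite /= in_itv/= le_max lexx orbT /= lerDl.
near=> s; rewrite /= in_itv/= le_max lexx orbT/= /b ge_max; apply/andP; split; last exact: b0.
have : s <= r + 1.
  near: s; exists 1 => //= z /=; rewrite ltr_norml => /andP[h1 _].
  move: h1; lra.
by move=> /le_trans; apply; rewrite lerD2r le_max lexx.
Unshelve. all: end_near. Qed.

Lemma continuous_bounded_itv (f : R -> R) (tau : R) : 0 <= tau -> continuous f ->
  exists b, forall r, 0 <= r <= tau -> `|f r| <= b.
Proof.
move=> t0 fc.
have fc' : {within `[0, tau], continuous (fun r => `|f r|)}.
  by apply: continuous_subspaceT => r; apply: cvg_norm; exact: fc.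
have [c _ hc] := EVT_max t0 fc'.
by exists `|f c| => r hr; apply: hc; rewrite in_itv.
Qed.

End joint.

Section off_null_set.
Context {R : realType} {d : measure_display} {T : measurableType d}.
Variable P : probability T R.
Variable N : set T.
Hypothesis mN : measurable N.

Definition off (f : T -> R) w := if w \in N then 0 else f w.

Lemma offN f w : N w -> off f w = 0.
Proof. by move=> Nw; rewrite /off mem_set. Qed.

Lemma offF f w : ~ N w -> off f w = f w.
Proof. by move=> Nw; rewrite /off memNset. Qed.

Lemma measurable_off f : measurable_fun setT f -> measurable_fun setT (off f).
Proof.
move=> mf; rewrite (_ : off f = (fun w => \1_(~` N) w * f w)); last first.
  apply/funext => w; rewrite indicE; have [h|h] := pselect (N w).
    by rewrite offN// memNset ?mul0r//=; exact: contrapT.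
  by rewrite offF// mem_set//= mul1r.
by apply: measurable_funM => //; apply: measurable_indic; exact: measurableC.
Qed.

(** A process modified on [N] need not stay adapted, [N] being only measurable; martingale relations
    are therefore proved for the original process and carried over by this lemma. *)
Lemma Rintegral_off (f g : T -> R) : P N = 0%E -> measurable_fun setT f ->
  (forall w, N w -> g w = 0) -> (forall w, ~ N w -> g w = f w) ->
  \int[P]_w g w = \int[P]_w f w.
Proof.
move=> N0 mf g0 gf; have -> : g = off f.
  apply/funext => w; have [h|h] := pselect (N w); first by rewrite offN// g0.
  by rewrite offF// gf.
congr fine; apply: ae_eq_integral => //.
- by apply/measurable_EFinP; exact: measurable_off.
- exact/measurable_EFinP.
- exists N; split => // w /=; apply: contra_notP => h _.
  by rewrite /= offF.
Qed.

End off_null_set.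

Lemma Rintegral_ae_le {R : realType} {d : measure_display} {T : measurableType d}
  (P : probability T R) (f g : T -> R) : rint P setT f -> rint P setT g ->
  (forall w, 0 <= g w) -> {ae P, forall w, f w <= g w} ->
  \int[P]_w f w <= \int[P]_w g w.
Proof.
move=> rf rg g0 [N [mN N0 hN]].
have mf := rint_measurable rf.
rewrite -(@Rintegral_off _ _ _ P N mN f (off N f) N0 mf); first last.
- by move=> w; exact: offF.
- by move=> w; exact: offN.
apply: le_Rintegral => //.
  apply: (rint_le _ _ _ (rint_abs measurableT rf)) => //; first exact: measurable_off.
  move=> w _; rewrite /off; case: ifP => // _; by rewrite normr0.
move=> w _; rewrite /off; case: ifPn => // Nw; apply: contrapT => h.
by move/negP: Nw; apply; rewrite inE; exact: hN.
Qed.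

(** * The gap between two points of the flow *)

Section flow_pair.
Context {R : realType} {d : measure_display} {T : measurableType d}.
Variables (P : probability T R) (phi a : R -> R) (X : R -> R -> T -> R -> R).
Hypothesis HF : HarrisFlow P phi a X.
Notation leb := (@lebesgue_measure R).

(** The generating family inside [flow_sigma X 0 t], named so that [<<s flow_gen t >>] is
    convertible to that sigma-algebra and [g_sigma_algebraType] can be formed. *)
Definition flow_gen (t : R) : set (set T) :=
  \bigcup_(p in [set p : R * R * R | 0 <= p.1.1 /\ p.1.1 <= p.1.2 /\ p.1.2 <= t])
     preimage_set_system setT (fun w => X p.1.1 p.1.2 w p.2) measurable.
Notation F := (flow_sigma X 0).

Lemma flow_measurable t z : 0 <= t -> measurable_fun setT (fun w => X 0 t w z).
Proof. by move=> t0; have [_ [h _]] := HF; exact: h. Qed.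

Lemma flow_sigma_measurable t A : 0 <= t -> <<s flow_gen t >> A -> measurable A.
Proof.
move=> t0; apply: (@smallest_sub _ _ (flow_gen t) measurable).
  exact: sigma_algebra_measurable.
move=> B [[[p1 p2] z] /= [p10 [p12 p2t]]] [C mC <-].
by have [_ [h _]] := HF; apply: h.
Qed.

Lemma flow_adapted t z : 0 <= t ->
  measurable_fun setT ((fun w => X 0 t w z) : g_sigma_algebraType (flow_gen t) -> R).
Proof.
move=> t0; apply: adapted_measurable => B mB; apply: sub_sigma_algebra.
by exists (0, t, z) => //=; exists B => //; rewrite setTI.
Qed.

Lemma flow_wiener z : wiener_wrt P 0 (fun t => <<s flow_gen t >>) (flow_w a X z 0).
Proof. by have [_ [_ [_ [_ [_ [_ [_ [_ [_ [h _]]]]]]]]]] := HF; exact: h. Qed.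

Definition flow_bracket z1 z2 t w :=
  \int[leb]_(r in `[0, t]) phi (X 0 r w z1 - X 0 r w z2).

Lemma flow_martingale z1 z2 : martingale_wrt P 0 (fun t => <<s flow_gen t >>)
  (fun t w => flow_w a X z1 0 t w * flow_w a X z2 0 t w - flow_bracket z1 z2 t w).
Proof. by have [_ [_ [_ [_ [_ [_ [_ [_ [_ [_ h]]]]]]]]]] := HF; exact: h. Qed.

Lemma flow_le t w z1 z2 : 0 <= t -> z1 <= z2 -> X 0 t w z1 <= X 0 t w z2.
Proof. by move=> t0 z12; have [h _] := HF; have [h1 _] := h 0 t w (lexx 0) t0; exact: h1. Qed.

Definition regular_path z w := [/\ X 0 0 w = id,
  {within `[0, +oo[, continuous (fun t => flow_w a X z 0 t w)},
  flow_w a X z 0 0 w = 0 &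
  forall t, 0 <= t -> rint leb `[0, t] (fun r => a (X 0 r w z))].

Lemma regular_path_ae z : {ae P, forall w, regular_path z w}.
Proof.
have [W0 [Wc _]] := flow_wiener z.
have [_ [_ [h0 [_ [_ [_ [_ [h1 _]]]]]]]] := HF.
near=> w; split; near: w => //; [exact: h0 (lexx 0)|exact: h1 (lexx 0)].
Unshelve. all: end_near. Qed.

Section pair.
Variables x y : R.
Hypothesis xy : x <= y.
Hypothesis phic : continuous phi.
Hypothesis phi0 : phi 0 = 1.
Hypothesis phi1 : forall z, `|phi z| <= 1.
Variables (rho : R -> R) (Cb : R).
Hypothesis mrho : measurable_fun setT rho.
Hypothesis rho0 : rho 0 = 0.
Hypothesis rhob : forall z, 0 <= z -> 0 <= rho z <= Cb * (1 + z).
Hypothesis arho : forall z h, 0 < h -> `|a (z + h) - a z| <= rho h.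
Variable N : set T.
Hypothesis mN : measurable N.
Hypothesis N0 : P N = 0%E.
Hypothesis Nx : forall w, ~ N w -> regular_path x w.
Hypothesis Ny : forall w, ~ N w -> regular_path y w.

Let W z t w := flow_w a X z 0 t w.
Let D t w := X 0 t w y - X 0 t w x.
Let V t w := W y t w - W x t w.

(* Discarding a null set and freezing at negative times makes every path
   continuous, hence the processes jointly measurable. *)
Definition flow_gap r := off N (D (Num.max r 0)).
Definition flow_gap_mart r := off N (V (Num.max r 0)).

Let regularE z w t : X 0 t w z = W z t w + z + \int[leb]_(r in `[0, t]) a (X 0 r w z).
Proof. by rewrite /W /flow_w; ring. Qed.

Let path_continuous z w : regular_path z w ->
  continuous (fun r : R => X 0 (Num.max r 0) w z).
Proof.
move=> [_ Wc _ ai].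
have -> : (fun r : R => X 0 (Num.max r 0) w z) = (fun r : R => W z (Num.max r 0) w + z +
   \int[leb]_(r in `[0, Num.max r 0]) a (X 0 r w z)) by apply/funext => r; exact: regularE.
move=> r; apply: cvgD; last exact: (clamp_integral_continuous ai).
by apply: cvgD; [exact: (clamp_continuous Wc)|exact: cvg_cst].
Qed.

Let gap_continuous w : continuous (fun r : R => flow_gap r w).
Proof.
have [h|h] := pselect (N w).
  have -> : (fun r : R => flow_gap r w) = cst 0 by apply/funext => r; exact: offN.
  by move=> r; exact: cvg_cst.
have -> : (fun r : R => flow_gap r w) = (fun r => D (Num.max r 0) w).
  by apply/funext => r; exact: offF.
by move=> r; apply: cvgB; apply: path_continuous; [exact: Ny|exact: Nx].
Qed.

Let gap_mart_continuous w : continuous (fun r : R => flow_gap_mart r w).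
Proof.
have [h|h] := pselect (N w).
  have -> : (fun r : R => flow_gap_mart r w) = cst 0 by apply/funext => r; exact: offN.
  by move=> r; exact: cvg_cst.
have -> : (fun r : R => flow_gap_mart r w) = (fun r => V (Num.max r 0) w).
  by apply/funext => r; exact: offF.
have [_ c1 _ _] := Ny h; have [_ c2 _ _] := Nx h.
by move=> r; apply: cvgB; [exact: (clamp_continuous c1)|exact: (clamp_continuous c2)].
Qed.

Let mD t : 0 <= t -> measurable_fun setT (D t).
Proof. by move=> t0; apply: measurable_funB; exact: flow_measurable. Qed.

Let mW z t : 0 <= t -> measurable_fun setT (W z t).
Proof. exact: (wiener_measurable flow_sigma_measurable (flow_wiener z)). Qed.

Let mV t : 0 <= t -> measurable_fun setT (V t).
Proof. by move=> t0; apply: measurable_funB; exact: mW. Qed.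

Let mDF t : 0 <= t -> measurable_fun setT (D t : g_sigma_algebraType (flow_gen t) -> R).
Proof. by move=> t0; apply: measurable_funB; exact: flow_adapted. Qed.

Let gapE r w : 0 <= r -> ~ N w -> flow_gap r w = D r w.
Proof. by move=> r0 h; rewrite /flow_gap offF// max_l. Qed.

Let martE r w : 0 <= r -> ~ N w -> flow_gap_mart r w = V r w.
Proof. by move=> r0 h; rewrite /flow_gap_mart offF// max_l. Qed.

Let gapN r w : N w -> flow_gap r w = 0. Proof. exact: offN. Qed.
Let martN r w : N w -> flow_gap_mart r w = 0. Proof. exact: offN. Qed.

Lemma flow_gap_ge0 r w : 0 <= flow_gap r w.
Proof.
have [h|h] := pselect (N w); first by rewrite gapN.
by rewrite /flow_gap offF// subr_ge0 flow_le// le_max lexx orbT.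
Qed.

Lemma flow_gap_measurable : measurable_fun setT (fun z : R * T => flow_gap z.1 z.2).
Proof.
apply: (continuous_joint_measurable (Y := fun r => off N (D r))).
- by move=> r r0; apply: measurable_off => //; exact: mD.
- exact: gap_continuous.
Qed.

Lemma flow_gap_mart_measurable : measurable_fun setT (fun z : R * T => flow_gap_mart z.1 z.2).
Proof.
apply: (continuous_joint_measurable (Y := fun r => off N (V r))).
- by move=> r r0; apply: measurable_off => //; exact: mV.
- exact: gap_mart_continuous.
Qed.

Let mgapw w : measurable_fun setT (fun r => flow_gap r w).
Proof. exact: (measurable_section1 w flow_gap_measurable). Qed.

(** Subtracting the Wiener parts leaves the time integral of the difference of [a] at the two
    points, which the modulus bounds by [rho] of the gap. *)
Lemma flow_gap_drift u v w : 0 <= u -> u <= v ->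
  `|flow_gap v w - flow_gap u w - (flow_gap_mart v w - flow_gap_mart u w)| <=
  \int[leb]_(r in `[u, v]) rho (flow_gap r w).
Proof.
move=> u0 uv; have v0 := le_trans u0 uv.
have rho_ge0 : 0 <= \int[leb]_(r in `[u, v]) rho (flow_gap r w).
  by apply: Rintegral_ge0 => r _; have /andP[] := rhob (flow_gap_ge0 r w).
have [h|h] := pselect (N w).
  by rewrite !gapN// !martN// !subrr normr0.
rewrite !gapE// !martE//.
have [_ _ _ iy] := Ny h; have [_ _ _ ix] := Nx h.
have sub : `[u, v] `<=` `[0, v] by apply: subset_itv; rewrite bnd_simp.
have jy : rint leb `[u, v] (fun r => a (X 0 r w y)).
  by apply: integrableS (iy v v0).
have jx : rint leb `[u, v] (fun r => a (X 0 r w x)).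
  by apply: integrableS (ix v v0).
have mI : measurable (`[u, v]%classic : set (measurableTypeR R)) by exact: measurable_itv.
have jB := rintB mI jy jx.
have [b bb] := continuous_bounded_itv v0 (@gap_continuous w).
have Cb0 : 0 <= Cb.
  have /andP[h1 h2] := rhob (lexx 0); rewrite addr0 mulr1 in h2; exact: le_trans h2.
have jr : rint leb `[u, v] (fun r => rho (flow_gap r w)).
  apply: (@rint_itv_bounded _ _ _ _ (Cb * (1 + b))).
    by apply: measurable_funTS; exact: (measurableT_comp mrho (mgapw w)).
  move=> r /andP[ur rv]; have g0 := flow_gap_ge0 r w; have /andP[h1 h2] := rhob g0.
  rewrite ger0_norm//; apply: le_trans h2 _; rewrite ler_wpM2l// lerD2l.
  apply: le_trans (ler_norm _) (bb _ _); by rewrite rv (le_trans u0).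
have -> : D v w - D u w - (V v w - V u w) =
   \int[leb]_(r in `[u, v]) (a (X 0 r w y) - a (X 0 r w x)).
  rewrite (RintegralB mI jy jx) /D /V !regularE.
  rewrite (Rintegral_itv_cat u0 uv (iy v v0)) (Rintegral_itv_cat u0 uv (ix v v0)).
  ring.
apply: le_trans (le_normr_Rintegral mI jB) _.
apply: le_Rintegral_itv => //; first exact: rint_abs.
move=> r /andP[ur rv]; have r0 := le_trans u0 ur.
(* [arho] concerns positive shifts only; once the points have met, [rho 0 = 0] closes the case. *)
rewrite gapE// /D; have := flow_le w r0 xy; rewrite le_eqVlt => /predU1P[->|hlt].
  by rewrite !subrr normr0 rho0.
by have := @arho (X 0 r w x) (X 0 r w y - X 0 r w x); rewrite subrKC subr_gt0; apply.
Qed.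

Lemma flow_gap_four u v : 0 <= u -> u < v ->
  size4 P (Num.sqrt (v - u)) (8 * (128 + 128)) (fun w => flow_gap_mart v w - flow_gap_mart u w).
Proof.
move=> u0 uv; have v0 := le_trans u0 (ltW uv).
have sy := wiener_size4 flow_sigma_measurable (flow_wiener y) u0 uv.
have sx := wiener_size4 flow_sigma_measurable (flow_wiener x) u0 uv.
apply: size4_le (size4D sy (size4N sx)).
  by apply: measurable_funB; exact: (measurable_section2 _ flow_gap_mart_measurable).
move=> w; have [h|h] := pselect (N w); first by rewrite !martN// subrr normr0.
rewrite !martE// /V /W le_eqVlt; apply/orP; left; apply/eqP; congr (`|_|); ring.
Qed.

Lemma flow_gap_martingale u v (q : R -> R) b : 0 <= u -> u <= v ->
  measurable_fun setT q -> (forall x, `|q x| <= b) ->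
  \int[P]_w (q (flow_gap u w) * (flow_gap_mart v w - flow_gap_mart u w)) = 0.
Proof.
move=> u0 uv mq qb; have v0 := le_trans u0 uv.
have FMs := flow_sigma_measurable.
have mqD : measurable_fun setT (fun w => q (D u w)) by exact: (measurableT_comp mq (mD u0)).
have mqF : measurable_fun setT ((fun w => q (D u w)) : g_sigma_algebraType (flow_gen u) -> R).
  exact: (measurableT_comp mq (mDF u0)).
have qDb w : `|q (D u w)| <= b by [].
rewrite (@Rintegral_off _ _ _ P N mN (fun w => q (D u w) * (W y v w - W y u w) -
    q (D u w) * (W x v w - W x u w)))//.
- have [C1 s1] := wiener_size4_incr FMs (flow_wiener y) u0 uv.
  have [C2 s2] := wiener_size4_incr FMs (flow_wiener x) u0 uv.
  have [i1 _] := size4_norm ltr01 s1; have [i2 _] := size4_norm ltr01 s2.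
  have j1 := rint_mul_bounded mqD qDb i1.
  have j2 := rint_mul_bounded mqD qDb i2.
  rewrite (RintegralB measurableT j1 j2).
  by rewrite (wiener_incr0 FMs (flow_wiener y) u0 uv mqF j1)
    (wiener_incr0 FMs (flow_wiener x) u0 uv mqF j2) subrr.
- by apply: measurable_funB; apply: measurable_funM => //; apply: measurable_funB; exact: mW.
- by move=> w h; rewrite !martN// subrr mulr0.
- by move=> w h; rewrite !martE// gapE// /V; ring.
Qed.

Let phib z : 0 <= 1 - phi z <= 2.
Proof. by have := phi1 z; rewrite ler_norml => /andP[h1 h2]; apply/andP; split; lra. Qed.

(** Polarisation: the difference of the two Wiener processes has bracket rate
    [phi 0 + phi 0 - 2 * phi], which is twice [1 - phi] at the gap. *)
Lemma flow_gap_quad u v (q : R -> R) b : 0 <= u -> u <= v ->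
  measurable_fun setT q -> (forall x, `|q x| <= b) ->
  \int[P]_w (q (flow_gap u w) * (flow_gap_mart v w - flow_gap_mart u w) ^+ 2) =
  2 * \int[P]_w (q (flow_gap u w) * \int[leb]_(r in `[u, v]) (1 - phi (flow_gap r w))).
Proof.
move=> u0 uv mq qb; have v0 := le_trans u0 uv.
have FMs := flow_sigma_measurable.
have mqD : measurable_fun setT (fun w => q (D u w)) by exact: (measurableT_comp mq (mD u0)).
have mqF : measurable_fun setT ((fun w => q (D u w)) : g_sigma_algebraType (flow_gen u) -> R).
  exact: (measurableT_comp mq (mDF u0)).
have qDb w : `|q (D u w)| <= b by [].
have cov z1 z2 := covariation FMs (flow_wiener z1) (flow_wiener z2) (flow_martingale z1 z2)
  u0 uv mqF qDb.
pose I z1 z2 w := q (D u w) * ((W z1 v w - W z1 u w) * (W z2 v w - W z2 u w)).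
pose J z1 z2 w := q (D u w) * (flow_bracket z1 z2 v w - flow_bracket z1 z2 u w).
have iI z1 z2 : rint P setT (I z1 z2).
  have [C1 s1] := wiener_size4_incr FMs (flow_wiener z1) u0 uv.
  have [C2 s2] := wiener_size4_incr FMs (flow_wiener z2) u0 uv.
  have [i _] := size4M ltr01 ltr01 s1 s2.
  exact: rint_mul_bounded mqD qDb i.
have iJ z1 z2 : rint P setT (J z1 z2) by have [] := cov z1 z2.
have IJ z1 z2 : \int[P]_w I z1 z2 w = \int[P]_w J z1 z2 w by have [] := cov z1 z2.
have iI2 := rintZ measurableT 2 (iI y x).
have iJ2 := rintZ measurableT 2 (iJ y x).
have iIs := rintD measurableT (iI y y) (iI x x).
have iJs := rintD measurableT (iJ y y) (iJ x x).
have iIt := rintB measurableT iIs iI2.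
have iJt := rintB measurableT iJs iJ2.
have iJh := rintZ measurableT 2^-1 iJt.
have main : \int[P]_w (I y y w + I x x w - 2 * I y x w) =
            \int[P]_w (J y y w + J x x w - 2 * J y x w).
  rewrite (RintegralB measurableT iIs iI2) (RintegralB measurableT iJs iJ2).
  rewrite (RintegralD measurableT (iI y y) (iI x x)) (RintegralD measurableT (iJ y y) (iJ x x)).
  by rewrite (RintegralZl _ measurableT (iI y x)) (RintegralZl _ measurableT (iJ y x)) !IJ.
transitivity (\int[P]_w (I y y w + I x x w - 2 * I y x w)).
  apply: (@Rintegral_off _ _ _ P N mN) => //.
  - exact: rint_measurable iIt.
  - by move=> w h; rewrite !martN// subrr expr0n mulr0.
  - by move=> w h; rewrite !martE// gapE// /V /I; ring.
rewrite main.
transitivity (2 * \int[P]_w (2^-1 * (J y y w + J x x w - 2 * J y x w))).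
  rewrite (RintegralZl _ measurableT iJt) mulrA divff ?mul1r// pnatr_eq0.
congr (2 * _); apply/esym; apply: (@Rintegral_off _ _ _ P N mN) => //.
- exact: rint_measurable iJh.
- move=> w h; under eq_Rintegral do rewrite gapN// phi0 subrr.
  by rewrite Rintegral_itv_cst// mul0r mulr0.
move=> w h; rewrite gapE// /J.
have brE z t : 0 <= t -> flow_bracket z z t w = t.
  move=> t0; rewrite /flow_bracket; under eq_Rintegral do rewrite subrr phi0.
  by rewrite Rintegral_itv_cst// mul1r subr0.
rewrite !brE//.
pose g r := phi (flow_gap r w).
have mphi : measurable_fun setT phi by exact: continuous_measurable_fun.
have ig s t : rint leb `[s, t] g.
  apply: (@rint_itv_bounded _ _ _ _ 1); last by move=> r _; exact: phi1.
  by apply: measurable_funTS; exact: (measurableT_comp mphi (mgapw w)).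
have bE t : flow_bracket y x t w = \int[leb]_(r in `[0, t]) g r.
  apply: eq_Rintegral => r; rewrite inE/= in_itv/= => /andP[r0 _].
  by rewrite /g gapE.
have mI : measurable (`[u, v]%classic : set (measurableTypeR R)) by exact: measurable_itv.
rewrite !bE (Rintegral_itv_cat u0 uv (ig 0 v)).
rewrite (RintegralB mI (rint_itv_cst u v 1) (ig u v)) Rintegral_itv_cst// mul1r.
by rewrite /g; field.
Qed.

Lemma flow_diff_proc tau : 0 < tau ->
  diff_proc P tau (y - x) rho (fun z => 1 - phi z) Cb (8 * (128 + 128)) flow_gap flow_gap_mart.
Proof.
move=> tau0; split.
- exact: flow_gap_measurable.
- exact: flow_gap_mart_measurable.
- exact: flow_gap_ge0.
- by move=> w; apply: continuous_bounded_itv; [exact: ltW|exact: gap_continuous].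
- by move=> w; apply: continuous_bounded_itv; [exact: ltW|exact: gap_mart_continuous].
- by move=> u v w u0 uv _; exact: flow_gap_drift.
- move=> w; have [h|h] := pselect (N w); first by rewrite gapN// subr_ge0.
  by rewrite gapE// /D; have [-> _ _ _] := Nx h.
- move=> w; have [h|h] := pselect (N w); first by rewrite martN.
  rewrite martE// /V /W; have [_ _ -> _] := Ny h; have [_ _ -> _] := Nx h.
  by rewrite subrr.
- by move=> u v q b u0 uv _; exact: flow_gap_martingale.
- by move=> u v q b u0 uv _; exact: flow_gap_quad.
- by move=> u v u0 uv _; exact: flow_gap_four.
- exact: mrho.
- by apply: measurable_funB => //; exact: continuous_measurable_fun.
- exact: rhob.
- exact: phib.
Qed.

Lemma alive_flow_gap r : 0 <= r -> alive P flow_gap r = \int[P]_w pos01 (D r w).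
Proof.
move=> r0; apply: (@Rintegral_off _ _ _ P N mN) => //.
- exact: (measurableT_comp (@measurable_pos01 R) (mD r0)).
- by move=> w h; rewrite gapN// /pos01 ltxx.
- by move=> w h; rewrite gapE.
Qed.

(** Absorption: almost surely [X 0 v] factors through [X 0 u], so points that agree at time [u]
    agree at time [v]. The times are arbitrary, which later carries the bound from a short time to
    [t]. *)
Lemma alive_flow_gap_le u v : 0 <= u -> u <= v -> alive P flow_gap v <= alive P flow_gap u.
Proof.
move=> u0 uv; have v0 := le_trans u0 uv.
have iD r : 0 <= r -> rint P setT (fun w => pos01 (D r w)).
  move=> r0; apply: (rint_le _ _ _ (rintP_cst P 1)) => //.
    exact: (measurableT_comp (@measurable_pos01 R) (mD r0)).
  by move=> w _; have /andP[h1 h2] := pos01_bound (D r w); rewrite ger0_norm.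
rewrite !alive_flow_gap//; apply: Rintegral_ae_le; try exact: iD.
  by move=> w; have /andP[] := pos01_bound (D u w).
have [_ [_ [_ [h _]]]] := HF.
apply: filterS (h 0 u v (lexx 0) u0 uv) => w hw.
have := flow_le w u0 xy; rewrite le_eqVlt => /predU1P[e|l].
  by rewrite /D hw /= e subrr /pos01 ltxx.
rewrite [leRHS]/pos01 [(0 < D u w)]subr_gt0 l.
by have /andP[] := pos01_bound (D v w).
Qed.

End pair.
End flow_pair.

(** * Choice of the drift modulus and of the exponents *)

Section parameters.
Context {R : realType}.
Implicit Types (alpha beta x y : R).

(** Positive definiteness is tested on the points 0 and [z], with weights 1 and [s], for [s = 1] and
    [s = -1]. *)
Lemma Phi_star_le1 (phi : R -> R) : Phi_star phi -> forall z, `|phi z| <= 1.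
Proof.
move=> [_ [sym [phi0 [pd _]]]] z; have [->|z0] := eqVneq z 0; first by rewrite phi0 normr1.
have key (s : R) : s ^+ 2 = 1 -> 0 < 2 + 2 * s * phi z.
  move=> s2; have := pd 2 (fun i => if i == ord0 then 0 else z) (fun i => if i == ord0 then 1 else s).
  rewrite !big_ord_recl !big_ord0 /= !subr0 !addr0 !sub0r subrr sym phi0 => h.
  have {}h : 0 < 1 * 1 * 1 + 1 * s * phi z + (s * 1 * phi z + s * s * 1).
    apply: h; last by exists ord0; rewrite oner_neq0.
    move=> i j; case: i => [[|[|?]]] // hi; case: j => [[|[|?]]] // hj /= => e; apply/val_inj => //=.
      by rewrite -e eqxx in z0.
    by rewrite e eqxx in z0.
  by have ss : s * s = 1 by []; move: h; rewrite ss; lra.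
have h1 := key 1 (expr1n _ _); have h2 := key (-1) (etrans (sqrrN 1) (expr1n _ _)).
by rewrite ler_norml; apply/andP; split; lra.
Qed.

(** Takes the place of [rho], which is controlled on positive reals only: an explicit Borel
    function, 0 up to the origin, a power up to [L], affine beyond. *)
Definition drift_modulus (L C b K x : R) : R :=
  if x <= 0 then 0 else if x <= L then C * x `^ b else K * (1 + x).

Lemma measurable_drift_modulus (L C b K : R) : measurable_fun setT (drift_modulus L C b K).
Proof.
apply: measurable_fun_ifT => //.
  exact: measurable_fun_ler.
apply: measurable_fun_ifT => //.
- exact: measurable_fun_ler.
- by apply: measurable_funM => //; exact: measurable_powR.
- by apply: measurable_funM => //; exact: measurable_funD.
Qed.

Lemma powR_le1 x (b c : R) : 0 < x -> x <= 1 -> b <= c -> x `^ c <= x `^ b.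
Proof. by move=> x0 x1 bc; apply: ger_powR => //; rewrite x0. Qed.

Lemma drift_modulus_affine (L C b K x : R) : 0 <= C -> 0 <= K -> K <= C -> L <= 1 -> 0 <= b ->
  0 <= x -> 0 <= drift_modulus L C b K x <= C * (1 + x).
Proof.
move=> C0 K0 KC L1 b0 x0; rewrite /drift_modulus; case: ifPn => [_|].
  by rewrite lexx mulr_ge0// addr_ge0.
rewrite -ltNge => xp; case: ifPn => [xL|_].
  rewrite mulr_ge0 ?powR_ge0//= ler_wpM2l//.
  apply: (@le_trans _ _ 1); last by rewrite lerDl.
  by rewrite -(powRr0 x); apply: powR_le1 => //; exact: le_trans L1.
by rewrite mulr_ge0 ?addr_ge0//= ler_wpM2r// addr_ge0.
Qed.

Lemma exponents alpha beta : 0 < alpha -> alpha < 2 -> -1 < beta - alpha ->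
  exists b a : R, [/\ 0 <= b, b = 0 \/ b <= beta, alpha <= a, a < 2 &
    0 < 1 + b - a < 1 /\ (b = 0 \/ 1 < a)].
Proof.
move=> a0 a2 ba; have [b0|b0] := leP beta 0.
  exists 0, alpha; split => //; first by left.
  by split; [apply/andP; split; lra|left].
pose b := Num.min beta 1.
have bb : b <= beta by rewrite /b ge_min lexx.
have b1 : b <= 1 by rewrite /b ge_min lexx orbT.
have bp : 0 < b by rewrite /b lt_min b0 ltr01.
have ab : alpha < 1 + b by rewrite /b addr_minr lt_min; apply/andP; split; lra.
pose A := Num.max alpha 1.
have A1 : 1 <= A by rewrite /A le_max lexx orbT.
have Aa : alpha <= A by rewrite /A le_max lexx.
have Ab : A < 1 + b by rewrite /A gt_max ab ltrDl.
exists b, ((A + 1 + b) / 2); split; [exact: ltW|by right|lra|lra|].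
by split; [apply/andP; split; lra|right; lra].
Qed.

End parameters.

Section flow_coalescence.
Context {R : realType} {d : measure_display} {T : measurableType d}.
Variables (P : probability T R) (phi a : R -> R) (X : R -> R -> T -> R -> R).
Variables alpha beta : R.
Hypothesis alpha0 : 0 < alpha.
Hypothesis alpha2 : alpha < 2.
Hypothesis ba : -1 < beta - alpha.
Hypothesis Pphi : Phi_alpha alpha phi.
Hypothesis Aa : A_beta beta a.
Hypothesis HF : HarrisFlow P phi a X.

Lemma flow_coalescence t : 0 < t -> exists K, forall x y, x <= y ->
  \int[P]_w pos01 (X 0 t w y - X 0 t w x) <= K * (y - x).
Proof.
move=> t0; have [[phic [_ [phi0 _]]] [Cf [Ct [Cf0 [Ct0 hphi]]]]] := Pphi.
have phi1 := Phi_star_le1 Pphi.1.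
have [_ [rho [Cr [Crt [Cr0 [Crt0 [_ [_ [arho [rho1 rho2]]]]]]]]]] := Aa.
have [b [g [b0 bbeta ag g2 [bg gcase]]]] := exponents alpha0 alpha2 ba.
pose L := Num.min (Num.min Crt 1) Ct.
have L0 : 0 < L by rewrite /L !lt_min Crt0 ltr01 Ct0.
have L1 : L <= 1 by rewrite /L !ge_min lexx orbT.
have LCrt : L <= Crt by rewrite /L !ge_min lexx.
have LCt : L <= Ct by rewrite /L ge_min lexx orbT.
(* On []0, 1]] the affine bound [Cr * (1 + h)] is at most [2 * Cr], the constant needed when
   [b = 0]. *)
pose C := 2 * Cr.
have C0 : 0 < C by rewrite mulr_gt0.
have CrC : Cr <= C by rewrite /C; lra.
pose rt := drift_modulus L C b Cr.
have rt0 : rt 0 = 0 by rewrite /rt /drift_modulus lexx.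
have rtb z : 0 <= z -> 0 <= rt z <= C * (1 + z).
  by move=> z0; apply: drift_modulus_affine => //; exact: ltW.
have rtL z : 0 < z <= L -> rt z <= C * z `^ b.
  by move=> /andP[z0 zL]; rewrite /rt /drift_modulus (leNgt z 0) z0/= zL.
have art z h : 0 < h -> `|a (z + h) - a z| <= rt h.
  move=> h0; apply: le_trans (arho z h h0) _.
  rewrite /rt /drift_modulus (leNgt h 0) h0/=; case: ifPn => [hL|_]; last first.
    by have := rho2 h h0; rewrite gtr0_norm.
  have h1 := le_trans hL L1.
  case: bbeta => [->|bb].
    rewrite powRr0 mulr1; apply: le_trans (rho2 h h0) _.
    by rewrite /C mulrC ler_pM2r// gtr0_norm// -[2]/(1 + 1) lerD2l.
  apply: le_trans (rho1 h h0 (le_trans hL LCrt)) _.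
  by apply: ler_pM; rewrite ?powR_ge0//; [exact: ltW|exact: powR_le1].
have m0 z : 0 <= 1 - phi z by have := phi1 z; rewrite ler_norml subr_ge0 => /andP[].
have mL z : 0 <= z <= L -> Cf * z `^ g <= 1 - phi z.
  move=> /andP[]; rewrite le_eqVlt => /predU1P[<- _|z0 zL].
    by rewrite powR0 ?mulr0// gt_eqF// (lt_le_trans alpha0).
  apply: (@le_trans _ _ (Cf * z `^ alpha)).
    by rewrite ler_pM2l//; apply: powR_le1 => //; exact: le_trans L1.
  by have := hphi z; rewrite gtr0_norm//; apply; exact: le_trans LCt.
have [tau0 tau00 coal] := coalescence_bound P g2 (ltW C0) Cf0 L0 L1 rt0 rtb rtL m0 mL bg gcase.
(* The estimate is proved at this time, short and at most [t]; monotonicity of the survival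
   probability carries it to [t]. *)
pose tau := Num.min tau0 t.
have taup : 0 < tau by rewrite /tau lt_min tau00.
have taut : tau <= t by rewrite /tau ge_min lexx orbT.
have [K hK] : exists K, forall (delta C4 : R) (Y M : R -> T -> R), 0 <= delta ->
    diff_proc P tau delta rt (fun z => 1 - phi z) C C4 Y M ->
    (forall u v, 0 <= u -> u <= v -> v <= tau -> alive P Y v <= alive P Y u) ->
    alive P Y tau <= K * delta.
  by apply: coal; rewrite taup /tau ge_min lexx.
exists K => x y xy.
have [N1 [mN1 N10 hN1]] := regular_path_ae HF x.
have [N2 [mN2 N20 hN2]] := regular_path_ae HF y.
pose N := N1 `|` N2.
have mN : measurable N by exact: measurableU.
have N0 : P N = 0%E by rewrite /N null_set_setU.
have Nx w : ~ N w -> regular_path a X x w.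
  by move=> Nw; apply: contrapT => h; apply: Nw; left; exact: hN1.
have Ny w : ~ N w -> regular_path a X y w.
  by move=> Nw; apply: contrapT => h; apply: Nw; right; exact: hN2.
have DP := flow_diff_proc HF xy phic phi0 phi1
  (measurable_drift_modulus L C b Cr) rt0 rtb art mN N0 Nx Ny taup.
have le1 u v := alive_flow_gap_le HF xy mN N0 (u := u) (v := v).
have := hK _ _ _ _ _ DP; rewrite subr_ge0 => /(_ xy) h.
have {}h : alive P (flow_gap X x y N) tau <= K * (y - x).
  by apply: h => u v u0 uv _; exact: le1.
by rewrite -(@alive_flow_gap _ _ _ _ _ _ _ HF x y N mN N0)//; [apply: le_trans h; apply: le1 => //; exact: ltW|exact: ltW].
Qed.

End flow_coalescence.

(** * Counting the values of the flow *)

Lemma near_all_seq {I : eqType} {T : Type} (F : set_system T) {FF : Filter F}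
  (s : seq I) (Q : I -> T -> Prop) :
  (forall i, i \in s -> \forall x \near F, Q i x) ->
  \forall x \near F, forall i, i \in s -> Q i x.
Proof.
elim: s => [_|i s ih h]; first by apply: nearW => x i.
have h1 : \forall x \near F, Q i x by apply: h; rewrite mem_head.
have h2 : \forall x \near F, forall j, j \in s -> Q j x.
  by apply: ih => j js; apply: h; rewrite in_cons js orbT.
apply: filterS2 h1 h2 => x Qi Qs j; rewrite in_cons => /predU1P[->//|]; exact: Qs.
Qed.

Section grid.
Context {R : realType}.
Variables (f : R -> R) (C : R).
Hypothesis C0 : 0 < C.
Hypothesis f_nd : nondecr_cadlag f.

Definition grid (n k : nat) : R := - C + 2 * C * k%:R / n.+1%:R.

Definition jumps n k := (\sum_(j < k) (f (grid n j) < f (grid n j.+1))%R)%N.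

Lemma le_grid n k l : (k <= l)%N -> grid n k <= grid n l.
Proof.
move=> kl; rewrite lerD2l ler_wpM2r ?invr_ge0// ler_wpM2l ?ler_nat//.
by rewrite mulr_ge0// ltW.
Qed.

Lemma jumps_mono n k l : (k <= l)%N -> (jumps n k <= jumps n l)%N.
Proof.
move=> /subnKC <-; elim: (l - k)%N => [|m ih]; first by rewrite addn0.
by rewrite addnS {2}/jumps big_ord_recr/= (leq_trans ih)// leq_addr.
Qed.

Lemma jumps_lt n k l : (k <= l)%N -> f (grid n k) < f (grid n l) ->
  (jumps n k < jumps n l)%N.
Proof.
move=> /subnKC <-; elim: (l - k)%N => [|m ih]; first by rewrite addn0 ltxx.
rewrite addnS => h; rewrite {2}/jumps big_ord_recr/= -/(jumps n (k + m)).
have [f_mono _] := f_nd.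
have [e|] := leP (f (grid n (k + m))) (f (grid n k)); last first.
  by move=> /ih /leq_trans; apply; rewrite leq_addr.
by rewrite (le_lt_trans e h) addn1 ltnS jumps_mono// leq_addr.
Qed.

(** The first grid point to the right of [x] tends to [x]. Monotonicity keeps [f] there above [f x],
    and right-continuity keeps it below each of the finitely many larger values in [s]. *)
Lemma grid_approx (s : seq R) x : - C <= x <= C ->
  \forall n \near \oo, exists2 k, (k <= n.+1)%N &
    f x <= f (grid n k) /\ forall v, v \in s -> f x < v -> f (grid n k) < v.
Proof.
move=> /andP[xC1 xC2]; have [f_mono f_rc] := f_nd.
have gridN n : grid n n.+1 = C.
  by rewrite /grid mulfK ?pnatr_eq0//; lra.
(* At [x = C] the interval has nothing to the right, but [C] is itself the last grid point. *)
have [xC|xC] := leP C x.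
  have -> : x = C by apply/le_anti; rewrite xC2.
  by apply: nearW => n; exists n.+1 => //; rewrite gridN.
have : \forall z \near at_right x, forall v, v \in s -> f x < v -> f z < v.
  apply: near_all_seq => v vs; have [h|h] := ltP (f x) v; last first.
    exact: nearW.
  have := f_rc x; move=> /(cvgr_lt _) => /(_ _ h) hh.
  by apply: filterS hh.
rewrite /at_right near_withinE => /nbhs_ballP[e /= e0 he].
have : \forall n \near \oo, 2 * C / e < n%:R by exact: nbhs_infty_gtr.
apply: filterS => n hn.
have n1 : 0 < n.+1%:R :> R by rewrite ltr0n.
pose q := (x + C) / (2 * C) * n.+1%:R.
have C2 : 0 < 2 * C by rewrite mulr_gt0.
have q0 : 0 <= q by rewrite mulr_ge0// divr_ge0// ?(ltW C2)//; lra.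
have /andP[t1 t2] := truncn_itv q0.
set k := Num.truncn q in t1 t2.
have qn : q < n.+1%:R by rewrite /q gtr_pMl// ltr_pdivrMr//; lra.
have kn : (k < n.+1)%N by rewrite -(ltr_nat R); exact: le_lt_trans qn.
exists k.+1 => //.
have xq : x = - C + 2 * C * q / n.+1%:R by rewrite /q; field; rewrite !gt_eqF.
have xg : x < grid n k.+1.
  by rewrite [ltLHS]xq ltrD2l ltr_pM2r ?invr_gt0// ltr_pM2l.
split; first by apply: f_mono; exact: ltW.
apply: he => //=.
rewrite /ball/= ltr0_norm ?subr_lt0// opprB [X in _ - X]xq.
have -> : grid n k.+1 - (- C + 2 * C * q / n.+1%:R) = 2 * C * (k.+1%:R - q) / n.+1%:R.
  by rewrite /grid; field; rewrite gt_eqF.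
apply: (@le_lt_trans _ _ (2 * C / n.+1%:R)).
  rewrite ler_wpM2r ?invr_ge0//.
  by rewrite ler_piMr ?(ltW C2)// -natr1; move: t1; lra.
by rewrite ltr_pdivrMr// -ltr_pdivrMl// [ltLHS]mulrC (lt_trans hn)// ltr_nat.
Qed.

(** Sending a value to the number of jumps before its grid point is strictly increasing on [s],
    hence injective into the integers from 0 to the total number of jumps; the count from 0 gives
    the extra 1. *)
Lemma count_le_jumps (s : seq R) : uniq s ->
  (forall v, v \in s -> (f @` `[- C, C]) v) ->
  \forall n \near \oo, (size s <= (jumps n n.+1).+1)%N.
Proof.
move=> us sf.
have : \forall n \near \oo, forall v, v \in s -> exists2 k, (k <= n.+1)%N &
    v <= f (grid n k) /\ forall v', v' \in s -> v < v' -> f (grid n k) < v'.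
  apply: near_all_seq => v /sf[x /=]; rewrite in_itv/= => xC <-; exact: grid_approx.
apply: filterS => n h.
have /choice[k hk] : forall v, exists k, v \in s -> (k <= n.+1)%N /\
    (v <= f (grid n k) /\ forall v', v' \in s -> v < v' -> f (grid n k) < v').
  move=> v; have [vs|vs] := boolP (v \in s); last by exists 0%N.
  by have [k k1 k2] := h v vs; exists k.
have [f_mono _] := f_nd.
have lt_k v v' : v \in s -> v' \in s -> v < v' -> (jumps n (k v) < jumps n (k v'))%N.
  move=> vs vs' vv; have [k1 [k2 k3]] := hk v vs; have [k1' [k2' k3']] := hk v' vs'.
  have flt : f (grid n (k v)) < f (grid n (k v')) by exact: lt_le_trans (k3 _ vs' vv) k2'.
  apply: (jumps_lt _ flt); rewrite leqNgt; apply/negP => /ltnW /(le_grid n) /f_mono.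
  by rewrite leNgt flt.
rewrite -(size_iota 0 (jumps n n.+1).+1) -(size_map (fun v => jumps n (k v))).
apply: uniq_leq_size.
  rewrite map_inj_in_uniq// => v v' vs vs' e.
  by case: (ltgtP v v') => // hv; [have := lt_k _ _ vs vs' hv|have := lt_k _ _ vs' vs hv];
    rewrite e ltnn.
move=> m /mapP[v vs ->]; rewrite mem_iota add0n ltnS; apply: jumps_mono.
by have [] := hk v vs.
Qed.

Lemma le_limn_einf (u : nat -> \bar R) (c : \bar R) :
  (\forall n \near \oo, (c <= u n)%E) -> (c <= limn_einf u)%E.
Proof.
move=> [n0 _ h]; rewrite limn_einf_lim; apply: lime_ge; first exact: is_cvg_einfs.
near=> n; apply: le_ereal_inf_tmp => _ [k /= nk <-]; apply: h => /=.
by apply: leq_trans nk; near: n; exact: nbhs_infty_ge.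
Unshelve. all: end_near. Qed.

Lemma limn_einf_le (u : nat -> \bar R) (c : \bar R) :
  (forall n, (u n <= c)%E) -> (limn_einf u <= c)%E.
Proof.
move=> h; rewrite limn_einf_lim; apply: lime_le; first exact: is_cvg_einfs.
apply: nearW => n; apply: le_trans (h n); apply: ereal_inf_lbound.
by exists n => /=.
Qed.

(** Every finite set of values is counted from some grid on, so the lower limit dominates the size
    of each finite subset of the image; for an infinite image these sizes are unbounded. *)
Lemma img_count_le_jumps :
  (img_count f C <= limn_einf (fun n => ((jumps n n.+1).+1%:R : R)%:E))%E.
Proof.
have main (B : {fset R}) : [set` B] `<=` f @` `[- C, C] ->
    ((#|` B|%fset)%:R%:E <= limn_einf (fun n => ((jumps n n.+1).+1%:R : R)%:E))%E.
  move=> BA; apply: le_limn_einf.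
  apply: filterS (count_le_jumps (fset_uniq B) BA) => n.
  by rewrite lee_fin ler_nat.
rewrite /img_count; case: asboolP => fin.
  apply: main; rewrite fset_setK//.
suff -> : limn_einf (fun n => ((jumps n n.+1).+1%:R : R)%:E) = +oo%E by rewrite leey.
apply/eqyP => A A0.
have [B BA Bn] := infinite_set_fset (Num.truncn A).+1 fin.
apply: le_trans (main B BA); rewrite lee_fin.
by apply: le_trans (ltW (truncnS_gt A)) _; rewrite ler_nat.
Qed.

End grid.

Section counting.
Context {R : realType} {d : measure_display} {T : measurableType d}.

(** The integral of a nonnegative function is a supremum over the simple functions below it, hence
    monotone without measurability. It is applied to [img_count], whose measurability in [w] is not
    established. *)
Lemma ge0_le_integral_nonmeasurable (mu : {measure set T -> \bar R}) (f g : T -> \bar R) :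
  (forall w, (0 <= f w)%E) -> (forall w, (f w <= g w)%E) ->
  (\int[mu]_w f w <= \int[mu]_w g w)%E.
Proof.
move=> f0 fg; have g0 w : (0 <= g w)%E by exact: le_trans (fg w).
rewrite !ge0_integralTE//; apply: ereal_sup_le => _ [h /= hf <-].
by exists h => //= w; exact: le_trans (hf w) (fg w).
Qed.

Variable P : probability T R.

Lemma jumpsE (f : R -> R) C n k : nondecr_cadlag f -> 0 < C ->
  (jumps f C n k)%:R = \sum_(j < k) pos01 (f (grid C n j.+1) - f (grid C n j)) :> R.
Proof.
move=> f_nd C0; rewrite natr_sum; apply: eq_bigr => j _.
by rewrite /pos01 subr_gt0.
Qed.

(** The [n + 1] cells have length [2 * C / (n + 1)] each, so a coalescence bound linear in [y - x]
    sums to [2 * C * K] whatever [n] is, and Fatou's lemma applies. *)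
Lemma img_count_integral (X : T -> R -> R) C K : 0 < C ->
  (forall w, nondecr_cadlag (X w)) -> (forall x, measurable_fun setT (fun w => X w x)) ->
  (forall x y, x <= y -> \int[P]_w pos01 (X w y - X w x) <= K * (y - x)) ->
  (\int[P]_w img_count (X w) C <= (1 + 2 * C * K)%:E)%E.
Proof.
move=> C0 Xnd mX hK.
pose c n w : R := (jumps (X w) C n n.+1).+1%:R.
pose p n (j : 'I_n.+1) w := pos01 (X w (grid C n j.+1) - X w (grid C n j)).
have cE n w : c n w = 1 + \sum_(j < n.+1) p n j w.
  by rewrite /c -nat1r jumpsE.
have ip n j : rint P setT (p n j).
  apply: (rint_le _ _ _ (rintP_cst P 1)) => //.
    apply: (measurableT_comp (@measurable_pos01 R)).
    exact: measurable_funB.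
  by move=> w _; have /andP[h1 h2] := pos01_bound (X w (grid C n j.+1) - X w (grid C n j));
     rewrite ger0_norm.
have iS n : rint P setT (fun w => \sum_(j < n.+1) p n j w) by exact: rint_sum.
have ic n : rint P setT (c n).
  have -> : c n = (fun w => 1 + \sum_(j < n.+1) p n j w) by apply/funext => w.
  by apply: rintD => //; exact: rintP_cst.
have bc n : (\int[P]_w (c n w)%:E <= (1 + 2 * C * K)%:E)%E.
  rewrite -(rint_fineK measurableT (ic n)) lee_fin.
  have -> : \int[P]_w c n w = 1 + \sum_(j < n.+1) \int[P]_w p n j w.
    under eq_Rintegral do rewrite cE.
    by rewrite (RintegralD measurableT (rintP_cst P 1) (iS n)) Rintegral_Pcst Rintegral_sum.
  rewrite lerD2l; apply: (@le_trans _ _ (\sum_(j < n.+1) (2 * C * K / n.+1%:R))).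
    apply: ler_sum => j _; apply: le_trans (hK _ _ (le_grid C0 n (leqnSn j))) _.
    rewrite le_eqVlt; apply/orP; left; apply/eqP.
    by rewrite /grid -natr1; field; rewrite addrC natr1 pnatr_eq0.
  by rewrite sumr_const card_ord -[leLHS]mulr_natr divfK// pnatr_eq0.
have c0 n w : (0 <= (c n w)%:E)%E by rewrite lee_fin.
apply: le_trans (ge0_le_integral_nonmeasurable (g := fun w => limn_einf (fun n => (c n w)%:E)) _ _ _) _.
- by move=> w; rewrite /img_count; case: ifP; rewrite ?leey// lee_fin.
- by move=> w; exact: img_count_le_jumps.
apply: le_trans (fatou _ _ _ _) _ => //.
  by move=> n; apply/measurable_EFinP; exact: rint_measurable (ic n).
exact: limn_einf_le.
Qed.

End counting.

Theorem mainTheorem2 (R : realType) (alpha beta : R) (phi a : R -> R)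
  (d : measure_display) (T : measurableType d) (P : probability T R)
  (X : R -> R -> T -> R -> R) :
  0 < alpha -> alpha < 2 -> -1 < beta - alpha ->
  Phi_alpha alpha phi -> A_beta beta a -> linear_growth a ->
  HarrisFlow P phi a X ->
  forall C t : R, 0 < C -> 0 < t ->
    (\int[P]_w img_count (X 0%R t w) C < +oo)%E.
Proof.
move=> a0 a2 ba Pphi Aa _ HF C t C0 t0.
have [K hK] := flow_coalescence a0 a2 ba Pphi Aa HF t0.
have [Xnd [mX _]] := HF.
apply: le_lt_trans (img_count_integral C0 _ _ hK) (ltry _).
- by move=> w; apply: Xnd => //; exact: ltW.
- by move=> x; apply: mX => //; exact: ltW.
Qed.
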